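(* Let $x\in\mathbb{T}^d$. The following are equivalent: (i) $x\in\mathcal{A}$; (ii) there exists a trajectory-control pair $(\gamma_x,u_x)$ defined on $\mathbb{R}$ (with $\gamma_x$ locally absolutely continuous, $u_x\in L^2_{loc}(\mathbb{R};\mathbb{R}^m)$, $\dot\gamma_x=F(\gamma_x)u_x$ a.e.) with $\gamma_x(0)=x$ such that, for all $t\ge0$, $$h(\gamma_x(t),x)=-\int_0^tL(\gamma_x(s),u_x(s))\,ds+\bar c\,t,\qquad h(x,\gamma_x(-t))=-\int_{-t}^0L(\gamma_x(s),u_x(s))\,ds+\bar c\,t.$$ Moreover, any trajectory $\gamma_x$ as in (ii) satisfies $\gamma_x(t)\in\mathcal{A}$ for all $t\in\mathbb{R}$.
   Context: Setting: $1\le m\le d$, $\mathbb{T}^d=\mathbb{R}^d/\mathbb{Z}^d$. $f_1,\dots,f_m$ smooth vector fields on $\mathbb{T}^d$ satisfying the Hörmander condition; $F(x)=[f_1(x)|\cdots|f_m(x)]$. (F): $F\in C^{1,1}$, rank $F(x)=m$. Admissible pairs: $\gamma$ absolutely continuous, $u\in L^2$, $\dot\gamma=F(\gamma)u$ a.e.; $\Gamma^{x\to y}_{0,t}$ those on $[0,t]$ from $x$ to $y$. (L): $L\in C^2(\mathbb{T}^d\times\mathbb{R}^m)$, $D^2_uL\ge0$, $L(x,u)\ge K_1|u|^\sigma-K_2$ ($\sigma>1$). $H(x,p)=\sup_u\{\langle F^*(x)p,u\rangle-L(x,u)\}$. (S): no singular minimizing controls other than zero for $V^T(x)=\inf\{\int_0^TL(\gamma,u):\gamma(0)=x\}$.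 $\bar c=\lim_{T\to\infty}V^T(x)/T$. $A_t(x,y)=\inf_{\Gamma^{x\to y}_{0,t}}\int_0^tL$. Peierls barrier $h(x,y)=\liminf_{t\to\infty}[A_t(x,y)-\bar c t]$. Projected Aubry set $\mathcal{A}=\{x:h(x,x)=0\}$. Assumptions (F), (L), (S) are in force. *)

(* Defs.v *)
From HB Require Import structures.
From mathcomp Require Import all_boot all_order all_algebra.
From mathcomp Require Import all_classical all_reals all_analysis.
Set Implicit Arguments. Unset Strict Implicit. Unset Printing Implicit Defensive.
Import Order.TTheory GRing.Theory Num.Theory.
Import numFieldNormedType.Exports.
Local Open Scope classical_set_scope.
Local Open Scope ring_scope.

(* Conventions.
   - R^n is represented by row vectors 'rV[R]_n.
   - The torus T^d = R^d / Z^d is represented through lifts: points are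
     vectors of 'rV[R]_d, functions on T^d are Z^d-periodic functions on R^d,
     curves in T^d are (lifted) curves in R^d, and equality of points of T^d
     is congruence modulo Z^d ([torus_eq]). *)

Section Defs.
Variable R : realType.

Definition intvec n (k : 'rV[R]_n) : Prop := forall i, exists z : int, k 0 i = z%:~R.

Definition torus_eq n (x y : 'rV[R]_n) : Prop := intvec (x - y).

Definition Zperiodic n (T : Type) (g : 'rV[R]_n -> T) : Prop :=
  forall x k, intvec k -> g (x + k) = g x.

Definition enorm n (u : 'rV[R]_n) : R := Num.sqrt (\sum_i (u 0 i) ^+ 2).

Definition partial_iter n (V : normedModType R) (g : 'rV[R]_n -> V)
  (s : seq 'I_n) : 'rV[R]_n -> V :=
  foldr (fun i h => fun x => 'D_(delta_mx 0 i) h x) g s.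

Definition Ck n (V : normedModType R) (k : nat) (g : 'rV[R]_n -> V) : Prop :=
  forall s : seq 'I_n, (size s <= k)%N ->
    continuous (partial_iter g s) /\
    ((size s < k)%N -> forall i x, derivable (partial_iter g s) x (delta_mx 0 i)).

Definition smooth n (V : normedModType R) (g : 'rV[R]_n -> V) : Prop :=
  forall k, Ck k g.

Definition C11 n (V : normedModType R) (g : 'rV[R]_n -> V) : Prop :=
  Ck 1 g /\ forall i, exists K : R, forall x y,
    `|'D_(delta_mx 0 i) g x - 'D_(delta_mx 0 i) g y| <= K * `|x - y|.

Definition lie_bracket d (g h : 'rV[R]_d -> 'rV[R]_d) : 'rV[R]_d -> 'rV[R]_d :=
  fun x => 'D_(g x) h x - 'D_(h x) g x.

Inductive iter_bracket d m (f : 'I_m -> 'rV[R]_d -> 'rV[R]_d) :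
  ('rV[R]_d -> 'rV[R]_d) -> Prop :=
| ib_base j : iter_bracket f (f j)
| ib_lie g h : iter_bracket f g -> iter_bracket f h ->
    iter_bracket f (lie_bracket g h).

(* Hoermander condition: at every point the Lie algebra generated by the
   f_j (= linear span of iterated brackets) evaluated at x is all of R^d *)
Definition hormander d m (f : 'I_m -> 'rV[R]_d -> 'rV[R]_d) : Prop :=
  forall (x v : 'rV[R]_d), exists n (g : 'I_n -> 'rV[R]_d -> 'rV[R]_d) (c : 'I_n -> R),
    (forall k, iter_bracket f (g k)) /\ v = \sum_k c k *: g k x.

Definition Fmat d m (f : 'I_m -> 'rV[R]_d -> 'rV[R]_d) (x : 'rV[R]_d) : 'M[R]_(d, m) :=
  \matrix_(i, j) f j x 0 i.

Definition Fapp d m (f : 'I_m -> 'rV[R]_d -> 'rV[R]_d) (x : 'rV[R]_d) (u : 'rV[R]_m)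
  : 'rV[R]_d := (Fmat f x *m u^T)^T.

Definition abs_cont (g : R -> R) (a b : R) : Prop :=
  forall e : R, 0 < e -> exists2 delta : R, 0 < delta &
    forall s : seq (R * R),
      all (fun p : R * R => (a <= p.1) && (p.1 <= p.2) && (p.2 <= b)) s ->
      pairwise (fun p q : R * R => (p.2 <= q.1) || (q.2 <= p.1)) s ->
      \sum_(p <- s) (p.2 - p.1) < delta ->
      \sum_(p <- s) `|g p.2 - g p.1| < e.

Definition abs_cont_vec n (g : R -> 'rV[R]_n) (a b : R) : Prop :=
  forall i, abs_cont (fun s => g s 0 i) a b.

Definition L2 n (u : R -> 'rV[R]_n) (a b : R) : Prop :=
  forall i, measurable_fun `[a, b] (fun s => u s 0 i) /\
    (\int[lebesgue_measure]_(s in `[a, b]) ((u s 0 i) ^+ 2)%:E < +oo)%E.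

Definition admissible d m (f : 'I_m -> 'rV[R]_d -> 'rV[R]_d) (a b : R)
  (gamma : R -> 'rV[R]_d) (u : R -> 'rV[R]_m) : Prop :=
  abs_cont_vec gamma a b /\ L2 u a b /\
  {ae lebesgue_measure, forall s, s \in `[a, b] ->
      is_derive s (1 : R) gamma (Fapp f (gamma s) (u s))}.

Definition cost d m (L : 'rV[R]_d -> 'rV[R]_m -> R) (a b : R)
  (gamma : R -> 'rV[R]_d) (u : R -> 'rV[R]_m) : \bar R :=
  (\int[lebesgue_measure]_(s in `[a, b]) (L (gamma s) (u s))%:E)%E.

Definition valueV d m (f : 'I_m -> 'rV[R]_d -> 'rV[R]_d) (L : 'rV[R]_d -> 'rV[R]_m -> R)
  (T : R) (x : 'rV[R]_d) : \bar R :=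
  ereal_inf [set cost L 0 T p.1 p.2 | p in
    [set p : (R -> 'rV[R]_d) * (R -> 'rV[R]_m) | admissible f 0 T p.1 p.2 /\ p.1 0 = x]].

Definition actionA d m (f : 'I_m -> 'rV[R]_d -> 'rV[R]_d) (L : 'rV[R]_d -> 'rV[R]_m -> R)
  (t : R) (x y : 'rV[R]_d) : \bar R :=
  ereal_inf [set cost L 0 t p.1 p.2 | p in
    [set p : (R -> 'rV[R]_d) * (R -> 'rV[R]_m) |
       admissible f 0 t p.1 p.2 /\ p.1 0 = x /\ torus_eq (p.1 t) y]].

Definition peierls d m (f : 'I_m -> 'rV[R]_d -> 'rV[R]_d) (L : 'rV[R]_d -> 'rV[R]_m -> R)
  (cbar : R) (x y : 'rV[R]_d) : \bar R :=
  ereal_sup [set ereal_inf [set (actionA f L t x y - (cbar * t)%:E)%E | t in [set t | M <= t]]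
            | M in [set: R]].

Definition aubry d m (f : 'I_m -> 'rV[R]_d -> 'rV[R]_d) (L : 'rV[R]_d -> 'rV[R]_m -> R)
  (cbar : R) (x : 'rV[R]_d) : Prop :=
  peierls f L cbar x x = 0%E.

(* image of the differential of the end-point map  v |-> xi(T), where xi
   solves the linearized control system along (gamma,u):
     xi' = sum_j u_j (Df_j(gamma)) xi + F(gamma) v,  xi(0) = 0 *)
Definition lin_endpoint_image d m (f : 'I_m -> 'rV[R]_d -> 'rV[R]_d) (T : R)
  (gamma : R -> 'rV[R]_d) (u : R -> 'rV[R]_m) : set 'rV[R]_d :=
  [set xi T | xi in [set xi : R -> 'rV[R]_d | exists v : R -> 'rV[R]_m,
     L2 v 0 T /\ abs_cont_vec xi 0 T /\ xi 0 = 0 /\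
     {ae lebesgue_measure, forall s, s \in `[0, T] ->
        is_derive s (1 : R) xi
          (\sum_j (u s 0 j) *: 'D_(xi s) (f j) (gamma s) + Fapp f (gamma s) (v s))}]].

Definition singular_control d m (f : 'I_m -> 'rV[R]_d -> 'rV[R]_d) (T : R)
  (gamma : R -> 'rV[R]_d) (u : R -> 'rV[R]_m) : Prop :=
  lin_endpoint_image f T gamma u != setT.

Definition hypS d m (f : 'I_m -> 'rV[R]_d -> 'rV[R]_d) (L : 'rV[R]_d -> 'rV[R]_m -> R) : Prop :=
  forall (T : R) (x : 'rV[R]_d) (gamma : R -> 'rV[R]_d) (u : R -> 'rV[R]_m),
    0 < T -> admissible f 0 T gamma u -> gamma 0 = x ->
    cost L 0 T gamma u = valueV f L T x ->
    singular_control f T gamma u ->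
    {ae lebesgue_measure, forall s, s \in `[0, T] -> u s = 0}.

Definition Lhat d m (L : 'rV[R]_d -> 'rV[R]_m -> R) : 'rV[R]_(d + m) -> R :=
  fun z => L (lsubmx z) (rsubmx z).

Definition hypL d m (L : 'rV[R]_d -> 'rV[R]_m -> R) : Prop :=
  [/\ Ck 2 (Lhat L),
      (forall u, Zperiodic (fun x => L x u)),
      (forall x u v, 0 <= 'D_v (fun w => 'D_v (L x) w) u) &
      exists sigma K1 K2 : R, [/\ 1 < sigma, 0 < K1 &
        forall x u, K1 * (enorm u) `^ sigma - K2 <= L x u]].

Definition hypF d m (f : 'I_m -> 'rV[R]_d -> 'rV[R]_d) : Prop :=
  [/\ (forall j, smooth (f j)),
      (forall j, Zperiodic (f j)),
      hormander f,
      (forall j, C11 (f j)) &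
      (forall x, \rank (Fmat f x) = m)].

Definition critical_value d m (f : 'I_m -> 'rV[R]_d -> 'rV[R]_d)
  (L : 'rV[R]_d -> 'rV[R]_m -> R) (cbar : R) : Prop :=
  forall x, (valueV f L T x * (T^-1)%:E)%E @[T --> +oo] --> cbar%:E.

Definition calibrated_at d m (f : 'I_m -> 'rV[R]_d -> 'rV[R]_d)
  (L : 'rV[R]_d -> 'rV[R]_m -> R) (cbar : R) (x : 'rV[R]_d)
  (gamma : R -> 'rV[R]_d) (u : R -> 'rV[R]_m) : Prop :=
  (forall a b, a <= b -> admissible f a b gamma u) /\ gamma 0 = x /\
  forall t, 0 <= t ->
    peierls f L cbar (gamma t) x = (- cost L 0 t gamma u + (cbar * t)%:E)%E /\
    peierls f L cbar x (gamma (- t)) = (- cost L (- t) 0 gamma u + (cbar * t)%:E)%E.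

End Defs.

(* Main.v *)
Require Import Defs.
From HB Require Import structures.
From mathcomp Require Import all_boot all_order all_algebra.
From mathcomp Require Import all_classical all_reals all_analysis.
From mathcomp Require Import measurable_realfun ring lra.
Import Order.TTheory GRing.Theory Num.Theory.
Import numFieldNormedType.Exports.
Local Open Scope classical_set_scope.
Local Open Scope ring_scope.

Set Implicit Arguments. Unset Strict Implicit. Unset Printing Implicit Defensive.

(** Call the integral of [L - cbar] along a curve its action. Everything rests on the fact that no
    closed curve of the torus has negative action: running around it many times would bring V^T/T
    below [cbar] ([loop_ge0]). Closing an admissible arc from gamma(a) to gamma(b) by return curves
    then shows that h(gamma(b), gamma(a)) is at least minus the action of the arc ([peierls_ge]);
    calibration is equality here.

    If x lies in the Aubry set, there are loops at x whose durations T_n tend to infinity and whose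
    actions a_n tend to 0. Two turns of each are placed on [-T_n, T_n], and a limit curve g, with a
    limit l of the running actions, is taken along an ultrafilter ([aubry_curve]). For p <= 0 and p
    <= q, the rest of the n-th loop leads from near g(q) to near g(p) with action close to l(p) -
    l(q); the two gaps are bridged by arcs of arbitrarily small cost, so h(g(q), g(p)) <= l(p) -
    l(q). The action of g on [p, q] does not exceed l(q) - l(p), so this meets the lower bound and g
    is calibrated. Conversely, calibration at t = 0 reads h(x, x) = 0. Finally, equality for a
    single arc provides long loops of small action through both of its ends, which puts both ends in
    the Aubry set ([calibrated_diag]).

    Compactness. Admissible controls are only square integrable. By superlinear growth of L, slowing
    fast pieces down to unit speed does not increase the action ([L_slow_down]); it lengthens the
    curve, which is harmless for a lower limit over long times. The resulting curves are described
    by [wk], a condition on pairs of times that is stable under concatenation ([step_cat], by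
    convexity) and pointwise limits ([step_limit]). [admissible_wk] leads from admissible pairs to
    such curves. [wk_admissible] leads back: a Lipschitz curve is differentiable almost everywhere,
    a left inverse of F recovers its control, and [wk_cost] compares its cost with the running
    action.

    Short connections ([local_reach]). This is the Chow-Rashevskii theorem with control of the time.
    Flows of the fields f_j act on functions by formal exponentials of differential operators, and a
    group commutator has the Lie bracket as leading term ([dvdX_commutator], [moves_bracket]). The
    Hoermander condition supplies, for every direction, a bracket motion correlated with it
    ([spanning_motions_near]). Moving along it shrinks the distance to a target by a fixed factor
    ([descent_step]), and the times spent form a geometric series. *)

(** * Lipschitz functions of one variable are differentiable almost everywhere *)

Section LipschitzDerivable.
Variable R : realType.
Notation mu := (@lebesgue_measure R).

Lemma ae_mono (P Q : R -> Prop) :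
  {ae mu, forall x, P x} -> (forall x, P x -> Q x) -> {ae mu, forall x, Q x}.
Proof.
by move=> HP PQ; apply: negligibleS HP => x /= nQ nP; apply: nQ; exact: PQ.
Qed.

Lemma ae_mono2 (P P' Q : R -> Prop) :
  {ae mu, forall x, P x} -> {ae mu, forall x, P' x} ->
  (forall x, P x -> P' x -> Q x) -> {ae mu, forall x, Q x}.
Proof.
move=> HP HP' PQ; apply: negligibleS (negligibleU HP HP') => x /= nQ.
by apply: contrapT => /not_orP[/contrapT Px /contrapT P'x]; apply: nQ; exact: PQ.
Qed.

Lemma lipschitz_cts (g : R -> R) (M : R) :
  (forall x y, `|g x - g y| <= M * `|x - y|) -> continuous g.
Proof.
move=> lip x; apply/cvgrPdist_le => e e0.
have M1 : 0 < `|M| + 1 by rewrite ltr_wpDl.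
near=> y; apply: (le_trans (lip _ _)).
apply: (@le_trans _ _ ((`|M| + 1) * `|x - y|)).
  by rewrite ler_wpM2r// (le_trans (ler_norm _))// lerDl.
rewrite -ler_pdivlMl// mulrC.
near: y; apply: cvgr_dist_le; first exact: cvg_id.
by rewrite divr_gt0.
Unshelve. all: by end_near. Qed.

Lemma stieltjes_itv_oc (h : cumulative R R) (a b : R) : a <= b ->
  lebesgue_stieltjes_measure h `]a, b]%classic = (h b - h a)%:E.
Proof.
move=> ab; rewrite /lebesgue_stieltjes_measure/= /measure_extension.
by rewrite measurable_mu_extE/= ?wlength_itv_bnd//; exact: is_ocitv.
Qed.

Section Density.
Variables (g : R -> R) (M : R).
Hypotheses (M0 : 0 <= M) (nd : {homo g : x y / x <= y})
  (lip : forall x y, x <= y -> g y - g x <= M * (y - x)).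

Let lipn x y : `|g x - g y| <= M * `|x - y|.
Proof.
have [xy|/ltW yx] := leP x y.
  by rewrite distrC (distrC x) !ger0_norm ?subr_ge0 ?lip ?nd.
by rewrite !ger0_norm ?subr_ge0 ?lip ?nd.
Qed.

Let g_rc : forall x, g @ at_right x --> g x.
Proof. by move=> x; apply: cvg_at_right_filter; exact: (lipschitz_cts lipn). Qed.

Let g2 x := M * x - g x.

Let g2_nd : {homo g2 : x y / x <= y}.
Proof. by move=> x y xy; have := lip xy; rewrite /g2; lra. Qed.

Let g2_rc : forall x, g2 @ at_right x --> g2 x.
Proof.
move=> x; apply: cvg_at_right_filter; apply: cvgB; last exact: (lipschitz_cts lipn).
by apply: cvgM; [exact: cvg_cst|exact: cvg_id].
Qed.

HB.instance Definition _ := isCumulative.Build R _ R g nd g_rc.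
HB.instance Definition _ := isCumulative.Build R _ R g2 g2_nd g2_rc.

Let mg := lebesgue_stieltjes_measure g.
Let mg2 := lebesgue_stieltjes_measure g2.

Let gM x := M * x.

Let gM_nd : {homo gM : x y / x <= y}.
Proof. by move=> x y xy; rewrite /gM ler_wpM2l. Qed.

Let gM_rc : forall x, gM @ at_right x --> gM x.
Proof.
move=> x; apply: cvg_at_right_filter.
by apply: cvgM; [exact: cvg_cst|exact: cvg_id].
Qed.

HB.instance Definition _ := isCumulative.Build R _ R gM gM_nd gM_rc.

Let mgM := lebesgue_stieltjes_measure gM.

(** The function [M * x] is the sum of the nondecreasing functions [g] and [g2], so the Stieltjes
    measure of [g] is a summand of [M] times Lebesgue measure. Both identities between measures
    follow from uniqueness of the extension from half-open intervals. *)
Let mg_le A : measurable A -> (mg A <= M%:E * mu A)%E.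
Proof.
move=> mA; pose Mn : {nonneg R} := NngNum M0.
have <- : mgM A = (M%:E * mu A)%E.
  rewrite -[RHS]/(mscale Mn mu A).
  apply: (@lebesgue_stieltjes_measure_unique _ gM (mscale Mn mu)) => // X /ocitvP[->|[[a b]/= ab ->]].
    by rewrite !measure0.
  rewrite stieltjes_itv_oc ?ltW//= /mscale/= lebesgue_measure_itv/= lte_fin ab.
  by rewrite -EFinB -EFinM; congr EFin; rewrite /gM mulrBr.
have -> : mgM A = (mg A + mg2 A)%E.
  transitivity (measure_add mg mg2 A); last exact: measure_addE.
  apply: (@lebesgue_stieltjes_measure_unique _ gM (measure_add mg mg2)) => // X /ocitvP[->|[[a b]/= ab ->]].
    by rewrite !measure0.
  transitivity (mg `]a, b]%classic + mg2 `]a, b]%classic)%E; last exact/esym/measure_addE.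
  rewrite /mg /mg2 !stieltjes_itv_oc ?ltW//= -EFinD; congr EFin.
  by rewrite /gM /g2; ring.
by rewrite leeDl.
Qed.

(** By [mg_le] the Stieltjes measure of [g] on []a, b]] is absolutely continuous. Its Radon-Nikodym
    density integrates over []a, y]] to [g y - g a], and Lebesgue differentiation applies. *)
Lemma nondecreasing_lipschitz_ae_derivable_itv (a b : R) : a < b ->
  {ae mu, forall x, a < x < b -> derivable g x 1}.
Proof.
move=> ab.
pose D : set R := `]a, b]%classic.
have mD : measurable (D : set (measurableTypeR R)) by exact: measurable_itv.
have mgD : (mg D < +oo)%E by rewrite /mg stieltjes_itv_oc ?ltW// ltry.
pose nu := mfrestr mD mgD.
have numu : nu `<< mu.
  apply/null_content_dominatesP => A mA A0.
  apply/eqP; rewrite eq_le measure_ge0 andbT.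
  apply: le_trans (mg_le (measurableI _ _ mA mD)) _.
  rewrite (_ : mu (A `&` D) = 0%E) ?mule0//.
  apply/eqP; rewrite eq_le measure_ge0 andbT -A0.
  by apply: le_measure; rewrite ?inE//; exact: measurableI.
have [f [f0 ffin intf fE]] := radon_nikodym_sigma_finite numu.
pose r := fine \o f.
have rE x : (r x)%:E = f x by rewrite /r/= fineK.
have intr : mu.-integrable setT (EFin \o r).
  by apply: eq_integrable intf => // x _; rewrite /= rE.
have locr : locally_integrable setT r.
  by apply: open_integrable_locally => //; exact: openT.
have intr' y : mu.-integrable [set` Interval (BRight a) (BRight y)] (EFin \o r).
  by apply: integrableS intr.
apply: (ae_mono (FTC1 intr' locr)).
move=> x /= H /andP[ax xb].
have [dF _] := H ax.
apply: (@near_eq_derivable _ _ _ (fun y => (\int[mu]_(t in [set` Interval (BRight a) (BRight y)]) r t) + cst (g a) y)).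
  near=> y.
  have ay : a < y by near: y; exact: lt_nbhsr.
  have yb : y < b by near: y; exact: lt_nbhsl.
  rewrite /Rintegral /=.
  have -> : (\int[mu]_(t in `]a, y]) (r t)%:E)%E = (g y - g a)%:E.
    under eq_integral do rewrite rE.
    rewrite -fE//= /nu /mfrestr /mrestr /D -stieltjes_itv_oc ?ltW//.
    congr (mg _); apply/seteqP; split => z /=; rewrite !in_itv/=; first by case.
    by move=> /andP[az zy]; split; rewrite az/= ?zy// (le_trans zy)// ltW.
  by rewrite /= subrK.
by apply: derivableD => //; exact: derivable_cst.
Unshelve. all: by end_near. Qed.

End Density.

(** Adding [M * x] makes [g] nondecreasing and keeps it Lipschitz; countably many bounded intervals
    exhaust the line. *)
Lemma lipschitz_ae_derivable (g : R -> R) (M : R) :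
  (forall x y, `|g x - g y| <= M * `|x - y|) ->
  {ae mu, forall x, derivable g x 1}.
Proof.
move=> lip.
have M0 : 0 <= M.
  by have := lip 1 0; rewrite subr0 normr1 mulr1; apply: le_trans.
pose h x := g x + M * x.
have hnd : {homo h : x y / x <= y}.
  move=> x y xy; rewrite /h.
  have := lip x y; rewrite (distrC x) (ger0_norm (_ : 0 <= y - x)) ?subr_ge0//.
  by move/ler_normlP => [_]; lra.
have hlip x y : x <= y -> h y - h x <= (2 * M) * (y - x).
  move=> xy; rewrite /h.
  have := lip y x; rewrite (ger0_norm (_ : 0 <= y - x)) ?subr_ge0//.
  by move/ler_normlP => [_]; lra.
have M20 : 0 <= 2 * M by rewrite mulr_ge0.
have key n : {ae mu, forall x, - n.+1%:R < x < n.+1%:R -> derivable h x 1}.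
  apply: (nondecreasing_lipschitz_ae_derivable_itv M20 hnd hlip).
  by rewrite (lt_trans (_ : _ < 0))// ltrNl oppr0.
apply: (ae_mono (ae_foralln key)).
move=> x H.
have [n xn] : exists n : nat, `|x| < n.+1%:R.
  exists (Num.trunc `|x|); exact: truncnS_gt.
have := H n; rewrite -ltr_norml => /(_ xn) dh.
rewrite (_ : g = h \- (fun y => M * y)); last first.
  by apply/funext => y /=; rewrite /h addrK.
by apply: derivableB => //; apply: derivableM => //; exact: derivable_cst.
Qed.

End LipschitzDerivable.

(** * The fundamental theorem of calculus for absolutely continuous functions *)

Section AbsolutelyContinuous.
Variable R : realType.
Notation mu := (@lebesgue_measure R).

(* Cousin's lemma in inductive form *)
Lemma interval_induction (P : R -> R -> Prop) (a b : R) : a <= b ->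
  (forall p q r, p <= q -> q <= r -> P p q -> P q r -> P p r) ->
  (forall s, a <= s <= b -> exists2 d, 0 < d &
     forall p q, a <= p -> p <= s -> s <= q -> q <= b ->
       s - d < p -> q < s + d -> P p q) ->
  P a b.
Proof.
move=> ab Padd Ploc.
pose S := [set t | a <= t <= b /\ P a t].
have Paa : P a a.
  have [|d d0 +] := Ploc a; first by rewrite lexx.
  by apply; rewrite ?lexx// ?ltrBlDr ltrDl.
have Sa : S a by split; rewrite ?lexx.
have hS : has_sup S.
  by split; [exists a|exists b => t [/andP[]]].
have aS : a <= sup S by apply: ub_le_sup => //; exact: hS.2.
have Sb : sup S <= b by apply: ge_sup; [exists a|move=> t [/andP[]]].
have [|d d0 Pd] := Ploc (sup S); first by rewrite aS.
have [t [/andP[at_ tb] Pat] St] := sup_adherent d0 hS.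
have tS : t <= sup S by apply: ub_le_sup; [exact: hS.2|split=> //; rewrite at_].
have [bS|Sltb] := leP b (sup S).
  have e : sup S = b by apply/eqP; rewrite eq_le Sb.
  move: Pd tS St; rewrite e => Pd tS St.
  by apply: (Padd a t b) => //; apply: Pd; rewrite ?ltrDl.
(* Were the supremum below [b], the local property there would carry [P a] beyond it. *)
pose q := Num.min b (sup S + d / 2).
have Sq : sup S < q by rewrite lt_min Sltb ltrDl divr_gt0.
have qd : q < sup S + d.
  by rewrite gt_min ltrD2l ltr_pdivrMr// ltr_pMr// ltr1n orbT.
have Pq : P a q.
  apply: (Padd a t q) => //; first by rewrite (le_trans tS)// ltW.
  by apply: Pd => //; [exact: ltW|rewrite ge_min lexx].
have : q <= sup S.
  apply: ub_le_sup; first exact: hS.2.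
  by split=> //; rewrite (le_trans aS (ltW Sq))/= ge_min lexx.
by rewrite leNgt Sq.
Qed.

Lemma Rintegral_split (r : R -> R) (a m b : R) : a <= m -> m <= b ->
  mu.-integrable `[a, b] (EFin \o r) ->
  \int[mu]_(t in `[a, b]) r t =
    \int[mu]_(t in `[a, m]) r t + \int[mu]_(t in `[m, b]) r t.
Proof.
move=> am mb ri.
have := @Rintegral_itvB R r (BLeft a) (BRight b) m ri.
rewrite !bnd_simp => /(_ am mb) e; rewrite -(Rintegral_itv_obnd_cbnd (r := m)).
  by rewrite -e; ring.
by apply: integrableS ri => //; apply: subset_itvr.
Qed.

Lemma is_derive_dist (h : R -> R) (s e : R) : 0 < e -> is_derive s 1 h 0 ->
  exists2 d, 0 < d & forall t, `|t - s| < d -> `|h t - h s| <= e * `|t - s|.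
Proof.
move=> e0 [dh hd].
have : (fun z => z^-1 *: ((h \o shift s) (z *: 1) - h s)) @ 0^' --> 'D_1 h s by exact: dh.
rewrite hd.
move/cvgrPdist_le => /(_ e e0) [d /= d0 H].
exists d => // t td.
have [->|ts] := eqVneq t s; first by rewrite !subrr normr0 mulr0.
have /= := H (t - s).
rewrite !sub0r normrN /= => /(_ td).
rewrite subr_eq0 => /(_ ts).
rewrite normrN normrZ normfV scaler1 subrK.
by rewrite mulrC ler_pdivrMr// normr_gt0 subr_eq0.
Qed.

Lemma open_ball_R (O : set R) (s : R) : open O -> O s ->
  exists2 d, 0 < d & forall t, `|t - s| < d -> O t.
Proof.
move=> oO Os; have /nbhs_ballP[d /= d0 H] := open_nbhs_nbhs (conj oO Os).
by exists d => // t td; apply: H; rewrite /ball/= distrC.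
Qed.


Let I (r : R -> R) (D : set R) a b := \int[mu]_(t in D `&` `]a, b]) r t.

Let mIoc (O : set R) (a b : R) : open O -> measurable (O `&` `]a, b]%classic : set (measurableTypeR R)).
Proof. by move=> oO; apply: measurableI; [exact: open_measurable|exact: measurable_itv]. Qed.

Let IocU (a m b : R) : a <= m -> m <= b ->
  `]a, m] `|` `]m, b] = `]a, b]%classic.
Proof.
move=> am mb; apply/seteqP; split => x /=; rewrite !in_itv/=.
  by move=> [/andP[ax xm]|/andP[mx xb]]; rewrite ?ax ?xb ?(le_trans xm) ?(le_lt_trans am).
move=> /andP[ax xb].
by have [xm|mx] := leP x m; [left; rewrite ax|right].
Qed.

Let IocI (O : set R) (a m b : R) : (O `&` `]a, m]) `&` (O `&` `]m, b]) = set0.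
Proof.
apply/seteqP; split => // x [[_ /=]] + [_ /=].
by rewrite !in_itv/= => /andP[_ xm] /andP[+ _]; rewrite ltNge xm.
Qed.

Let I_split (r : R -> R) (D : set R) a m b : open D -> a <= m -> m <= b ->
  mu.-integrable setT (EFin \o r) ->
  I r D a b = I r D a m + I r D m b.
Proof.
move=> oD am mb ri; rewrite /I -Rintegral_setU; first last.
- by rewrite disj_set2E IocI.
- by apply: integrableS ri => //; apply: measurableU; exact: mIoc.
- exact: mIoc.
- exact: mIoc.
by rewrite -setIUr IocU.
Qed.

(** Around points outside [N] the increments of [h] are at most [e] times the length. Around points
    of [N] the intervals lie in an open set [O] of small measure, where absolute continuity of [g]
    and of the integral of [r] makes the total increment small. Interval induction glues both kinds
    of intervals. *)
Lemma abs_cont_constant (h g r : R -> R) (N : set R) (a b : R) : a <= b ->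
  abs_cont g a b -> mu.-integrable setT (EFin \o r) ->
  (forall p q, a <= p -> p <= q -> q <= b ->
    h q - h p = g q - g p - \int[mu]_(t in `]p, q]) r t) ->
  mu.-negligible N ->
  (forall s, a <= s <= b -> ~ N s -> is_derive s 1 h 0) ->
  h b = h a.
Proof.
move=> ab gac ri hE [N' [mN' N'0 NN']] hd.
apply/eqP; rewrite -subr_eq0 -normr_le0; apply/ler_addgt0Pr => e0 e00; rewrite add0r.
have ba0 : 0 < b - a + 2 by rewrite ltr_wpDl ?subr_ge0.
(* The three errors, [e * (b - a)] off [N], [e] from [g] and [e] from the integral, add up to
   [e0]. *)
pose e := e0 / (b - a + 2).
have ep : 0 < e by rewrite divr_gt0.
have [d1 d10 gd] := gac e ep.
have [d2 [d20 rd]] := integral_normr_continuous ri ep.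
have [|||O [oO NO muOlt]] := @lebesgue_regularity_outer _ N' (Num.min d1 d2).
- by [].
- by apply: (@le_lt_trans _ _ 0%E); rewrite ?ltry//; move: N'0 => /= ->.
- by rewrite lt_min d10.
pose muO p q := fine (mu (O `&` `]p, q]%classic)).
have {}muO' : (mu O < (Num.min d1 d2)%:E)%E.
  have mO : measurable (O : set (measurableTypeR R)) by exact: open_measurable.
  apply: le_lt_trans muOlt.
  have -> : mu O = (mu (O `\` N') + mu (O `&` N'))%E.
    by apply: measureDI.
  rewrite (_ : mu (O `&` N') = 0%E) ?adde0//.
  apply/eqP; rewrite eq_le measure_ge0 andbT; move: (N'0) => <-.
  by apply: le_measure; rewrite ?inE//; exact: measurableI.
(* The list [s] collects the intervals chosen inside [O]. Bounding their total length by the measure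
   of [O] within []p, q]] makes the property additive in [p], [q]. *)
pose ok p q (s : seq (R * R)) :=
  [/\ all (fun z : R * R => (p <= z.1) && (z.1 <= z.2) && (z.2 <= q)) s,
      pairwise (fun z z' : R * R => (z.2 <= z'.1) || (z'.2 <= z.1)) s,
      \sum_(z <- s) (z.2 - z.1) <= muO p q &
      `|h q - h p| <= e * (q - p) + \sum_(z <- s) `|g z.2 - g z.1| +
          I (fun t => `|r t|) O p q].
have rni : mu.-integrable setT (EFin \o (fun t => `|r t|)).
  exact: integrable_norm.
have muOfin p q : mu (O `&` `]p, q]%classic) \is a fin_num.
  rewrite ge0_fin_numE ?measure_ge0//.
  apply: le_lt_trans (lt_trans muO' (ltry _)).
  by apply: le_measure; rewrite ?inE//; [exact: mIoc|exact: open_measurable].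
have muO_split p m q : p <= m -> m <= q -> muO p q = muO p m + muO m q.
  move=> pm mq; rewrite /muO -fineD// -measureU; [|exact: mIoc|exact: mIoc|exact: IocI].
  by rewrite -setIUr IocU.
have [s [sab sd sl hs]] : exists s, ok a b s.
  pose P p q := p <= q -> a <= p -> q <= b -> exists s, ok p q s.
  suff : P a b by apply.
  apply: (interval_induction ab).
    move=> p q r' pq qr Ppq Pqr pr ap rb.
    have [||s [s1 s2 s3 s4]] := Ppq pq => //; first by rewrite (le_trans qr).
    have [||s' [s'1 s'2 s'3 s'4]] := Pqr qr => //; first by rewrite (le_trans ap).
    exists (s ++ s'); split.
    - rewrite all_cat; apply/andP; split.
        apply/allP => z zs; have /andP[/andP[-> ->] zq] := allP s1 z zs.
        by rewrite (le_trans zq).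
      apply/allP => z zs; have /andP[/andP[zq ->] ->] := allP s'1 z zs.
      by rewrite (le_trans pq).
    - rewrite pairwise_cat s2 s'2 !andbT; apply/allrelP => z z' zs zs'.
      have /andP[_ zq] := allP s1 z zs.
      have /andP[/andP[z'q _] _] := allP s'1 z' zs'.
      by rewrite (le_trans zq).
    - by rewrite big_cat/= (muO_split p q r')//; exact: lerD.
    - rewrite big_cat/= (I_split oO pq qr)//.
      have := ler_normD (h q - h p) (h r' - h q).
      by rewrite (_ : _ + (h r' - h q) = h r' - h p); lra.
  move=> s sab; have [Ns|Ns] := pselect (N s).
    have [d d0 dO] := open_ball_R oO (NO _ (NN' _ Ns)).
    exists d => // p q ap ps sq qb sp qs pq _ _.
    have Opq : O `&` `]p, q]%classic = `]p, q]%classic.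
      apply/setIidPr => t; rewrite /= in_itv/= => /andP[pt tq]; apply: dO.
      by rewrite ltr_distl; apply/andP; split; [apply: lt_trans pt|apply: le_lt_trans tq _].
    exists [:: (p, q)]; split; rewrite /= ?lexx ?pq// ?big_seq1/=.
      by rewrite /muO Opq lebesgue_measure_itv/= lte_fin; case: ltP => [|qp]/=; rewrite ?subr_le0.
    rewrite hE// /I Opq.
    have rpq : mu.-integrable `]p, q] (EFin \o r) by exact: integrableS ri.
    have := le_normr_Rintegral (mu := mu) (measurable_itv _) rpq.
    have := ler_normB (g q - g p) (\int[mu]_(t in `]p, q]) r t).
    have : 0 <= e * (q - p) by rewrite mulr_ge0 ?subr_ge0// ltW.
    lra.
  have [d d0 dh] := is_derive_dist ep (hd s sab Ns).
  exists d => // p q ap ps sq qb sp qs pq _ _.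
  exists [::]; split => //=; rewrite !big_nil.
    by rewrite /muO fine_ge0.
  have I0 : 0 <= I (fun t => `|r t|) O p q by rewrite /I Rintegral_ge0.
  have := dh p; have := dh q.
  rewrite (ger0_norm (_ : 0 <= q - s)) ?subr_ge0// (ler0_norm (_ : p - s <= 0)) ?subr_le0//.
  have qs' : q - s < d by rewrite ltrBlDl.
  have sp' : - (p - s) < d by rewrite opprB ltrBlDl -ltrBlDr.
  move=> /(_ qs') H1 /(_ sp') H2.
  have := ler_normB (h q - h s) (h p - h s).
  by rewrite (_ : _ - (h p - h s) = h q - h p); nra.
have IO : muO a b < d1.
  rewrite /muO -lte_fin fineK//.
  apply: le_lt_trans (lt_le_trans muO' _).
    by apply: le_measure; rewrite ?inE//; [exact: mIoc|exact: open_measurable].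
  by rewrite lee_fin ge_min lexx.
have H1 := gd s sab sd (le_lt_trans sl IO).
have H2 : I (fun t => `|r t|) O a b < e.
  apply: rd; first exact: mIoc.
  apply: le_lt_trans (lt_le_trans muO' _).
    by apply: le_measure; rewrite ?inE//; [exact: mIoc|exact: open_measurable].
  by rewrite lee_fin ge_min lexx orbT.
apply: (le_trans hs).
rewrite (_ : e0 = e * (b - a) + e + e); last by rewrite /e; field; rewrite gt_eqF.
lra.
Qed.
Lemma abs_cont_sub (g : R -> R) (a b s t : R) : a <= s -> t <= b ->
  abs_cont g a b -> abs_cont g s t.
Proof.
move=> as_ tb H e /H[d d0 Hd]; exists d => // l lst; apply: Hd.
apply/allP => z zl; have /andP[/andP[sz ->] zt] := allP lst z zl.
by rewrite (le_trans as_) ?(le_trans zt).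
Qed.

Lemma negligible2 (a b : R) : mu.-negligible [set a; b].
Proof.
by apply: negligibleU; [exists [set a]|exists [set b]]; split => //; exact: lebesgue_measure_set1.
Qed.

(** By Lebesgue differentiation, [g] minus the integral of [r] has derivative 0 almost everywhere,
    so it is constant by [abs_cont_constant]. Extending [r] by 0 makes it integrable on the whole
    line. *)
Lemma abs_cont_ftc_itv (g r : R -> R) (a b : R) : a <= b ->
  abs_cont g a b -> mu.-integrable `[a, b] (EFin \o r) ->
  {ae mu, forall s, s \in `[a, b] -> is_derive s 1 g (r s)} ->
  g b - g a = \int[mu]_(t in `[a, b]) r t.
Proof.
move=> ab gac ri gd.
pose r1 := r \_ `[a, b].
have r1i : mu.-integrable setT (EFin \o r1).
  by rewrite /r1 -restrict_EFin -integrable_mkcond.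
have -> : \int[mu]_(t in `[a, b]) r t = \int[mu]_(t in `]a, b]) r1 t.
  rewrite Rintegral_itv_obnd_cbnd; last by apply: integrableS r1i.
  by apply: eq_Rintegral => t tab; rewrite /r1 patchE tab.
pose F t := \int[mu]_(z in `]a, t]) r1 z.
have r1i' D : measurable D -> mu.-integrable D (EFin \o r1).
  by move=> mD; apply: integrableS r1i.
have locr : locally_integrable setT r1.
  by apply: open_integrable_locally => //; exact: openT.
have Fd := FTC1 (a := BRight a) (fun y => r1i' _ (measurable_itv _)) locr.
pose N := [set s | (s \in `[a, b] -> is_derive s 1 g (r s)) /\
                  ((BRight a < BRight s)%E -> derivable F s 1 /\ (F^`())%classic s = r1 s)].
have Nn : {ae mu, forall s, N s} by apply: (ae_mono2 gd Fd) => s.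
pose h t := g t - F t.
suff : h b = h a.
  rewrite /h /F (_ : `]a, a]%classic = set0) ?Rintegral_set0; first by lra.
  by rewrite set_itv_ge// bnd_simp ltxx.
apply: (@abs_cont_constant h g r1 (~` N `|` [set a; b])) => //.
- move=> p q ap pq qb; rewrite /h.
  have := @Rintegral_itvB R r1 (BRight a) (BRight q) p (r1i' _ (measurable_itv _)).
  rewrite !bnd_simp => /(_ ap pq) <-.
  by rewrite /F; ring.
- by apply: negligibleU => //; exact: negligible2.
- move=> s /andP[]; rewrite le_eqVlt => /predU1P[->|as_]; first by move=> _ []; right; left.
  rewrite le_eqVlt => /predU1P[->|sb]; first by move=> []; right; right.
  move=> /not_orP[/contrapT[H1 H2] _].
  have [dF F's] := H2 as_.
  have dg := H1 _; rewrite -(subrr (r s)).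
  apply: is_deriveB; first by apply: H1; rewrite in_itv/= !ltW.
  apply: DeriveDef; first exact: dF.
  by move: F's; rewrite derive1E => ->; rewrite /r1 patchE mem_set//= in_itv/= !ltW.
Qed.

Lemma abs_cont_ftc (g r : R -> R) (a b s t : R) :
  abs_cont g a b -> mu.-integrable `[a, b] (EFin \o r) ->
  {ae mu, forall s, s \in `[a, b] -> is_derive s 1 g (r s)} ->
  a <= s -> s <= t -> t <= b ->
  g t - g s = \int[mu]_(z in `[s, t]) r z.
Proof.
move=> gac ri gd as_ st tb; apply: abs_cont_ftc_itv => //.
- exact: abs_cont_sub gac.
- apply: integrableS ri => //.
  by apply: subset_itv; rewrite bnd_simp.
- apply: (ae_mono gd) => z + zst; apply.
  by move: zst; rewrite !in_itv/= => /andP[sz zt]; rewrite (le_trans as_)// (le_trans zt).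
Qed.

End AbsolutelyContinuous.

(** * The sup norm and convergence of row vectors, coordinate by coordinate *)

Section RowVectors.
Variable R : realType.

Lemma coord_norm_le n (x : 'rV[R]_n) i : `|x 0 i| <= `|x|.
Proof.
rewrite [leRHS]/Num.norm/= mx_normrE.
exact: (le_bigmax _ (fun i : 'I_1 * 'I_n => `|x i.1 i.2|) (0, i)).
Qed.

Lemma norm_le_coord n (x : 'rV[R]_n) c : 0 <= c ->
  (forall i, `|x 0 i| <= c) -> `|x| <= c.
Proof.
move=> c0 H; rewrite [leLHS]/Num.norm/= mx_normrE.
by apply: bigmax_le => //= -[i j] _ /=; rewrite ord1.
Qed.

Lemma cvg_rVP n (T : Type) (F : set_system T) {FF : Filter F} (f : T -> 'rV[R]_n) (l : 'rV[R]_n) :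
  f @ F --> l <-> forall i, (fun t => f t 0 i) @ F --> l 0 i.
Proof.
split.
  move=> fl i; apply: (@cvg_comp _ _ _ f (fun x : 'rV[R]_n => x 0 i) _ _ _ fl).
  exact: coord_continuous.
move=> H; apply/cvgrPdist_le => e e0.
have : \forall t \near F, forall i, `|l 0 i - f t 0 i| <= e.
  apply: filter_forall => i; move/cvgrPdist_le: (H i); exact.
apply: filterS => t Ht; apply: norm_le_coord; first exact: ltW.
by move=> i; rewrite !mxE.
Qed.

End RowVectors.

(** * Measurability of continuous functions of a measurable vector *)

Section MeasurableComposition.
Context d (T : measurableType d) (R : realType).

Lemma floor_approx (x : R) k :
  `|x - (Num.floor (k.+1%:R * x))%:~R / k.+1%:R| <= k.+1%:R^-1.
Proof.
have k0 : 0 < k.+1%:R :> R by [].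
have /andP[H1 H2] := floor_itv (k.+1%:R * x).
rewrite -(ler_pM2l k0) mulfV ?gt_eqF// -{1}(gtr0_norm k0) -normrM mulrBr.
rewrite (mulrCA _ _ (_^-1)) mulfV ?gt_eqF// mulr1.
by rewrite ger0_norm ?subr_ge0// lerBlDr addrC; apply/ltW; rewrite -intrD1.
Qed.

(** Rounding the coordinates of [X] down to multiples of 1/(k+1) gives a map with countably many
    values, each taken on a measurable box; [G \o X] is the pointwise limit of [G] applied to these
    roundings. *)
Lemma measurable_cts_comp n (D : set T) (X : T -> 'rV[R]_n) (G : 'rV[R]_n -> R) :
  continuous G -> measurable D ->
  (forall i, measurable_fun D (fun s => X s 0 i)) ->
  measurable_fun D (G \o X).
Proof.
move=> cG mD mX.
pose Z k s : 'rV[int]_n := \row_i Num.floor (k.+1%:R * X s 0 i).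
pose q k (z : 'rV[int]_n) : 'rV[R]_n := \row_i ((z 0 i)%:~R / k.+1%:R).
apply: (@measurable_fun_cvg _ _ _ _ (fun k s => G (q k (Z k s)))).
  move=> k _ Y mY.
  rewrite (_ : _ `&` _ = \bigcup_(z : 'rV[int]_n)
    if `[< Y (G (q k z)) >] then D `&` [set s | Z k s = z] else set0).
    apply: countable_bigcupT_measurable => [|z]; first exact: countableP.
    case: asboolP => // _.
    rewrite (_ : _ `&` _ = D `&` \bigcap_(i in [set: 'I_n])
        (D `&` (fun s => k.+1%:R * X s 0 i) @^-1` `[(z 0 i)%:~R, (z 0 i + 1)%:~R[)).
      apply: measurableI => //; apply: fin_bigcap_measurable => // i _.
      have : measurable_fun D (fun s => k.+1%:R * X s 0 i).
        by apply: measurable_funM => //; exact: measurable_cst.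
      by apply => //; exact: measurable_itv.
    apply/seteqP; split => s /= [Ds].
      move=> <-; split => // i _; split => //=.
      by rewrite in_itv/= /Z !mxE floor_itv.
    move=> H; split => //; apply/rowP => i; rewrite mxE.
    by have [_ /=] := H i I; rewrite in_itv/=; exact: floor_def.
  apply/seteqP; split => s /=.
    move=> [Ds Ys]; exists (Z k s) => //.
    by case: asboolP.
  by move=> [z _]; case: asboolP => // Yz [Ds /= zE]; rewrite zE.
move=> s Ds; apply: (@cvg_comp _ _ _ (fun k => q k (Z k s)) G).
  apply/cvgrPdist_le => e e0; near=> k.
  apply: norm_le_coord; first exact: ltW.
  move=> i; rewrite !mxE; apply: le_trans (floor_approx _ _) _.
  by apply/ltW; near: k; exact: (near_infty_natSinv_lt (PosNum e0)).
exact: cG.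
Unshelve. all: by end_near. Qed.
End MeasurableComposition.

(** * The mean value theorem on either side of a point *)

Section Calculus1D.
Variable R : realType.

Lemma mvt_any (f df : R -> R) (a b : R) :
  (forall x : R, is_derive x (1 : R) f (df x)) ->
  exists2 c, `|c - a| <= `|b - a| & f b - f a = df c * (b - a).
Proof.
move=> fd.
have cf A : {within A, continuous f}.
  apply: continuous_subspaceT => x.
  have fdx := fd x; have d1 : derivable f x 1 by exact: ex_derive.
  exact/differentiable_continuous/derivable1_diffP.
have [ab|/ltW ba] := leP a b.
  have [c + e] := MVT_segment ab (fun x _ => fd x) (cf _).
  rewrite in_itv/= => /andP[ac cb]; exists c => //.
  by rewrite !ger0_norm ?subr_ge0// lerD2r.
have [c + e] := MVT_segment ba (fun x _ => fd x) (cf _).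
rewrite in_itv/= => /andP[bc ca]; exists c.
  by rewrite !ler0_norm ?subr_le0// lerN2 lerD2r.
by rewrite -(opprB (f a)) e -mulrN opprB.
Qed.

End Calculus1D.

(** * Scalar functions of class C^k in several variables *)

Section Calculus.
Variable R : realType.
Implicit Types (n : nat).

Lemma is_derive_line n (g : 'rV[R]_n -> R) (x v : 'rV[R]_n) (t : R) :
  derivable g (x + t *: v) v ->
  is_derive t 1 (fun s => g (x + s *: v)) ('D_v g (x + t *: v)).
Proof.
move=> dg.
have E : (fun h : R => h^-1 *: (((fun s => g (x + s *: v)) \o shift t) (h *: 1) - g (x + t *: v)))
   = (fun h : R => h^-1 *: ((g \o shift (x + t *: v)) (h *: v) - g (x + t *: v))).
  apply/funext => h /=; congr (_ *: (g _ - _)).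
  by rewrite [h *: 1]mulr1 scalerDl addrCA.
by apply: DeriveDef; rewrite /derivable /derive E.
Qed.

Notation "'e_ i" := (delta_mx 0 i) (at level 8, i at level 2, format "''e_' i").
Notation "'d_ i g" := (fun x => 'D_('e_i) g x) (at level 8, i at level 2, g at level 9).

(** A recursive form of C^k through partial derivatives, suited to induction on [k] for sums,
    products and compositions; [Ck_Sm] and [Ck_coord] derive it from [Ck]. *)
Fixpoint Sm (k : nat) n (g : 'rV[R]_n -> R) : Prop :=
  continuous g /\
  if k is k'.+1 then
    forall i, (forall x, derivable g x 'e_i) /\ Sm k' ('d_i g)
  else True.

Lemma cts_add n (g h : 'rV[R]_n -> R) : continuous g -> continuous h ->
  continuous (fun x => g x + h x).
Proof. by move=> cg ch x; exact: (continuousD (cg x) (ch x)). Qed.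

Lemma cts_mul n (g h : 'rV[R]_n -> R) : continuous g -> continuous h ->
  continuous (fun x => g x * h x).
Proof. by move=> cg ch x; exact: (continuousM (cg x) (ch x)). Qed.

Lemma Sm_cts k n (g : 'rV[R]_n -> R) : Sm k g -> continuous g.
Proof. by case: k => [|k] []. Qed.

Lemma SmW k n (g : 'rV[R]_n -> R) : Sm k.+1 g -> Sm k g.
Proof.
elim: k g => [|k IH] g [cg H]; split => // i.
by split; [exact: (H i).1|apply: IH; exact: (H i).2].
Qed.

Lemma Sm_le k l n (g : 'rV[R]_n -> R) : (k <= l)%N -> Sm l g -> Sm k g.
Proof.
move=> /subnK <-; elim: (l - k)%N => // p IH H; apply: IH.
by apply: SmW; rewrite -addSn.
Qed.

Lemma Sm_d k n (g : 'rV[R]_n -> R) i : Sm k.+1 g -> Sm k ('d_i g).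
Proof. by move=> [_ H]; exact: (H i).2. Qed.

Lemma Sm_derivable k n (g : 'rV[R]_n -> R) : Sm k.+1 g ->
  forall i x, derivable g x 'e_i.
Proof. by move=> [_ H] i; exact: (H i).1. Qed.

Lemma Sm_ext k n (g h : 'rV[R]_n -> R) : g =1 h -> Sm k g -> Sm k h.
Proof. by move=> /funext ->. Qed.

Lemma Sm_cst k n (c : R) : Sm k (fun _ : 'rV[R]_n => c).
Proof.
elim: k c => [|k IH] c; split; try exact: cst_continuous; first by [].
move=> i; split; first by move=> x; exact: derivable_cst.
apply: (Sm_ext _ (IH 0)) => x; by rewrite derive_cst.
Qed.

Lemma Sm_add k n (g h : 'rV[R]_n -> R) : Sm k g -> Sm k h ->
  Sm k (fun x => g x + h x).
Proof.
elim: k g h => [|k IH] g h Hg Hh; split => //.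
- exact: cts_add (Sm_cts Hg) (Sm_cts Hh).
- exact: cts_add (Sm_cts Hg) (Sm_cts Hh).
move=> i; split=> [x|].
  by apply: derivableD; [exact: (Sm_derivable Hg)|exact: (Sm_derivable Hh)].
apply: (Sm_ext _ (IH _ _ (Sm_d i Hg) (Sm_d i Hh))) => x.
by rewrite deriveD//; [exact: (Sm_derivable Hg)|exact: (Sm_derivable Hh)].
Qed.

Lemma Sm_mul k n (g h : 'rV[R]_n -> R) : Sm k g -> Sm k h ->
  Sm k (fun x => g x * h x).
Proof.
elim: k g h => [|k IH] g h Hg Hh; split => //.
- exact: cts_mul (Sm_cts Hg) (Sm_cts Hh).
- exact: cts_mul (Sm_cts Hg) (Sm_cts Hh).
move=> i; split=> [x|].
  by apply: derivableM; [exact: (Sm_derivable Hg)|exact: (Sm_derivable Hh)].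
apply: (Sm_ext _ (Sm_add (IH _ _ (SmW Hg) (Sm_d i Hh)) (IH _ _ (SmW Hh) (Sm_d i Hg)))) => x.
by rewrite deriveM//; [exact: (Sm_derivable Hg)|exact: (Sm_derivable Hh)].
Qed.

Lemma Sm_sum k n p (g : 'I_p -> 'rV[R]_n -> R) : (forall j, Sm k (g j)) ->
  Sm k (fun x => \sum_j g j x).
Proof.
elim: p g => [|p IH] g Hg.
  by apply: (Sm_ext _ (Sm_cst k n 0)) => x; rewrite big_ord0.
apply: (Sm_ext _ (Sm_add (Hg ord0) (IH _ (fun j => Hg (lift ord0 j))))) => x.
by rewrite big_ord_recl.
Qed.

Lemma is_derive_coord n (i j : 'I_n) (x : 'rV[R]_n) :
  is_derive x 'e_i (fun x : 'rV[R]_n => x 0 j) (i == j)%:R.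
Proof.
have H : (fun h : R => h^-1 *: (((fun x : 'rV[R]_n => x 0 j) \o shift x) (h *: 'e_i) - x 0 j)) @ 0^' --> ((i == j)%:R : R).
  apply: cvg_near_cst; near=> h.
  rewrite /= !mxE eqxx/= addrK eq_sym [_ *: _]mulrA mulVf ?mul1r//.
  by near: h; exact: nbhs_dnbhs_neq.
by apply: DeriveDef; [apply/cvg_ex; eexists; exact: H|exact: cvg_lim].
Unshelve. all: by end_near. Qed.

Lemma Sm_coord k n (j : 'I_n) : Sm k (fun x : 'rV[R]_n => x 0 j).
Proof.
case: k => [|k]; split => //; try exact: coord_continuous.
move=> i; split; first by move=> x; exact: (@ex_derive _ _ _ _ _ _ _ (is_derive_coord i j x)).
apply: (Sm_ext _ (Sm_cst k n (i == j)%:R)) => x.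
by rewrite (@derive_val _ _ _ _ _ _ _ (is_derive_coord i j x)).
Qed.

End Calculus.

(** * The chain rule along curves *)

Section DirectionalDerivatives.
Variable R : realType.
Notation "'e_ i" := (delta_mx 0 i) (at level 8, i at level 2, format "''e_' i").
Notation "'d_ i g" := (fun x => 'D_('e_i) g x) (at level 8, i at level 2, g at level 9).

(** The increment telescopes along the path that changes one coordinate at a time, and the mean
    value theorem applies to each edge. *)
Lemma mvt_coords n (g : 'rV[R]_n -> R) (x h : 'rV[R]_n) :
  (forall i x, derivable g x 'e_i) ->
  exists xi : 'I_n -> 'rV[R]_n, (forall i, `|xi i - x| <= `|h|) /\
    g (x + h) - g x = \sum_i h 0 i * 'd_i g (xi i).
Proof.
move=> dg.
pose z k : 'rV[R]_n := \row_j (x 0 j + (j < k)%:R * h 0 j).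
have step (i : 'I_n) : exists xi, `|xi - x| <= `|h| /\
    g (z i.+1) - g (z i) = h 0 i * 'd_i g xi.
  have D (t : R) : is_derive t (1 : R) (fun s => g (z i + s *: 'e_i)) ('d_i g (z i + t *: 'e_i)).
    by apply: is_derive_line; exact: dg.
  have [c] := mvt_any (f := fun s => g (z i + s *: 'e_i)) 0 (h 0 i) D.
  rewrite !subr0 scale0r addr0 => ch E; exists (z i + c *: 'e_i); split.
    apply: norm_le_coord => // j; rewrite !mxE eqxx/=.
    rewrite (_ : _ - x 0 j = (j < i)%:R * h 0 j + c * (j == i)%:R); last by ring.
    have [->|ji] := eqVneq j i; last first.
      rewrite mulr0 addr0 normrM; apply: le_trans (coord_norm_le h j).
      by rewrite ler_piMl// normr_nat lern1 leq_b1.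
    by rewrite ltnn mul0r add0r mulr1 (le_trans ch)// coord_norm_le.
  rewrite mulrC -E; congr (g _ - _).
  apply/rowP => j; rewrite !mxE ltnS eqxx/=.
  have [->|ji] := eqVneq j i.
    by rewrite leqnn ltnn mul0r addr0 mul1r mulr1.
  by rewrite mulr0 addr0 (leq_eqVlt j) (negbTE (_ : (j : nat) != i)).
have [xi Hxi] := choice step.
exists xi; split; first by move=> i; exact: (Hxi i).1.
have <- : \sum_(i < n) (g (z i.+1) - g (z i)) = g (x + h) - g x.
  rewrite -(big_mkord xpredT (fun i => g (z i.+1) - g (z i))) telescope_sumr//.
  congr (g _ - g _); apply/rowP => j; rewrite !mxE ?ltn0 ?mul0r ?addr0//.
  by rewrite ltn_ord mul1r.
by apply: eq_bigr => i _; exact: (Hxi i).2.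
Qed.

Lemma cvg_sum_ord (T : Type) (F : set_system T) {FF : Filter F} n
    (f : 'I_n -> T -> R) (l : 'I_n -> R) :
  (forall i, f i @ F --> l i) -> (fun t => \sum_i f i t) @ F --> \sum_i l i.
Proof.
elim: n f l => [|n IH] f l H.
  rewrite big_ord0 (_ : (fun t => _) = fun=> 0); first exact: cvg_cst.
  by apply/funext => t; rewrite big_ord0.
rewrite big_ord_recl (_ : (fun t => _) = fun t => f ord0 t + \sum_i f (lift ord0 i) t).
  by apply: cvgD; [exact: H|apply: IH => i; exact: H].
by apply/funext => t; rewrite big_ord_recl.
Qed.

(** In [mvt_coords] for the increment [c (s + t) - c t], the intermediate points tend to [c t],
    where the partial derivatives are continuous. *)
Lemma derive_comp_curve n (g : 'rV[R]_n -> R) (c : R -> 'rV[R]_n) (t : R) v :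
  Sm 1 g -> is_derive t (1 : R) c v ->
  is_derive t 1 (g \o c) (\sum_i v 0 i * 'd_i g (c t)).
Proof.
move=> Sg [dc cv].
have dg := Sm_derivable Sg.
have cd i : continuous ('d_i g) by exact: (Sm_cts (Sm_d i Sg)).
pose h s := c (s + t) - c t.
have hv : (fun s : R => s^-1 *: h s) @ 0^' --> v.
  have : (fun s : R => s^-1 *: ((c \o shift t) (s *: 1) - c t)) @ 0^' --> 'D_1 c t by exact: dc.
  rewrite cv; apply: cvg_trans; apply: near_eq_cvg.
  by apply: nearW => s; rewrite /h /= [s *: 1]mulr1.
have h0 : h @ 0^' --> (0 : 'rV[R]_n).
  rewrite -(scale0r v).
  have : (fun s : R => s *: (s^-1 *: h s)) @ 0^' --> 0 *: v.
    by apply: cvgZ => //; exact: nbhs_dnbhs.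
  apply: cvg_trans; apply: near_eq_cvg; near=> s.
  rewrite scalerA mulfV ?scale1r//; near: s; exact: nbhs_dnbhs_neq.
have ex s : exists xi : 'I_n -> 'rV[R]_n, (forall i, `|xi i - c t| <= `|h s|) /\
    g (c t + h s) - g (c t) = \sum_i h s 0 i * 'd_i g (xi i).
  exact: mvt_coords.
have [xi Hxi] := choice ex.
have xit i : (fun s => xi s i) @ 0^' --> c t.
  apply/cvgrPdist_le => e e0; move/cvgrPdist_le : h0 => /(_ e e0).
  apply: filterS => s; rewrite sub0r normrN => hs.
  by rewrite distrC (le_trans _ hs)//; exact: (Hxi s).1.
have H : (fun s : R => s^-1 *: (((g \o c) \o shift t) (s *: 1) - (g \o c) t)) @ 0^'
    --> \sum_i v 0 i * 'd_i g (c t).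
  rewrite (_ : (fun s => _) = fun s => \sum_i (s^-1 *: h s) 0 i * 'd_i g (xi s i)).
    apply: cvg_sum_ord => i; apply: cvgM.
      by move/cvg_rVP : hv; apply.
    exact: (cvg_comp _ _ (xit i) (cd i _)).
  apply/funext => s /=; rewrite [s *: 1]mulr1.
  have -> : c (s + t) = c t + h s by rewrite /h [RHS]addrC subrK.
  rewrite (Hxi s).2 [LHS]mulr_sumr; apply: eq_bigr => i _.
  by rewrite !mxE mulrA.
by apply: DeriveDef; [apply/cvg_ex; eexists; exact: H|exact: cvg_lim].
Unshelve. all: by end_near. Qed.

Lemma Sm_is_derive n (g : 'rV[R]_n -> R) x v : Sm 1 g ->
  is_derive x v g (\sum_i v 0 i * 'd_i g x).
Proof.
move=> Sg.
have D : is_derive (0 : R) (1 : R) (fun s => x + s *: v) v.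
  have H : (fun h : R => h^-1 *: (((fun s => x + s *: v) \o shift 0) (h *: 1) - (x + 0 *: v))) @ 0^' --> v.
    apply: cvg_near_cst; near=> h.
    rewrite /= [h *: 1]mulr1 !addr0 scale0r addr0 addrC addKr scalerA mulVf ?scale1r//.
    by near: h; exact: nbhs_dnbhs_neq.
  by apply: DeriveDef; [apply/cvg_ex; eexists; exact: H|exact: cvg_lim].
have := derive_comp_curve Sg D.
rewrite scale0r addr0 => -[H1 H2].
have E : (fun h : R => h^-1 *: (((g \o (fun s => x + s *: v)) \o shift 0) (h *: 1) - (g \o (fun s => x + s *: v)) 0))
   = (fun h : R => h^-1 *: ((g \o shift x) (h *: v) - g x)).
  apply/funext => h /=; congr (_ *: (g _ - g _)).
    by rewrite [h *: 1]mulr1 addr0 addrC.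
  by rewrite scale0r addr0.
by apply: DeriveDef; [move: H1|move: H2]; rewrite /derivable /derive E.
Unshelve. all: by end_near. Qed.

End DirectionalDerivatives.

(** * Symmetry of second derivatives; passage from [Ck] to [Sm] *)

Section Smoothness.
Variable R : realType.
Notation "'e_ i" := (delta_mx 0 i) (at level 8, i at level 2, format "''e_' i").
Notation "'d_ i g" := (fun x => 'D_('e_i) g x) (at level 8, i at level 2, g at level 9).

(** The mean value theorem is used twice: in direction [i] for the difference [phi] of two parallel
    edges, then in direction [j]. *)
Let second_difference n (g : 'rV[R]_n -> R) (x : 'rV[R]_n) i j (s : R) :
  Sm 2 g -> exists2 y, `|y - x| <= `|s| + `|s| &
    (g (x + s *: 'e_i + s *: 'e_j) - g (x + s *: 'e_i)) - (g (x + s *: 'e_j) - g x)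
     = ('d_j 'd_i g) y * s * s.
Proof.
move=> Sg.
have D1 := Sm_derivable Sg.
have D2 := Sm_derivable (Sm_d i Sg).
pose phi t := g (x + s *: 'e_j + t *: 'e_i) - g (x + t *: 'e_i).
have phiD (t : R) : is_derive t (1 : R) phi
    ('d_i g (x + s *: 'e_j + t *: 'e_i) - 'd_i g (x + t *: 'e_i)).
  by apply: is_deriveB; apply: is_derive_line; exact: D1.
have [tau + E] := mvt_any 0 s phiD.
rewrite !subr0 => ts.
have psiD (t : R) : is_derive t (1 : R) (fun t => 'd_i g (x + tau *: 'e_i + t *: 'e_j))
    ('d_j 'd_i g (x + tau *: 'e_i + t *: 'e_j)).
  by apply: is_derive_line; exact: D2.
have [sg + E2] := mvt_any 0 s psiD.
rewrite !subr0 => sgs.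
have en (k : 'I_n) : `|'e_k : 'rV[R]_n| <= 1.
  by apply: norm_le_coord => // l; rewrite !mxE normr_nat lern1 leq_b1.
exists (x + tau *: 'e_i + sg *: 'e_j).
  rewrite (_ : _ - x = tau *: 'e_i + sg *: 'e_j); last first.
    by apply/rowP => k; rewrite !mxE; ring.
  rewrite (le_trans (ler_normD _ _))// !normrZ.
  by apply: lerD; [apply: le_trans ts|apply: le_trans sgs]; rewrite ler_piMr.
move: E E2; rewrite /phi !scale0r !addr0 !subr0 => E E2.
rewrite -E2.
rewrite (_ : x + s *: 'e_i + s *: 'e_j = x + s *: 'e_j + s *: 'e_i); last by rewrite addrAC.
rewrite (_ : x + tau *: 'e_i + s *: 'e_j = x + s *: 'e_j + tau *: 'e_i); last by rewrite addrAC.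
by rewrite -E; ring.
Qed.

(** The second difference is symmetric in [i] and [j], so the two mixed derivatives agree at points
    arbitrarily close to [x]; continuity concludes. *)
Lemma schwarz n (g : 'rV[R]_n -> R) i j : Sm 2 g -> 'd_i 'd_j g =1 'd_j 'd_i g.
Proof.
move=> Sg x.
have c1 : continuous ('d_i 'd_j g) by exact: (Sm_cts (Sm_d i (Sm_d j Sg))).
have c2 : continuous ('d_j 'd_i g) by exact: (Sm_cts (Sm_d j (Sm_d i Sg))).
have near_val (c : 'rV[R]_n -> R) e : continuous c -> 0 < e ->
    exists2 d, 0 < d & forall y, `|y - x| < d -> `|c x - c y| <= e.
  move=> cc e0; have /cvgrPdist_le/(_ e e0)/nbhs_ballP[d /= d0 Hd] := cc x.
  exists d => // y yd; apply: Hd; rewrite -ball_normE /ball_/=.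
  by rewrite distrC.
apply/eqP; rewrite -subr_eq0 -normr_le0; apply/ler_addgt0Pr => e e0; rewrite add0r.
have e20 : 0 < e / 2 by rewrite divr_gt0.
have [d1 d10 H1] := near_val _ _ c1 e20.
have [d2 d20 H2] := near_val _ _ c2 e20.
pose s := Num.min d1 d2 / 3.
have s0 : 0 < s by rewrite divr_gt0// lt_min d10.
have s3 : s * 3 = Num.min d1 d2 by rewrite /s mulfVK// gt_eqF.
have [y1 + E1] := second_difference x i j s Sg.
have [y2 + E2] := second_difference x j i s Sg.
rewrite (gtr0_norm s0) => y2s y1s.
have sd : s + s < Num.min d1 d2 by rewrite -s3; move: s0; clear; lra.
have E : 'd_j 'd_i g y1 = 'd_i 'd_j g y2.
  apply: (mulIf (lt0r_neq0 s0)); apply: (mulIf (lt0r_neq0 s0)).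
  apply: etrans (esym E1) _; apply: etrans _ E2.
  rewrite (addrAC x (s *: 'e_i) (s *: 'e_j)).
  by move: (g _) (g _) (g _) (g _) => a b c e'; clear; ring.
have sd1 : s + s < d1 by apply: lt_le_trans sd _; rewrite ge_min lexx.
have sd2 : s + s < d2 by apply: lt_le_trans sd _; rewrite ge_min lexx orbT.
have A := H1 y2 (le_lt_trans y2s sd1).
have B := H2 y1 (le_lt_trans y1s sd2).
rewrite [X in _ - X]E in B.
suff H (a b c : R) : `|a - c| <= e / 2 -> `|b - c| <= e / 2 -> `|a - b| <= e by exact: H A B.
clear => A B; have := ler_normB (a - c) (b - c).
rewrite (_ : _ - _ - _ = a - b); last by ring.
by move/le_trans; apply; rewrite [leRHS]splitr lerD.
Qed.

Lemma Ck_continuous n (V : normedModType R) k (g : 'rV[R]_n -> V) :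
  Ck k g -> continuous g.
Proof. by move=> /(_ [::]) []. Qed.

Lemma Ck_d n (V : normedModType R) k (g : 'rV[R]_n -> V) i : Ck k.+1 g -> Ck k ('d_i g).
Proof.
move=> H s sk.
have -> : partial_iter ('d_i g) s = partial_iter g (rcons s i).
  by rewrite /partial_iter foldr_rcons.
have [|c d] := H (rcons s i); first by rewrite size_rcons.
by split => // sk'; apply: d; rewrite size_rcons.
Qed.

Lemma Ck_Sm n k (g : 'rV[R]_n -> R) : Ck k g -> Sm k g.
Proof.
elim: k g => [|k IH] g Hg; split => //; try exact: Ck_continuous Hg.
move=> i; split; first by move=> x; have [_] := Hg [::] isT; exact.
exact/IH/Ck_d.
Qed.

Lemma cts_coord n p (f : 'rV[R]_n -> 'rV[R]_p) j : continuous f ->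
  continuous (fun x => f x 0 j).
Proof.
move=> cf x; apply: (@continuous_comp _ _ _ f (fun y : 'rV[R]_p => y 0 j)).
  exact: cf.
exact: coord_continuous.
Qed.

Lemma Ck_coord n p k (f : 'rV[R]_n -> 'rV[R]_p) j : Ck k f ->
  Sm k (fun x => f x 0 j).
Proof.
elim: k f => [|k IH] f Hf; split => //.
- exact: cts_coord (Ck_continuous Hf).
- exact: cts_coord (Ck_continuous Hf).
have df i x : derivable f x 'e_i by have [_] := Hf [::] isT; exact.
move=> i; split; first by move=> x; have /derivable_mxP := df i x; exact.
apply: (Sm_ext _ (IH _ (Ck_d i Hf))) => x.
by rewrite derive_mx// mxE.
Qed.

End Smoothness.

(** * Bounds for periodic functions; functions of a pair (x, u) *)

Section Periodic.
Variable R : realType.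
Notation "'e_ i" := (delta_mx 0 i) (at level 8, i at level 2, format "''e_' i").
Notation "'d_ i g" := (fun x => 'D_('e_i) g x) (at level 8, i at level 2, g at level 9).

Lemma intvec_reduce n (x : 'rV[R]_n) : exists2 k, intvec k & `|x - k| <= 1.
Proof.
exists (\row_i (Num.floor (x 0 i))%:~R).
  by move=> i; exists (Num.floor (x 0 i)); rewrite mxE.
apply: norm_le_coord => // i; rewrite !mxE.
have := floor_itv (x 0 i); rewrite intrD1 => /andP[H1 H2].
by rewrite ger0_norm ?subr_ge0// lerBlDl ltW// addrC.
Qed.

Lemma compact_norm_le n (r : R) : compact [set x : 'rV[R]_n | `|x| <= r].
Proof.
apply: bounded_closed_compact.
  by exists r; split => [|s rs x /= xr]; [exact: num_real|rewrite (le_trans xr)// ltW].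
have -> : [set x : 'rV[R]_n | `|x| <= r] = (fun x => `|x|) @^-1` [set y | y <= r] by [].
by apply: closed_comp => [x _|]; [exact: norm_continuous|exact: closed_le].
Qed.

Lemma cts_bounded_ball n (g : 'rV[R]_n -> R) (r : R) : continuous g ->
  exists2 M, 0 <= M & forall x, `|x| <= r -> `|g x| <= M.
Proof.
move=> cg.
have cB := @compact_norm_le n r.
have /compact_bounded[M [_ HM]] := continuous_compact (continuous_subspaceT cg) cB.
exists (`|M| + 1); first by rewrite addr_ge0.
move=> x xr; apply: (HM (`|M| + 1)); last by exists x.
by rewrite (le_lt_trans (ler_norm _))// ltrDl.
Qed.

Lemma derive_shift n (g : 'rV[R]_n -> R) (k v : 'rV[R]_n) :
  (forall x, g (x + k) = g x) -> forall x, 'D_v g (x + k) = 'D_v g x.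
Proof.
move=> gk x.
have E : (fun h : R => h^-1 *: ((g \o shift (x + k)) (h *: v) - g (x + k)))
   = (fun h : R => h^-1 *: ((g \o shift x) (h *: v) - g x)).
  by apply/funext => h /=; rewrite addrA !gk.
by rewrite /derive E.
Qed.

Lemma periodic_bounded n (g : 'rV[R]_n -> R) : continuous g -> Zperiodic g ->
  exists2 M, 0 <= M & forall x, `|g x| <= M.
Proof.
move=> cg pg; have [M M0 HM] := cts_bounded_ball 1 cg.
exists M => // x; have [k kint xk] := intvec_reduce x.
by rewrite -(subrK k x) pg// HM.
Qed.

Lemma bounded_gradient_lipschitz n (g : 'rV[R]_n -> R) (M : R) :
  (forall i x, derivable g x 'e_i) -> (forall i x, `|'d_i g x| <= M) ->
  forall x y, `|g x - g y| <= n%:R * M * `|x - y|.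
Proof.
move=> dg gM x y; have [xi [_]] := mvt_coords y (x - y) dg.
rewrite [y + _]addrC subrK => ->.
apply: (le_trans (ler_norm_sum _ _ _)).
rewrite (_ : n%:R * M * _ = \sum_(i < n) M * `|x - y|).
  by apply: ler_sum => i _; rewrite normrM mulrC ler_pM// coord_norm_le.
by rewrite sumr_const card_ord -[RHS]mulr_natl mulrA.
Qed.

Lemma periodic_lipschitz n (g : 'rV[R]_n -> R) : Sm 1 g -> Zperiodic g ->
  exists2 M, 0 <= M & forall x y, `|g x - g y| <= M * `|x - y|.
Proof.
move=> Sg pg.
have H i : exists M, 0 <= M /\ forall x, `|'d_i g x| <= M.
  have [|M M0 HM] := periodic_bounded (Sm_cts (Sm_d i Sg)); last by exists M.
  by move=> x k ik; apply: derive_shift => z; exact: pg.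
have [M HM] := choice H.
exists (n%:R * \sum_i M i).
  by rewrite mulr_ge0// sumr_ge0// => i _; exact: (HM i).1.
apply: bounded_gradient_lipschitz; first exact: Sm_derivable Sg.
move=> i x; apply: (le_trans ((HM i).2 x)).
by rewrite (bigD1 i)//= lerDl sumr_ge0// => j _; exact: (HM j).1.
Qed.

Lemma row_mx_delta_r d m (x : 'rV[R]_d) (u : 'rV[R]_m) j h :
  row_mx x (h *: 'e_j + u) = h *: 'e_(rshift d j) + row_mx x u.
Proof.
apply/rowP => i; rewrite !mxE; case: splitP => l il.
  by rewrite eqxx/= (_ : i == _ = false) ?mulr0 ?add0r// -val_eqE/= il ltn_eqF// (leq_trans (ltn_ord l))// leq_addr.
by rewrite !mxE eqxx/= (_ : (i == rshift d j) = (l == j))// -!val_eqE/= il eqn_add2l.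
Qed.

Lemma row_mx_delta_l d m (x : 'rV[R]_d) (u : 'rV[R]_m) j h :
  row_mx (h *: 'e_j + x) u = h *: 'e_(lshift m j) + row_mx x u.
Proof.
apply/rowP => i; rewrite !mxE; case: splitP => l il.
  by rewrite !mxE eqxx/= (_ : (i == lshift m j) = (l == j))// -!val_eqE/= il.
by rewrite eqxx/= (_ : i == _ = false) ?mulr0 ?add0r// -val_eqE/= il gtn_eqF// (leq_trans (ltn_ord j))// leq_addr.
Qed.

Lemma cts_row_mx_r d m (G : 'rV[R]_(d + m) -> R) (x : 'rV[R]_d) :
  continuous G -> continuous (fun u => G (row_mx x u)).
Proof.
move=> cG u; apply: (@continuous_comp 'rV[R]_m 'rV[R]_(d + m) R (row_mx x) G u); last exact: cG.
apply/(@cvg_rVP R (d + m) 'rV[R]_m (nbhs u) (nbhs_filter u) (row_mx x) (row_mx x u)) => i; have [j ->|j ->] := split_ordP i.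
  rewrite (_ : (fun t => _) = fun=> x 0 j) ?row_mxEl; first exact: cvg_cst.
  by apply/funext => v; rewrite row_mxEl.
rewrite (_ : (fun t => _) = fun v : 'rV[R]_m => v 0 j) ?row_mxEr; first exact: coord_continuous.
by apply/funext => v; rewrite row_mxEr.
Qed.

Lemma cts_row_mx_l d m (G : 'rV[R]_(d + m) -> R) (u : 'rV[R]_m) :
  continuous G -> continuous (fun x => G (row_mx x u)).
Proof.
move=> cG x; apply: (@continuous_comp 'rV[R]_d 'rV[R]_(d + m) R (row_mx^~ u) G x); last exact: cG.
apply/(@cvg_rVP R (d + m) 'rV[R]_d (nbhs x) (nbhs_filter x) (row_mx^~ u) (row_mx x u)) => i; have [j ->|j ->] := split_ordP i.
  rewrite (_ : (fun t => _) = fun v : 'rV[R]_d => v 0 j) ?row_mxEl; first exact: coord_continuous.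
  by apply/funext => v; rewrite row_mxEl.
rewrite (_ : (fun t => _) = fun=> u 0 j) ?row_mxEr; first exact: cvg_cst.
by apply/funext => v; rewrite row_mxEr.
Qed.

Lemma Sm_row_mx_r k d m (G : 'rV[R]_(d + m) -> R) (x : 'rV[R]_d) :
  Sm k G -> Sm k (fun u => G (row_mx x u)).
Proof.
elim: k G => [|k IH] G SG; split => //; try exact: cts_row_mx_r (Sm_cts SG).
move=> i.
have E u : (fun h : R => h^-1 *: (((fun u => G (row_mx x u)) \o shift u) (h *: 'e_i) - G (row_mx x u)))
  = (fun h : R => h^-1 *: ((G \o shift (row_mx x u)) (h *: 'e_(rshift d i)) - G (row_mx x u))).
  by apply/funext => h /=; rewrite row_mx_delta_r.
split=> [u|]; first by rewrite /derivable E; exact: (Sm_derivable SG).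
apply: (Sm_ext _ (IH _ (Sm_d (rshift d i) SG))) => u.
by rewrite /derive E.
Qed.

Lemma derive_row_mx_l d m (G : 'rV[R]_(d + m) -> R) (x : 'rV[R]_d) (u : 'rV[R]_m) i :
  Sm 1 G -> derivable (fun x => G (row_mx x u)) x 'e_i /\
  'd_i (fun x => G (row_mx x u)) x = 'd_(lshift m i) G (row_mx x u).
Proof.
move=> SG.
have E : (fun h : R => h^-1 *: (((fun x => G (row_mx x u)) \o shift x) (h *: 'e_i) - G (row_mx x u)))
  = (fun h : R => h^-1 *: ((G \o shift (row_mx x u)) (h *: 'e_(lshift m i)) - G (row_mx x u))).
  by apply/funext => h /=; rewrite row_mx_delta_l.
by rewrite /derivable /derive E; split => //; exact: (Sm_derivable SG).
Qed.

End Periodic.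

(** * Bounds, convexity and growth of the Lagrangian *)

Section Lagrangian.
Variables (R : realType) (d m : nat) (L : 'rV[R]_d -> 'rV[R]_m -> R).
Hypothesis HL : hypL L.
Notation "'e_ i" := (delta_mx 0 i) (at level 8, i at level 2, format "''e_' i").
Notation "'d_ i g" := (fun x => 'D_('e_i) g x) (at level 8, i at level 2, g at level 9).

Lemma Lhat_row_mx x u : Lhat L (row_mx x u) = L x u.
Proof. by rewrite /Lhat row_mxKl row_mxKr. Qed.

Lemma Lhat_Sm : Sm 2 (Lhat L).
Proof. by have [H _ _ _] := HL; exact: Ck_Sm. Qed.

Lemma L_Sm x : Sm 2 (L x).
Proof.
apply: (Sm_ext _ (Sm_row_mx_r x Lhat_Sm)) => u.
exact: Lhat_row_mx.
Qed.

Lemma norm_row_mx (x : 'rV[R]_d) (u : 'rV[R]_m) a b :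
  `|x| <= a -> `|u| <= b -> `|row_mx x u| <= a + b.
Proof.
move=> xa ub; have a0 := le_trans (normr_ge0 _) xa; have b0 := le_trans (normr_ge0 _) ub.
apply: norm_le_coord => [|i]; first exact: addr_ge0.
have [j ->|j ->] := split_ordP i.
  by rewrite row_mxEl (le_trans (coord_norm_le _ _))// (le_trans xa)// lerDl.
by rewrite row_mxEr (le_trans (coord_norm_le _ _))// (le_trans ub)// lerDr.
Qed.

Lemma L_reduce (x : 'rV[R]_d) : exists2 y, `|y| <= 1 & forall u, L x u = L y u.
Proof.
have [k kint xk] := intvec_reduce x; exists (x - k) => // u.
have [_ Lp _ _] := HL.
by have /= := Lp u (x - k) k kint; rewrite subrK.
Qed.

Lemma L_bounded K : exists2 M, 0 <= M & forall x u, `|u| <= K -> `|L x u| <= M.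
Proof.
have [M M0 HM] := cts_bounded_ball (1 + K) (Sm_cts Lhat_Sm).
exists M => // x u uK; have [y y1 ->] := L_reduce x.
by rewrite -Lhat_row_mx; apply: HM; exact: norm_row_mx.
Qed.

Lemma L_lipschitz K : exists2 C, 0 <= C &
  forall x y u, `|u| <= K -> `|L x u - L y u| <= C * `|x - y|.
Proof.
have H i : exists M, 0 <= M /\ forall x u, `|u| <= K -> `|'d_(lshift m i) (Lhat L) (row_mx x u)| <= M.
  have [M M0 HM] := cts_bounded_ball (1 + K) (Sm_cts (Sm_d (lshift m i) Lhat_Sm)).
  exists M; split => // x u uK.
  have [k kint xk] := intvec_reduce x.
  have -> : row_mx x u = row_mx (x - k) u + row_mx k 0.
    by rewrite add_row_mx subrK addr0.
  rewrite derive_shift; first by apply: HM; exact: norm_row_mx.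
  move=> z; rewrite /Lhat !linearD/= row_mxKl row_mxKr addr0.
  by have [_ Lp _ _] := HL; exact: Lp.
have [M HM] := choice H.
have S0 : 0 <= \sum_i M i by apply: sumr_ge0 => i _; exact: (HM i).1.
exists (d%:R * \sum_i M i); first by rewrite mulr_ge0.
move=> x y u uK; rewrite -!Lhat_row_mx.
have D i z := derive_row_mx_l z u i (SmW Lhat_Sm).
apply: (bounded_gradient_lipschitz (g := fun z => Lhat L (row_mx z u))).
  by move=> i z; exact: (D i z).1.
move=> i z; rewrite (D i z).2; apply: (le_trans ((HM i).2 z u uK)).
by rewrite (bigD1 i)//= lerDl sumr_ge0// => j _; exact: (HM j).1.
Qed.

(** The gradient of [L x] at [v] serves: on the segment from [v] to [w] the second derivative is
    nonnegative, so the mean slope is at least the initial one. *)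
Lemma L_subgradient x v : exists q : 'I_m -> R,
  forall w : 'rV[R]_m, L x v + \sum_j q j * (w 0 j - v 0 j) <= L x w.
Proof.
exists (fun j => 'd_j (L x) v) => w.
have S2 := L_Sm x.
pose h := w - v.
pose phi t := L x (v + t *: h).
pose dphi t := 'D_h (L x) (v + t *: h).
have dL z : derivable (L x) z h.
  by have H := Sm_is_derive z h (SmW S2); exact: ex_derive.
have phiD (t : R) : is_derive t (1 : R) phi (dphi t) by exact: is_derive_line.
have dLE : 'D_h (L x) =1 fun z => \sum_j h 0 j * 'd_j (L x) z.
  by move=> z; have H := Sm_is_derive z h (SmW S2); rewrite derive_val.
have SdL : Sm 1 (fun z => 'D_h (L x) z).
  apply: (@Sm_ext _ _ _ (fun z => \sum_j h 0 j * 'd_j (L x) z)).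
    by move=> z; rewrite dLE.
  by apply: Sm_sum => j; apply: Sm_mul; [exact: Sm_cst|exact: Sm_d].
have dphiD (t : R) : is_derive t (1 : R) dphi ('D_h (fun z => 'D_h (L x) z) (v + t *: h)).
  apply: is_derive_line.
  by have H := Sm_is_derive (v + t *: h) h SdL; exact: ex_derive.
have cts (p dp : R -> R) A : (forall t : R, is_derive t (1 : R) p (dp t)) -> {within A, continuous p}.
  move=> pD; apply: continuous_subspaceT => t.
  have pDt := pD t; have d1 : derivable p t 1 by exact: ex_derive.
  exact/differentiable_continuous/derivable1_diffP.
have [c c01 E] := MVT_segment ler01 (fun t _ => phiD t) (cts _ _ _ phiD).
have c0 : 0 <= c by move: c01; rewrite in_itv/= => /andP[].
have [c' _ E'] := MVT_segment c0 (fun t _ => dphiD t) (cts _ _ _ dphiD).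
have : 0 <= dphi c - dphi 0.
  rewrite E' subr0 mulr_ge0//.
  by have [_ _ Lconv _] := HL; exact: Lconv.
move: E; rewrite /phi /dphi subr0 mulr1 scale1r scale0r addr0.
rewrite {1}/h (addrC v) subrK => E.
rewrite -E subr_ge0 dLE => H.
rewrite -lerBrDl (le_trans _ H)// le_eqVlt; apply/orP; left; apply/eqP.
by apply: eq_bigr => j _; rewrite mulrC !mxE.
Qed.

Lemma norm_le_enorm n (u : 'rV[R]_n) : `|u| <= enorm u.
Proof.
apply: norm_le_coord => [|i]; first exact: sqrtr_ge0.
rewrite -sqrtr_sqr /enorm ler_wsqrtr// (bigD1 i)//= lerDl sumr_ge0// => j _.
exact: sqr_ge0.
Qed.

Lemma L_growth : exists s K1 K2, [/\ 1 < s, 0 < K1 &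
  forall x u, K1 * `|u| `^ s - K2 <= L x u].
Proof.
have [_ _ _ [s [K1 [K2 [s1 K10 H]]]]] := HL.
exists s, K1, K2; split => // x u; apply: le_trans (H x u).
rewrite lerB// ler_wpM2l ?(ltW K10)//; apply: ge0_ler_powR; rewrite ?nnegrE//.
- by rewrite ltW// (lt_trans _ s1).
- exact: sqrtr_ge0.
- exact: norm_le_enorm.
Qed.

Lemma L_bounded_below : exists2 C, 0 <= C & forall x u, - C <= L x u.
Proof.
have [s [K1 [K2 [s1 K10 H]]]] := L_growth.
exists `|K2| => // x u; apply: le_trans (H x u).
have := mulr_ge0 (ltW K10) (powR_ge0 `|u| s); have := ler_norm K2; lra.
Qed.

(* Fast pieces of a curve may be slowed down to unit speed without increasing [L - c]. *)
Lemma L_slow_down c : exists2 K, 1 <= K & forall x y u v, K <= `|u| -> `|v| <= 1 ->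
  `|u| * (L y v - c) <= L x u - c.
Proof.
have [s [K1 [K2 [s1 K10 H]]]] := L_growth.
have [M M0 HM] := L_bounded 1.
pose A := M + `|c| + `|K2| + `|c|.
have A0 : 0 <= A by rewrite !addr_ge0.
have sm : 0 < s - 1 by rewrite subr_gt0.
(* For a control of norm at least [K], [K1 * |u|^(s-1)] is at least [A], which covers both the cost
   per unit time at unit speed and the constants [K2] and [c]. *)
pose K := Num.max 1 ((A / K1) `^ (s - 1)^-1).
have K1K : 1 <= K by rewrite le_max lexx.
exists K => // x y u v Ku v1; apply: le_trans (lerB (H x u) (lexx _)).
have u1 : 1 <= `|u| by exact: le_trans Ku.
have u0 : 0 < `|u| by exact: lt_le_trans u1.
have -> : `|u| `^ s = `|u| * `|u| `^ (s - 1).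
  rewrite -{2}(powRr1 (ltW u0)) -powRD; first by rewrite addrC subrK.
  by apply/implyP => _; rewrite gt_eqF.
have AK : A <= K1 * `|u| `^ (s - 1).
  rewrite mulrC -ler_pdivrMr//.
  have -> : A / K1 = ((A / K1) `^ (s - 1)^-1) `^ (s - 1).
    by rewrite -powRrM mulVf ?gt_eqF// powRr1// divr_ge0// ltW.
  apply: ge0_ler_powR; rewrite ?nnegrE ?powR_ge0 ?(ltW sm) ?(ltW u0)//.
  by apply: le_trans Ku; rewrite /K le_max lexx orbT.
have Lv := HM y v v1.
have Lc : L y v - c <= M + `|c|.
  by have := ler_norm (L y v); have := ler_norm (- c); rewrite normrN; lra.
have P1 : `|u| * (L y v - c) <= `|u| * (M + `|c|) by rewrite ler_wpM2l// ltW.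
have P2 : `|u| * A <= `|u| * (K1 * `|u| `^ (s - 1)) by rewrite ler_wpM2l// ltW.
have P3 : K2 + c <= `|u| * (`|K2| + `|c|).
  have := ler_norm K2; have := ler_norm c; have := normr_ge0 K2; have := normr_ge0 c.
  nra.
have -> : K1 * (`|u| * `|u| `^ (s - 1)) = `|u| * (K1 * `|u| `^ (s - 1)) by ring.
have eA : `|u| * A = `|u| * (M + `|c|) + `|u| * (`|K2| + `|c|) by rewrite /A; ring.
by move: P1 P2 P3; rewrite eA; clear; lra.
Qed.

End Lagrangian.

(** * Bounds on the control fields and a continuous left inverse of F *)

Section ControlledField.
Variables (R : realType) (d m : nat) (f : 'I_m -> 'rV[R]_d -> 'rV[R]_d).
Hypothesis HF : hypF f.

Lemma Fapp_coord x u i : Fapp f x u 0 i = \sum_j u 0 j * f j x 0 i.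
Proof. by rewrite /Fapp !mxE; apply: eq_bigr => j _; rewrite !mxE mulrC. Qed.

Lemma FappD x u v : Fapp f x (u + v) = Fapp f x u + Fapp f x v.
Proof. by rewrite /Fapp linearD/= mulmxDr linearD. Qed.

Lemma FappZ x a u : Fapp f x (a *: u) = a *: Fapp f x u.
Proof. by rewrite /Fapp linearZ/= -scalemxAr linearZ. Qed.

Lemma Fapp_delta x j : Fapp f x (delta_mx 0 j) = f j x.
Proof.
apply/rowP => i; rewrite Fapp_coord (bigD1 j)//= mxE !eqxx mul1r big1 ?addr0//.
by move=> l lj; rewrite mxE eqxx/= (negbTE lj) mul0r.
Qed.

Lemma f_Sm k j i : Sm k (fun x => f j x 0 i).
Proof. by have [H _ _ _ _] := HF; exact/Ck_coord/H. Qed.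

Lemma f_periodic j i : Zperiodic (fun x => f j x 0 i).
Proof. by have [_ H _ _ _] := HF; move=> x k ik; rewrite H. Qed.

Lemma f_bounded : exists2 M, 0 <= M & forall j x, `|f j x| <= M.
Proof.
have H (p : 'I_m * 'I_d) : exists M, 0 <= M /\ forall x, `|f p.1 x 0 p.2| <= M.
  have [M M0 HM] := periodic_bounded (Sm_cts (f_Sm 0 p.1 p.2)) (@f_periodic p.1 p.2).
  by exists M.
have [M HM] := choice H.
have S0 : 0 <= \sum_p M p by apply: sumr_ge0 => p _; exact: (HM p).1.
exists (\sum_p M p) => // j x; apply: norm_le_coord => // i.
apply: (le_trans ((HM (j, i)).2 x)).
by rewrite (bigD1 (j, i))//= lerDl sumr_ge0// => p _; exact: (HM p).1.
Qed.

Lemma f_lipschitz : exists2 M, 0 <= M & forall j x y, `|f j x - f j y| <= M * `|x - y|.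
Proof.
have H (p : 'I_m * 'I_d) : exists M, 0 <= M /\
    forall x y, `|f p.1 x 0 p.2 - f p.1 y 0 p.2| <= M * `|x - y|.
  have [M M0 HM] := periodic_lipschitz (f_Sm 1 p.1 p.2) (@f_periodic p.1 p.2).
  by exists M.
have [M HM] := choice H.
have S0 : 0 <= \sum_p M p by apply: sumr_ge0 => p _; exact: (HM p).1.
exists (\sum_p M p) => // j x y; apply: norm_le_coord => [|i]; first exact: mulr_ge0.
rewrite !mxE; apply: (le_trans ((HM (j, i)).2 x y)); rewrite ler_wpM2r//.
by rewrite (bigD1 (j, i))//= lerDl sumr_ge0// => p _; exact: (HM p).1.
Qed.

Lemma FappE x u : Fapp f x u = \sum_j u 0 j *: f j x.
Proof.
by apply/rowP => i; rewrite Fapp_coord summxE; apply: eq_bigr => j _; rewrite mxE.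
Qed.

Lemma Fapp_bounded : exists2 B, 0 <= B & forall x u, `|Fapp f x u| <= B * `|u|.
Proof.
have [M M0 HM] := f_bounded; exists (m%:R * M); first by rewrite mulr_ge0.
move=> x u; rewrite FappE (le_trans (ler_norm_sum _ _ _))//.
rewrite (_ : m%:R * M * _ = \sum_(j < m) `|u| * M).
  by apply: ler_sum => j _; rewrite normrZ ler_pM// coord_norm_le.
by rewrite sumr_const card_ord -[RHS]mulr_natl; ring.
Qed.

Lemma Fapp_lipschitz : exists2 C, 0 <= C &
  forall x y u, `|Fapp f x u - Fapp f y u| <= C * `|x - y| * `|u|.
Proof.
have [M M0 HM] := f_lipschitz; exists (m%:R * M); first by rewrite mulr_ge0.
move=> x y u; rewrite !FappE -sumrB (le_trans (ler_norm_sum _ _ _))//.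
rewrite (_ : m%:R * M * _ * _ = \sum_(j < m) `|u| * (M * `|x - y|)).
  by apply: ler_sum => j _; rewrite -scalerBr normrZ ler_pM// coord_norm_le.
by rewrite sumr_const card_ord -[RHS]mulr_natl; ring.
Qed.

Lemma mulmx_tr_eq0 n (z : 'rV[R]_n) : z *m z^T = 0 -> z = 0.
Proof.
move=> zz; have : \sum_i (z 0 i) ^+ 2 = 0.
  have := congr1 (fun A : 'M[R]_1 => A 0 0) zz; rewrite !mxE => E; rewrite -[RHS]E.
  by apply: eq_bigr => i _; rewrite mxE expr2.
move/eqP; rewrite psumr_eq0 => [/allP H|i _]; last exact: sqr_ge0.
apply/rowP => i; have := H i (mem_index_enum _); rewrite sqrf_eq0 => /eqP ->.
by rewrite mxE.
Qed.

Let Gram x := (Fmat f x)^T *m Fmat f x.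

(** The Moore-Penrose left inverse of [Fmat f x], available since the columns are independent. It
    recovers a control from the velocity that it produces. *)
Definition Fpinv x : 'M[R]_(m, d) := invmx (Gram x) *m (Fmat f x)^T.

(** If [w] kills the Gram matrix, then [w *m (Fmat f x)^T] has Euclidean norm 0, and full rank gives
    [w = 0]. *)
Lemma Gram_unit x : Gram x \in unitmx.
Proof.
rewrite -row_free_unit; apply: inj_row_free => w wG.
have w0 : w *m (Fmat f x)^T = 0.
  by apply: mulmx_tr_eq0; rewrite trmx_mul trmxK mulmxA -(mulmxA w) -/(Gram x) wG mul0mx.
have rf : row_free (Fmat f x)^T.
  by have [_ _ _ _ H] := HF; rewrite /row_free mxrank_tr H.
by apply: (row_free_inj rf); rewrite /= w0 mul0mx.
Qed.

Lemma Fpinv_Fapp x u : Fpinv x *m (Fapp f x u)^T = u^T.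
Proof.
by rewrite /Fapp trmxK /Fpinv -mulmxA (mulmxA _ (Fmat f x)) -/(Gram x) mulKmx// Gram_unit.
Qed.

Let cts_big (T : Type) (r : seq T) (g : T -> 'rV[R]_d -> R) :
  (forall t, continuous (g t)) ->
  continuous (fun x => \sum_(t <- r) g t x) /\ continuous (fun x => \prod_(t <- r) g t x).
Proof.
move=> cg; elim: r => [|t r [IH1 IH2]].
  split.
    rewrite (_ : (fun x => _) = fun=> 0); first exact: cst_continuous.
    by apply/funext => x; rewrite big_nil.
  rewrite (_ : (fun x => _) = fun=> 1); first exact: cst_continuous.
  by apply/funext => x; rewrite big_nil.
split.
  rewrite (_ : (fun x => _) = fun x => g t x + \sum_(t <- r) g t x); first exact: cts_add.
  by apply/funext => x; rewrite big_cons.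
rewrite (_ : (fun x => _) = fun x => g t x * \prod_(t <- r) g t x); first exact: cts_mul.
by apply/funext => x; rewrite big_cons.
Qed.

Let cts_mulmx p q r (A : 'rV[R]_d -> 'M[R]_(p, q)) (B : 'rV[R]_d -> 'M[R]_(q, r)) :
  (forall i j, continuous (fun x => A x i j)) -> (forall i j, continuous (fun x => B x i j)) ->
  forall i j, continuous (fun x => (A x *m B x) i j).
Proof.
move=> cA cB i j.
rewrite (_ : (fun x => _) = fun x => \sum_k A x i k * B x k j).
  by apply: (cts_big _ _).1 => k; exact: cts_mul.
by apply/funext => x; rewrite mxE.
Qed.

Let cts_det p (A : 'rV[R]_d -> 'M[R]_p) : (forall i j, continuous (fun x => A x i j)) ->
  continuous (fun x => \det (A x)).
Proof.
move=> cA; apply: (cts_big _ _).1 => s; apply: cts_mul; first exact: cst_continuous.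
by apply: (cts_big _ _).2 => i; exact: cA.
Qed.

Let cts_adj p (A : 'rV[R]_d -> 'M[R]_p) : (forall i j, continuous (fun x => A x i j)) ->
  forall i j, continuous (fun x => (\adj (A x)) i j).
Proof.
move=> cA i j.
rewrite (_ : (fun x => _) = fun x => (-1) ^+ (j + i) * \det (row' j (col' i (A x)))).
  apply: cts_mul; first exact: cst_continuous.
  apply: cts_det => k l; rewrite (_ : (fun x => _) = fun x => A x (lift j k) (lift i l)).
    exact: cA.
  by apply/funext => x; rewrite !mxE.
by apply/funext => x; rewrite mxE.
Qed.

(** By Cramer's formula the entries are polynomials in continuous functions, divided by a
    determinant that never vanishes. *)
Lemma Fpinv_continuous i j : continuous (fun x => Fpinv x i j).
Proof.
have cF k l : continuous (fun x => Fmat f x k l).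
  rewrite (_ : (fun x => _) = fun x => f l x 0 k); first exact: (Sm_cts (f_Sm 0 l k)).
  by apply/funext => x; rewrite mxE.
have cFt k l : continuous (fun x => (Fmat f x)^T k l).
  rewrite (_ : (fun x => _) = fun x => Fmat f x l k); first exact: cF.
  by apply/funext => x; rewrite mxE.
have cG k l : continuous (fun x => Gram x k l) by exact: cts_mulmx.
apply: cts_mulmx => // k l.
rewrite (_ : (fun x => _) = fun x => (\det (Gram x))^-1 * (\adj (Gram x)) k l).
  apply: cts_mul; last exact: cts_adj.
  move=> x; apply: (@cvgV R 'rV[R]_d (nbhs x) (nbhs_filter x) (fun x => \det (Gram x))).
    by have := Gram_unit x; rewrite unitmxE unitfE.
  exact: cts_det.
by apply/funext => x; rewrite /invmx Gram_unit mxE.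
Qed.

End ControlledField.

(** * Compactness along ultrafilters *)

Section UltraLimits.
Variable R : realType.

Lemma fmap_ultra (T V : Type) (U : set_system T) (a : T -> V) :
  UltraFilter U -> UltraFilter (a @ U).
Proof.
move=> UU; split; first exact: fmap_proper_filter.
move=> G GG UG; apply/seteqP; split => // A GA.
have [//|UC] := in_ultra_setVsetC (a @^-1` A) UU.
have /UG GC : (a @ U) (~` A) by [].
have G0 : G set0 by rewrite -(setICr A); exact: filterI.
by have [] := filter_ex G0.
Qed.

(** This replaces the extraction of subsequences: one ultrafilter gives limits at all times of a
    curve at once, without Ascoli's theorem. *)
Lemma ultra_bounded_cvg n (T : Type) (U : set_system T) {UU : UltraFilter U}
    (a : T -> 'rV[R]_n) (M : R) :
  (\forall t \near U, `|a t| <= M) -> exists l : 'rV[R]_n, a @ U --> l.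
Proof.
move=> aM.
have := @compact_norm_le R n M; rewrite compact_ultra => /(_ (a @ U) (fmap_ultra a UU) aM) [l [_ al]].
by exists l.
Qed.

Lemma ultra_bounded_cvg_R (T : Type) (U : set_system T) {UU : UltraFilter U}
    (a : T -> R) (M : R) :
  (\forall t \near U, `|a t| <= M) -> exists l : R, a @ U --> l.
Proof.
move=> aM.
have bM : \forall t \near U, `|(const_mx (a t) : 'rV[R]_1)| <= `|M|.
  apply: filterS aM => t aM; apply: norm_le_coord => // i.
  by rewrite mxE (le_trans aM)// ler_norm.
have [l al] := ultra_bounded_cvg bM.
exists (l 0 0); have /cvg_rVP/(_ 0) := al.
by under eq_fun do rewrite mxE.
Qed.

End UltraLimits.

(** All the constants of the system, fixed once so that later statements share them: [bK] is the
    bound on controls after slowing down, [bB] bounds F, [bLF] and [bLL] are Lipschitz constants in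
    x, and [bC0] and [- bC1] bound [L - c] from above (for controls up to [bK]) and from below. *)
Record bounds (R : realType) (d m : nat) (f : 'I_m -> 'rV[R]_d -> 'rV[R]_d)
    (L : 'rV[R]_d -> 'rV[R]_m -> R) (c : R) := Bounds {
  bK : R; bB : R; bLF : R; bLL : R; bC0 : R; bC1 : R;
  bHF : hypF f;
  bHL : hypL L;
  bK1 : 1 <= bK;
  bB0 : 0 <= bB;
  bLF0 : 0 <= bLF;
  bLL0 : 0 <= bLL;
  bFapp : forall x u, `|Fapp f x u| <= bB * `|u|;
  bFlip : forall x y u, `|Fapp f x u - Fapp f y u| <= bLF * `|x - y| * `|u|;
  bLlip : forall x y u, `|u| <= bK -> `|L x u - L y u| <= bLL * `|x - y|;
  bLup : forall x u, `|u| <= bK -> L x u - c <= bC0;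
  bLlow : forall x u, - bC1 <= L x u - c;
  bslow : forall x y u v, bK <= `|u| -> `|v| <= 1 -> `|u| * (L y v - c) <= L x u - c
}.

Arguments bLlip {R d m f L c} b x y {u}.
Arguments bLup {R d m f L c} b x {u}.
Arguments bslow {R d m f L c} b x y {u v}.

Lemma bounds_exist (R : realType) (d m : nat) (f : 'I_m -> 'rV[R]_d -> 'rV[R]_d)
    (L : 'rV[R]_d -> 'rV[R]_m -> R) (c : R) :
  hypF f -> hypL L -> exists _ : bounds f L c, True.
Proof.
move=> HF HL.
have [K K1 slow] := L_slow_down HL c.
have [B B0 HB] := Fapp_bounded HF.
have [LF LF0 HLF] := Fapp_lipschitz HF.
have [LL LL0 HLL] := L_lipschitz HL K.
have [M M0 HM] := L_bounded HL K.
have [C1 C10 HC1] := L_bounded_below HL.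
unshelve eexists; last by [].
apply: (@Bounds _ _ _ _ _ _ K B LF LL (M - c) (C1 + c)) => //.
  by move=> x u uK; rewrite lerB// (le_trans (ler_norm _))// HM.
by move=> x u; have := HC1 x u; lra.
Qed.

(** * Weak trajectories, defined by increments between pairs of times *)

Section WeakTrajectories.
Variables (R : realType) (d m : nat) (f : 'I_m -> 'rV[R]_d -> 'rV[R]_d).
Variables (L : 'rV[R]_d -> 'rV[R]_m -> R) (c : R) (D : bounds f L c).
Notation K := (bK D).
Notation B := (bB D).
Notation LF := (bLF D).
Notation LL := (bLL D).
Notation C0 := (bC0 D).
Notation C1 := (bC1 D).
Let HF : hypF f := bHF D.
Let HL : hypL L := bHL D.
Let K1 : 1 <= K := bK1 D.
Let B0 : 0 <= B := bB0 D.
Let LF0 : 0 <= LF := bLF0 D.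
Let LL0 : 0 <= LL := bLL0 D.
Let hB x u : `|Fapp f x u| <= B * `|u| := bFapp D x u.
Let hLF x y u : `|Fapp f x u - Fapp f y u| <= LF * `|x - y| * `|u| := bFlip D x y u.
Let hLL x y u : `|u| <= K -> `|L x u - L y u| <= LL * `|x - y| := @bLlip R d m f L c D x y u.
Let hC0 x u : `|u| <= K -> L x u - c <= C0 := @bLup R d m f L c D x u.
Let hC1 x u : - C1 <= L x u - c := bLlow D x u.

(** Moving the base point of a step by [B * K * t1] changes its displacement by at most the first
    summand times [t1 * t2] and its cost by at most the second; [bC] absorbs both. *)
Definition bC := LF * (B * K) * K + LL * (B * K).
Notation C := bC.


Lemma bK0 : 0 <= K. Proof. exact: le_trans K1. Qed.
Lemma bBK0 : 0 <= B * K. Proof. exact: mulr_ge0 B0 bK0. Qed.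
Lemma bC_F : LF * (B * K) * K <= C. Proof. by rewrite lerDl mulr_ge0 ?bBK0. Qed.
Lemma bC_L : LL * (B * K) <= C. Proof. by rewrite lerDr !mulr_ge0 ?bK0. Qed.
Lemma bC_ge0 : 0 <= C. Proof. by rewrite addr_ge0 ?mulr_ge0 ?bK0 ?bBK0. Qed.

Let K0 := bK0.
Let BK0 := bBK0.
Let CF := bC_F.
Let CL := bC_L.
Let C_ge0 := bC_ge0.

(* A discrete form of [y' = F(y) u, l' >= L(y, u) - c, |u| <= K], stable under
   concatenation and pointwise limits. *)
Definition step (tau : R) (y y' : 'rV[R]_d) (a : R) : Prop :=
  [/\ `|y' - y| <= B * K * tau, - C1 * tau <= a &
   exists v : 'rV[R]_m, [/\ `|v| <= K,
     `|y' - y - tau *: Fapp f y v| <= C * tau ^+ 2 &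
     tau * (L y v - c) - C * tau ^+ 2 <= a]].

Lemma step_le (tau : R) y y' (a a' : R) : a <= a' -> step tau y y' a -> step tau y y' a'.
Proof.
move=> aa' [H1 H2 [v [v1 v2 v3]]]; split => //; first exact: le_trans aa'.
by exists v; split => //; exact: le_trans aa'.
Qed.

Lemma step_C0 (tau : R) y y' a : 0 <= tau -> step tau y y' a -> step tau y y' (C0 * tau).
Proof.
move=> tau0 [H1 H2 [v [v1 v2 v3]]]; split => //.
  by rewrite ler_wpM2r// (le_trans (hC1 y v))// hC0.
exists v; split => //.
have t2 : 0 <= C * tau ^+ 2 by rewrite mulr_ge0// sqr_ge0.
by have := ler_wpM2l tau0 (hC0 y v1); move: t2; lra.
Qed.

Lemma Fapp_shift x k u : intvec k -> Fapp f (x + k) u = Fapp f x u.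
Proof.
move=> ik; rewrite !FappE; apply: eq_bigr => j _.
by have [_ H _ _ _] := HF; rewrite H.
Qed.

Lemma L_shift x k u : intvec k -> L (x + k) u = L x u.
Proof. by move=> ik; have [_ H _ _] := HL; exact: (H u). Qed.

Lemma step_shift tau y y' a k : intvec k -> step tau y y' a -> step tau (y + k) (y' + k) a.
Proof.
move=> ik [H1 H2 [v [v1 v2 v3]]]; split => //.
  by rewrite opprD addrACA subrr addr0.
by exists v; split => //; rewrite ?L_shift// Fapp_shift// opprD addrACA subrr addr0.
Qed.

(** The control of the union is the time average [z] of the two controls. The displacement is linear
    in the control, and convexity of L bounds the averaged cost. Replacing the base point [y1] by
    [y] costs at most [C * (t1 * t2)], which the cross terms of [C * (t1 + t2) ^+ 2] pay for. *)
Lemma step_cat (t1 t2 : R) y y1 y2 a1 a2 : 0 <= t1 -> 0 <= t2 ->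
  step t1 y y1 a1 -> step t2 y1 y2 a2 -> step (t1 + t2) y y2 (a1 + a2).
Proof.
move=> t10 t20 [H1 H2 [v [v1 v2 v3]]] [G1 G2 [w [w1 w2 w3]]].
have E : y2 - y = (y2 - y1) + (y1 - y) by rewrite addrA subrK.
split.
- by rewrite E addrC mulrDr (le_trans (ler_normD _ _))// lerD.
- by rewrite mulrDr lerD.
have [t0|t0] := eqVneq (t1 + t2) 0.
  have [e1 e2] : t1 = 0 /\ t2 = 0 by split; lra.
  move: v2 v3 w2 w3; rewrite t0 e1 e2 expr0n/= !mulr0 !scale0r !subr0 !mul0r => v2 v3 w2 w3.
  exists v; split => //.
    rewrite scale0r subr0 E (le_trans (ler_normD _ _))//.
    by rewrite -[X in _ <= X]addr0 lerD.
  by rewrite mul0r subr0 addr_ge0.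
have {}t0 : 0 < t1 + t2 by rewrite lt0r t0 addr_ge0.
pose z := (t1 + t2)^-1 *: (t1 *: v + t2 *: w).
have tz : (t1 + t2) *: z = t1 *: v + t2 *: w.
  by rewrite /z scalerA mulfV ?scale1r// gt_eqF.
have zK : `|z| <= K.
  rewrite /z normrZ ger0_norm ?invr_ge0 ?(ltW t0)// ler_pdivrMl//.
  rewrite (le_trans (ler_normD _ _))// !normrZ !ger0_norm// mulrDl.
  by rewrite lerD// ler_wpM2l.
clearbody z.
have t12 : 0 <= t1 * t2 by exact: mulr_ge0.
have Ct : 0 <= C * (t1 * t2) by exact: mulr_ge0.
have sq : C * (t1 + t2) ^+ 2 = C * t1 ^+ 2 + C * t2 ^+ 2 + C * (t1 * t2) + C * (t1 * t2).
  by ring.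
have y1y : `|y1 - y| <= B * K * t1 by [].
exists z; split => //.
  rewrite -FappZ tz FappD !FappZ.
  have -> : y2 - y - (t1 *: Fapp f y v + t2 *: Fapp f y w) =
    (y1 - y - t1 *: Fapp f y v) + ((y2 - y1 - t2 *: Fapp f y1 w)
      + t2 *: (Fapp f y1 w - Fapp f y w)).
    by rewrite E; apply/rowP => i; rewrite !mxE; ring.
  have H3 : `|t2 *: (Fapp f y1 w - Fapp f y w)| <= C * (t1 * t2).
    rewrite normrZ ger0_norm//.
    have := hLF y1 y w.
    have : LF * `|y1 - y| * `|w| <= LF * (B * K * t1) * K.
      by apply: ler_pM => //; [exact: mulr_ge0|rewrite ler_wpM2l].
    move=> A1 A2; have A3 := ler_wpM2l t20 (le_trans A2 A1).
    apply: (le_trans A3).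
    rewrite (_ : t2 * _ = LF * (B * K) * K * (t1 * t2)); last by ring.
    by rewrite ler_wpM2r.
  apply: (le_trans (ler_normD _ _)).
  have := ler_normD (y2 - y1 - t2 *: Fapp f y1 w) (t2 *: (Fapp f y1 w - Fapp f y w)).
  by rewrite sq; move: v2 w2 H3 Ct; lra.
(* Jensen's inequality for two points: the linear terms of the subgradient at [z] cancel after
   weighting by [t1] and [t2]. *)
have [q Hq] := L_subgradient HL y z.
have Lv := Hq v; have Lw := Hq w.
have S0 : t1 * \sum_j q j * (v 0 j - z 0 j) + t2 * \sum_j q j * (w 0 j - z 0 j) = 0.
  rewrite !mulr_sumr -big_split/= big1// => j _.
  have := congr1 (fun x : 'rV[R]_m => x 0 j) tz; rewrite !mxE => e.
  transitivity (q j * ((t1 * v 0 j + t2 * w 0 j) - (t1 + t2) * z 0 j)); first by ring.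
  by rewrite e; ring.
have Lw1 : L y w - LL * (B * K * t1) <= L y1 w.
  have := hLL y1 y w1.
  have := ler_wpM2l LL0 y1y.
  by have := ler_norm (- (L y1 w - L y w)); rewrite normrN; lra.
have P1 := ler_wpM2l t10 Lv.
have P2 := ler_wpM2l t20 Lw.
have P3 := ler_wpM2l t20 Lw1.
have P4 : t2 * (LL * (B * K * t1)) <= C * (t1 * t2).
  rewrite (_ : t2 * _ = LL * (B * K) * (t1 * t2)); last by ring.
  by rewrite ler_wpM2r.
rewrite sq; move: v3 w3 P1 P2 P3 P4 Ct S0.
rewrite !mulrBr !mulrDr !mulrDl; lra.
Qed.

(** The condition bears on all pairs of times rather than on derivatives, so that it passes to
    pointwise limits. The function [l] is a running action that may exceed the true one. *)
Definition wk (g : R -> 'rV[R]_d) (l : R -> R) (a b : R) : Prop :=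
  forall s t, a <= s -> s <= t -> t <= b -> step (t - s) (g s) (g t) (l t - l s).

Lemma wk_sub g l a b a' b' : a <= a' -> b' <= b -> wk g l a b -> wk g l a' b'.
Proof.
move=> aa bb H s t as_ st tb; apply: H => //; first exact: le_trans as_.
exact: le_trans bb.
Qed.

Lemma wk_cat g l a p b : wk g l a p -> wk g l p b -> wk g l a b.
Proof.
move=> H1 H2 s t as_ st tb.
have [tp|pt] := leP t p; first exact: H1.
have [sp|ps] := leP s p; last by apply: H2 => //; exact: ltW.
have := step_cat _ _ (H1 s p as_ sp (lexx _)) (H2 p t (lexx _) (ltW pt) tb).
rewrite !subr_ge0 => /(_ sp (ltW pt)).
by congr step; ring.
Qed.

(** The witnessing controls are bounded by [K], hence converge along the ultrafilter, and all the
    inequalities are closed conditions. *)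
Lemma step_limit (T : Type) (U : set_system T) {UU : UltraFilter U} (tau : R)
    (y y' : T -> 'rV[R]_d) (a : T -> R)
    (ly ly' : 'rV[R]_d) (la : R) : 0 <= tau ->
  y @ U --> ly -> y' @ U --> ly' -> a @ U --> la ->
  (\forall t \near U, step tau (y t) (y' t) (a t)) -> step tau ly ly' la.
Proof.
move=> tau0 cy cy' ca H.
have cle (g h : T -> R) (lg lh : R) : g @ U --> lg -> h @ U --> lh ->
    (\forall t \near U, g t <= h t) -> lg <= lh.
  move=> cg ch gh; rewrite -subr_ge0.
  have gh' : \forall t \near U, 0 <= h t - g t by apply: filterS gh => t; rewrite subr_ge0.
  exact: (@closed_cvg _ _ U _ (fun t => h t - g t) (fun x : R => 0 <= x) (@closed_ge _ 0) gh' _ (cvgB ch cg)).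
have cn n (h : T -> 'rV[R]_n) (lh : 'rV[R]_n) : h @ U --> lh -> (fun t => `|h t|) @ U --> `|lh|.
  by move=> ch; exact: cvg_norm.
split.
- apply: (cle _ (fun=> B * K * tau) _ _ (cn _ _ _ (cvgB cy' cy)) (cvg_cst _)).
  by apply: filterS H => t [].
- by apply: (cle _ _ _ _ (cvg_cst _) ca); apply: filterS H => t [].
have ex t : exists v : 'rV[R]_m, step tau (y t) (y' t) (a t) -> [/\ `|v| <= K,
     `|y' t - y t - tau *: Fapp f (y t) v| <= C * tau ^+ 2 &
     tau * (L (y t) v - c) - C * tau ^+ 2 <= a t].
  have [[_ _ [v Hv]]|N] := pselect (step tau (y t) (y' t) (a t)); first by exists v.
  by exists 0.
have [v Hv] := choice ex.
have vK : \forall t \near U, `|v t| <= K by apply: filterS H => t /Hv [].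
have [lv cv] := ultra_bounded_cvg vK.
have d0 n (h : T -> 'rV[R]_n) (lh : 'rV[R]_n) : h @ U --> lh -> (fun t => `|h t - lh|) @ U --> (0 : R).
  move=> ch; rewrite -(normr0 'rV[R]_n) -(subrr lh).
  by apply: cn; apply: cvgB => //; exact: cvg_cst.
have sq0 (p q : T -> R) (lp : R) : (fun t => q t) @ U --> (0 : R) -> 
    (\forall t \near U, `|p t - lp| <= q t) -> p @ U --> lp.
  move=> q0 pq; apply/cvgrPdist_le => e e0.
  have := q0 => /cvgrPdist_le/(_ e e0).
  apply: filter_app; apply: filterS pq => t pq; rewrite sub0r normrN => qe.
  by rewrite distrC (le_trans pq)// (le_trans _ qe)// ler_norm.
have cF : (fun t => `|Fapp f (y t) (v t) - Fapp f ly lv|) @ U --> (0 : R).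
  apply: (@sq0 _ (fun t => LF * `|y t - ly| * K + B * `|v t - lv|)).
    rewrite (_ : 0 = LF * 0 * K + B * 0); last by rewrite !mulr0 mul0r addr0.
    apply: cvgD; apply: cvgM; try exact: cvg_cst; last exact: d0.
    by apply: cvgM; [exact: cvg_cst|exact: d0].
  apply: filterS vK => t vtK; rewrite subr0 normr_id.
  rewrite -(subrKA (Fapp f ly (v t))) (le_trans (ler_normD _ _))// lerD//.
    by rewrite (le_trans (hLF _ _ _))// ler_wpM2l// mulr_ge0.
  have -> : Fapp f ly (v t) - Fapp f ly lv = Fapp f ly (v t - lv).
    by rewrite FappD -scaleN1r -[in RHS]scaleN1r FappZ.
  exact: hB.
have cFv : (fun t => Fapp f (y t) (v t)) @ U --> Fapp f ly lv.
  apply/cvgrPdist_le => e e0; have := cF => /cvgrPdist_le/(_ e e0).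
  by apply: filterS => t; rewrite sub0r normrN normr_id distrC.
have cLy : (fun t => L ly (v t)) @ U --> L ly lv.
  have Z : continuous (L ly) := Sm_cts (L_Sm HL ly).
  have H1 := @continuous_cvg T _ _ U _ v (L ly) lv (Z lv) cv.
  exact: H1.
have cL : (fun t => L (y t) (v t)) @ U --> L ly lv.
  apply: (@sq0 _ (fun t => LL * `|y t - ly| + `|L ly (v t) - L ly lv|)).
    rewrite (_ : 0 = LL * 0 + `|L ly lv - L ly lv|); last by rewrite mulr0 subrr normr0 addr0.
    apply: cvgD; first by apply: cvgM; [exact: cvg_cst|exact: d0].
    by apply: cvg_norm; apply: cvgB => //; exact: cvg_cst.
  apply: filterS vK => t vtK.
  by rewrite -(subrKA (L ly (v t))) (le_trans (ler_normD _ _))// lerD// hLL.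
exists lv; split.
- exact: (cle _ _ _ _ (cn _ _ _ cv) (cvg_cst _) vK).
- apply: (cle _ _ _ _ (cn _ _ _ (cvgB (cvgB cy' cy) (cvgZ (cvg_cst tau) cFv))) (cvg_cst (C * tau ^+ 2))).
  by apply: filterS H => t /Hv [].
- apply: (cle (fun t => tau * (L (y t) (v t) - c) - C * tau ^+ 2) _ _ _ _ ca).
    apply: cvgB; last exact: cvg_cst.
    apply: cvgM; first exact: cvg_cst.
    by apply: cvgB => //; exact: cvg_cst.
  by apply: filterS H => t /Hv [].
Qed.

End WeakTrajectories.

(** * Monotonicity from almost everywhere lower bounds on increments *)

Section DiniMonotone.
Variable R : realType.
Notation mu := (@lebesgue_measure R).

Let Ioc_split (a p b : R) : a <= p -> p <= b -> `]a, p] `|` `]p, b] = `]a, b]%classic.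
Proof.
move=> ap pb; apply/seteqP; split => x /=; rewrite !in_itv/=.
  by move=> [/andP[ax xp]|/andP[px xb]]; rewrite ?ax ?xb ?(le_trans xp) ?(le_lt_trans ap).
move=> /andP[ax xb].
by have [xp|px] := leP x p; [left; rewrite ax|right].
Qed.

Let mIoc (O : set R) (a b : R) : open O -> measurable (O `&` `]a, b]%classic : set (measurableTypeR R)).
Proof. by move=> oO; apply: measurableI; [exact: open_measurable|exact: measurable_itv]. Qed.

(** Outer regularity gives [O], and [w p q] is the Lebesgue measure of the part of [O] in []p,
    q]]. *)
Lemma negligible_small_cover (N : set R) (e : R) : mu.-negligible N -> 0 < e ->
  exists O : set R, exists w : R -> R -> R,
  [/\ open O, N `<=` O,
    (forall p q r, p <= q -> q <= r -> w p r = w p q + w q r),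
    (forall p q, p <= q -> (forall t, p < t <= q -> O t) -> w p q = q - p) &
    (forall p q, 0 <= w p q < e)].
Proof.
move=> [N' [mN' N'0 NN']] e0.
have [|||O [oO NO muOlt]] := @lebesgue_regularity_outer _ N' e.
- by [].
- by apply: (@le_lt_trans _ _ 0%E); rewrite ?ltry//; move: N'0 => /= ->.
- by [].
have muO' : (mu O < e%:E)%E.
  have mO : measurable (O : set (measurableTypeR R)) by exact: open_measurable.
  apply: le_lt_trans muOlt.
  have -> : mu O = (mu (O `\` N') + mu (O `&` N'))%E.
    by apply: measureDI.
  rewrite (_ : mu (O `&` N') = 0%E) ?adde0//.
  apply/eqP; rewrite eq_le measure_ge0 andbT; move: (N'0) => <-.
  by apply: le_measure; rewrite ?inE//; exact: measurableI.
have muOle p q : (mu (O `&` `]p, q]%classic) <= mu O)%E.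
  by apply: le_measure; rewrite ?inE//; [exact: mIoc|exact: open_measurable].
have muOfin p q : mu (O `&` `]p, q]%classic) \is a fin_num.
  rewrite ge0_fin_numE ?measure_ge0//.
  by apply: le_lt_trans (lt_trans muO' (ltry _)).
exists O, (fun p q => fine (mu (O `&` `]p, q]%classic))); split => //.
- exact: subset_trans NO.
- move=> p q r pq qr; rewrite -fineD// -measureU; [|exact: mIoc|exact: mIoc|].
    by rewrite -setIUr Ioc_split.
  apply/seteqP; split => // x [[_ /=]] + [_ /=].
  by rewrite !in_itv/= => /andP[_ xm] /andP[+ _]; rewrite ltNge xm.
- move=> p q pq Opq.
  have -> : O `&` `]p, q]%classic = `]p, q]%classic.
    by apply/setIidPr => t; rewrite /= in_itv/=; exact: Opq.
  rewrite lebesgue_measure_itv/= lte_fin; case: ltP => //= qp.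
  by apply/eqP; rewrite eq_sym subr_eq0 eq_le pq qp.
- move=> p q; rewrite fine_ge0//= -lte_fin fineK//.
  exact: le_lt_trans muO'.
Qed.

(** Around points outside [N] the function loses at most [e] per unit length; around points of [N]
    the crude rate [M] applies only inside a cover of small measure. Interval induction adds up the
    losses. *)
Lemma dini_nondecreasing (psi : R -> R) (M : R) (N : set R) (a b : R) : a <= b ->
  (forall p q, a <= p -> p <= q -> q <= b -> - M * (q - p) <= psi q - psi p) ->
  mu.-negligible N ->
  (forall s, a <= s <= b -> ~ N s -> forall e, 0 < e -> exists2 d, 0 < d &
    forall p q, a <= p -> p <= s -> s <= q -> q <= b -> s - d < p -> q < s + d ->
      - e * (q - p) <= psi q - psi p) ->
  psi a <= psi b.
Proof.
move=> ab lip Nn good; rewrite -subr_ge0 -oppr_le0; apply/ler_addgt0Pr => e0 e00.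
rewrite add0r lerNl.
have M1 : 0 < `|M| + 1 by rewrite ltr_wpDl.
have ba0 : 0 < b - a + 1 by rewrite ltr_wpDl ?subr_ge0.
pose e := e0 / 2 / (b - a + 1).
have ep : 0 < e by rewrite !divr_gt0.
have e2 : 0 < e0 / 2 / (`|M| + 1) by rewrite !divr_gt0.
have [U [w [oO NO wadd wO wlt]]] := negligible_small_cover Nn e2.
pose P p q := p <= q -> a <= p -> q <= b -> - e * (q - p) - (`|M| + 1) * w p q <= psi q - psi p.
have : P a b.
  apply: (interval_induction ab).
    move=> p q r pq qr Ppq Pqr pr ap rb.
    have := Ppq pq ap (le_trans qr rb); have := Pqr qr (le_trans ap pq) rb.
    by rewrite (wadd p q r)// mulrDr; lra.
  move=> s sab; have [Ns|Ns] := pselect (N s).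
    have [dl d0 dO] := open_ball_R oO (NO _ Ns).
    exists dl => // p q ap ps sq qb sp qs pq _ _.
    rewrite wO//; last first.
      move=> t /andP[pt tq]; apply: dO.
      by rewrite ltr_distl; apply/andP; split; [apply: lt_trans pt|apply: le_lt_trans tq _].
    have := lip p q ap pq qb; have := ler_norm M.
    have : 0 <= q - p by rewrite subr_ge0.
    by move: ep; nra.
  have [dl d0 dh] := good s sab Ns e ep.
  exists dl => // p q ap ps sq qb sp qs pq _ _.
  have := dh p q ap ps sq qb sp qs.
  have /andP[w0 _] := wlt p q.
  have Mw : 0 <= (`|M| + 1) * w p q by rewrite mulr_ge0// ltW.
  by move: Mw; lra.
move=> /(_ ab (lexx _) (lexx _)); apply: le_trans.
have /andP[_ wl] := wlt a b.
have H1 : (`|M| + 1) * w a b <= e0 / 2.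
  rewrite -ler_pdivlMl// mulrC ltW//.
have H2 : e * (b - a) <= e0 / 2.
  by rewrite /e -mulrA ler_piMr ?divr_ge0 ?ltW// mulrC ltr_pdivrMr// mul1r ltrDl.
by move: H1 H2; lra.
Qed.

Lemma ae_forall_ord n (P : 'I_n -> R -> Prop) :
  (forall i, {ae mu, forall s, P i s}) -> {ae mu, forall s, forall i, P i s}.
Proof.
elim: n P => [|n IH] P H.
  by apply: (ae_mono (P := fun=> True)); [exact: aeW|move=> s _ []].
apply: (ae_mono2 (H ord0) (IH _ (fun i => H (lift ord0 i)))) => s P0 Pi i.
by case: (unliftP ord0 i) => [j ->|->].
Qed.

Lemma lipschitz_abs_cont (g : R -> R) (M a b : R) :
  (forall x y, `|g x - g y| <= M * `|x - y|) -> abs_cont g a b.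
Proof.
move=> lip e e0; have M1 : 0 < `|M| + 1 by rewrite ltr_wpDl.
exists (e / (`|M| + 1)); first by rewrite divr_gt0.
move=> s /allP sab _; rewrite ltr_pdivlMr// mulrC; apply: le_lt_trans.
rewrite mulr_sumr big_seq [leRHS]big_seq; apply: ler_sum => p /sab /andP[/andP[_ p12] _].
apply: (le_trans (lip _ _)); rewrite ger0_norm ?subr_ge0// ler_wpM2r ?subr_ge0//.
by rewrite (le_trans (ler_norm _))// lerDl.
Qed.

End DiniMonotone.

(** * The control of a weak trajectory at a point of differentiability *)

Section Velocity.
Variables (R : realType) (d m : nat) (f : 'I_m -> 'rV[R]_d -> 'rV[R]_d).
Variables (L : 'rV[R]_d -> 'rV[R]_m -> R) (c : R) (D : bounds f L c).
Notation K := (bK D).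
Notation B := (bB D).
Notation LF := (bLF D).
Notation C0 := (bC0 D).
Notation C1 := (bC1 D).
Notation C := (bC D).
Notation mu := (@lebesgue_measure R).

Lemma step_const (tau : R) y : 0 <= tau -> step D tau y y (C0 * tau).
Proof.
move=> tau0; have C0C1 : - C1 <= C0.
  by apply: le_trans (bLlow D y 0) _; apply: bLup; rewrite normr0 bK0.
have Ct : 0 <= C * tau ^+ 2 by rewrite mulr_ge0 ?bC_ge0// sqr_ge0.
split; first by rewrite subrr normr0 mulr_ge0// bBK0.
  by rewrite ler_wpM2r.
exists 0; split; first by rewrite normr0 bK0.
  by rewrite -(scale0r (0 : 'rV[R]_m)) FappZ scale0r scaler0 !subr0 subrr normr0.
have H : L y 0 - c <= C0 by apply: bLup; rewrite normr0 bK0.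
by have := ler_wpM2l tau0 H; move: Ct; lra.
Qed.

(** Outside [[a, b]] the curve stands still and pays [C0] per unit time, so later arguments may
    assume trajectories on the whole line. *)
Lemma wk_extend g l a b : a <= b -> wk D g l a b -> exists g' l',
  [/\ (forall p q, wk D g' l' p q), (forall s, a <= s <= b -> g' s = g s) &
      (forall s, a <= s <= b -> l' s = l s)].
Proof.
move=> ab H.
pose cl (s : R) := Num.max a (Num.min s b).
have clE s : a <= s <= b -> cl s = s.
  by move=> /andP[as_ sb]; rewrite /cl (min_idPl sb) (max_idPr as_).
have clL s : s <= a -> cl s = a.
  by move=> sa; rewrite /cl (min_idPl (le_trans sa ab)) (max_idPl sa).
have clR s : b <= s -> cl s = b.
  by move=> bs; rewrite /cl (min_idPr bs) (max_idPr ab).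
exists (g \o cl), (fun s => l (cl s) + C0 * (s - cl s)); split; last 2 first.
- by move=> s sab; rewrite /= clE.
- by move=> s sab; rewrite clE// subrr mulr0 addr0.
move=> p q; apply: (wk_sub (a := Num.min p a) (b := Num.max q b)).
- by rewrite ge_min lexx.
- by rewrite le_max lexx.
apply: (wk_cat (p := b)); first apply: (wk_cat (p := a)).
- move=> s t _ st ta; rewrite /= !clL// ?(le_trans st)//.
  have -> : l a + C0 * (t - a) - (l a + C0 * (s - a)) = C0 * (t - s) by ring.
  by apply: step_const; rewrite subr_ge0.
- move=> s t as_ st tb; rewrite /= !clE ?as_ ?tb ?(le_trans st) ?(le_trans as_)//.
  rewrite !subrr mulr0 !addr0; exact: H.
- move=> s t bs st _; rewrite /= !clR// ?(le_trans bs)//.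
  have -> : l b + C0 * (t - b) - (l b + C0 * (s - b)) = C0 * (t - s) by ring.
  by apply: step_const; rewrite subr_ge0.
Qed.

Section Global.
Variables (g : R -> 'rV[R]_d) (l : R -> R).
Hypothesis wgl : forall p q, wk D g l p q.

Lemma wk_lipschitz x y : `|g x - g y| <= B * K * `|x - y|.
Proof.
have H s t : s <= t -> `|g t - g s| <= B * K * `|t - s|.
  move=> st; have [H1 _ _] := wgl (lexx s) st (lexx t).
  by rewrite ger0_norm ?subr_ge0.
have [xy|/ltW yx] := leP x y; last exact: H.
by rewrite distrC (distrC x); exact: H.
Qed.

Lemma is_derive_dist_rV (s : R) v (e : R) : 0 < e -> is_derive s (1 : R) g v ->
  exists2 dl, 0 < dl & forall t, `|t - s| < dl ->
    `|g t - g s - (t - s) *: v| <= e * `|t - s|.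
Proof.
move=> e0 [dg gv].
have : (fun z : R => z^-1 *: ((g \o shift s) (z *: 1) - g s)) @ 0^' --> 'D_1 g s by exact: dg.
rewrite gv => /cvgrPdist_le => /(_ e e0) [dl /= d0 H].
exists dl => // t td.
have [->|ts] := eqVneq t s; first by rewrite !subrr scale0r subr0 !normr0 mulr0.
have ts0 : t - s != 0 by rewrite subr_eq0.
have /= := H (t - s).
rewrite !sub0r normrN /= => /(_ td ts0).
rewrite [(t - s) *: 1]mulr1 subrK => H1.
have -> : g t - g s - (t - s) *: v = - ((t - s) *: (v - (t - s)^-1 *: (g t - g s))).
  by rewrite scalerBr scalerA mulfV// scale1r opprB.
by rewrite normrN normrZ mulrC ler_wpM2r.
Qed.

Let mulmx_bound p q (A : 'M[R]_(p, q)) : exists2 M : R, 0 < M &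
  forall y : 'rV[R]_q, `|(A *m y^T)^T| <= M * `|y|.
Proof.
exists (\sum_i \sum_j `|A i j| + 1).
  by rewrite ltr_wpDl// sumr_ge0// => i _; rewrite sumr_ge0.
move=> y; apply: norm_le_coord => [|i].
  by rewrite mulr_ge0// addr_ge0// sumr_ge0// => i _; rewrite sumr_ge0.
rewrite !mxE (le_trans (ler_norm_sum _ _ _))//.
apply: (@le_trans _ _ (\sum_j `|A i j| * `|y|)).
  by apply: ler_sum => j _; rewrite normrM mxE ler_wpM2l// coord_norm_le.
rewrite -mulr_suml ler_wpM2r// (bigD1 i)//= -addrA lerDl addr_ge0//.
by rewrite sumr_ge0// => k _; rewrite sumr_ge0.
Qed.

(** Despite its name, this is the control that generates the velocity [v] at [g s], when there is
    one. *)
Definition velocity (s : R) (v : 'rV[R]_d) : 'rV[R]_m := (Fpinv f (g s) *m v^T)^T.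

Lemma velocity_Fapp s u : velocity s (Fapp f (g s) u) = u.
Proof. by rewrite /velocity (Fpinv_Fapp (bHF D)) trmxK. Qed.

(** On a short step with [s] as an endpoint, the image of the step's control [w] is close to the
    difference quotient of [g], hence to [v]; the left inverse of F, bounded at [g s], transfers
    this to [w]. *)
Lemma step_velocity (s : R) v (e : R) : 0 < e -> is_derive s (1 : R) g v ->
  exists2 dl, 0 < dl & forall p q (w : 'rV[R]_m), p < q -> (p == s) || (q == s) ->
    s - dl < p -> q < s + dl -> `|w| <= K ->
    `|g q - g p - (q - p) *: Fapp f (g p) w| <= C * (q - p) ^+ 2 ->
    `|w - velocity s v| <= e /\ `|v - Fapp f (g s) w| <= e.
Proof.
move=> e0 gv.
have [A A0 HA] := mulmx_bound (Fpinv f (g s)).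
have C20 : 0 < C + LF * (B * K) * K + 1.
  by rewrite ltr_wpDl// addr_ge0 ?bC_ge0// !mulr_ge0 ?bLF0 ?bB0 ?bK0.
have A10 : 0 < A + 1 by rewrite addr_gt0.
(* One half is spent on the difference quotient, the other on the quadratic error and the shift of
   the base point from [p] to [s]; dividing by [A + 1] leaves [e] after the left inverse, of norm at
   most [A]. *)
pose e1 := e / (A + 1) / 2.
have e10 : 0 < e1 by rewrite !divr_gt0.
have [d1 d10 H1] := is_derive_dist_rV e10 gv.
have d20 : 0 < e1 / (C + LF * (B * K) * K + 1) by rewrite divr_gt0.
exists (Num.min d1 (e1 / (C + LF * (B * K) * K + 1))); first by rewrite lt_min d10.
move=> p q w pq pqs sp qs wK Hw.
have tau0 : 0 < q - p by rewrite subr_gt0.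
have tau1 : q - p < Num.min d1 (e1 / (C + LF * (B * K) * K + 1)).
  move: sp qs; move: (Num.min _ _) => M0.
  by case/orP: pqs => /eqP ->; lra.
have [t1 t2] : q - p < d1 /\ q - p < e1 / (C + LF * (B * K) * K + 1).
  by move: tau1; rewrite lt_min => /andP[].
have inc : `|g q - g p - (q - p) *: v| <= e1 * (q - p).
  case/orP: pqs => /eqP E.
    by rewrite -E in H1; have := H1 q; rewrite gtr0_norm//; exact.
  rewrite -E in H1; have := H1 p; rewrite distrC gtr0_norm// => /(_ t1).
  by rewrite -normrN !opprD !opprK -scaleNr opprB addrC -(addrC (g q)) addrC.
have gps : `|g p - g s| <= B * K * (q - p).
  apply: (le_trans (wk_lipschitz p s)); rewrite ler_wpM2l ?bBK0//.
  case/orP: pqs => /eqP <-; first by rewrite subrr normr0 ltW.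
  by rewrite distrC gtr0_norm.
have H2 : `|v - Fapp f (g p) w| <= e1 + C * (q - p).
  rewrite -(ler_pM2l tau0) -{1}(gtr0_norm tau0) -normrZ scalerBr.
  have -> : (q - p) *: v - (q - p) *: Fapp f (g p) w =
     (g q - g p - (q - p) *: Fapp f (g p) w) - (g q - g p - (q - p) *: v).
    by apply/rowP => i; rewrite !mxE; ring.
  apply: (le_trans (ler_normB _ _)).
  by move: inc Hw; rewrite expr2; lra.
have H3 : `|Fapp f (g p) w - Fapp f (g s) w| <= LF * (B * K) * K * (q - p).
  apply: (le_trans (bFlip D _ _ _)).
  rewrite (_ : _ * (q - p) = LF * (B * K * (q - p)) * K); last by ring.
  by apply: ler_pM => //; [rewrite mulr_ge0// bLF0|rewrite ler_wpM2l// bLF0].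
have H4 : `|v - Fapp f (g s) w| <= e1 + e1.
  rewrite -(subrKA (Fapp f (g p) w)) (le_trans (ler_normD _ _))//.
  have : (C + LF * (B * K) * K + 1) * (q - p) <= e1 by rewrite mulrC -ler_pdivlMr// ltW.
  by move: H2 H3 tau0; nra.
have e1e : e1 + e1 = e / (A + 1) by rewrite /e1; field; rewrite gt_eqF.
rewrite e1e in H4; split.
  rewrite -{1}(velocity_Fapp s w) distrC.
  have -> : velocity s v - velocity s (Fapp f (g s) w) = velocity s (v - Fapp f (g s) w).
    by rewrite /velocity [in RHS]linearB/= mulmxBr [RHS]linearB.
  apply: (le_trans (HA _)).
  have := ler_wpM2l (ltW A0) H4; move=> /le_trans; apply.
  by rewrite mulrA ler_pdivrMr// mulrC ler_wpM2l ?(ltW e0)// lerDl.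
by apply: (le_trans H4); rewrite ler_pdivrMr// ler_peMr ?(ltW e0)// lerDr ltW.
Qed.

(** Controls of shorter and shorter steps starting at [s] converge to [velocity s v], and their
    bound [K] passes to the limit. *)
Lemma velocity_spec (s : R) v : is_derive s (1 : R) g v ->
  Fapp f (g s) (velocity s v) = v /\ `|velocity s v| <= K.
Proof.
move=> gv.
have H e : 0 < e -> exists w : 'rV[R]_m, [/\ `|w| <= K, `|w - velocity s v| <= e & `|v - Fapp f (g s) w| <= e].
  move=> e0; have [dl d0 Hd] := step_velocity e0 gv.
  have sq : s < s + dl / 2 by rewrite ltrDl divr_gt0.
  have [_ _ [w [w1 w2 _]]] := wgl (lexx s) (ltW sq) (lexx _).
  exists w.
  have s1 : s - dl < s by rewrite ltrBlDr ltrDl.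
  have s2 : s + dl / 2 < s + dl by rewrite ltrD2l ltr_pdivrMr// ltr_pMr// ltr1n.
  by have [] := Hd s (s + dl / 2) w sq (introT orP (or_introl (eqxx s))) s1 s2 w1 w2.
split.
  apply/eqP; rewrite -subr_eq0 -normr_le0; apply/ler_addgt0Pr => e e0; rewrite add0r.
  have B10 : 0 < B + 1 by rewrite ltr_wpDl ?bB0.
  have [w [w1 w2 w3]] := H (e / (B + 1)) (divr_gt0 e0 B10).
  rewrite -(subrKA (Fapp f (g s) w)) (le_trans (ler_normD _ _))//.
  have -> : Fapp f (g s) (velocity s v) - Fapp f (g s) w = Fapp f (g s) (velocity s v - w).
    by rewrite FappD -scaleN1r -[in RHS]scaleN1r FappZ.
  rewrite (distrC (Fapp _ _ _) v).
  have H1 := bFapp D (g s) (velocity s v - w).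
  rewrite distrC in w2.
  have H2 := ler_wpM2l (bB0 D) w2.
  have -> : e = B * (e / (B + 1)) + e / (B + 1) by field; rewrite gt_eqF.
  exact: lerD (le_trans H1 H2) w3.
apply/ler_addgt0Pr => e e0; have [w [w1 w2 _]] := H e e0.
rewrite -(subrK w (velocity s v)) addrC (le_trans (ler_normD _ _))// lerD//.
by rewrite distrC.
Qed.

End Global.
End Velocity.

(** * The running action dominates the cost *)

Lemma is_derive_mulc (R : realType) (k s : R) : is_derive s (1 : R) (fun t => k * t) k.
Proof.
have H : (fun h : R => h^-1 *: (((fun t => k * t) \o shift s) (h *: 1) - k * s)) @ 0^' --> k.
  apply: cvg_near_cst; near=> h.
  rewrite /= [h *: 1]mulr1 mulrDr addrK [_ *: _]mulrC mulfK//.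
  by near: h; exact: nbhs_dnbhs_neq.
by apply: DeriveDef; [apply/cvg_ex; eexists; exact: H|exact: cvg_lim].
Unshelve. all: by end_near. Qed.

Section Cost.
Variables (R : realType) (d m : nat) (f : 'I_m -> 'rV[R]_d -> 'rV[R]_d).
Variables (L : 'rV[R]_d -> 'rV[R]_m -> R) (c : R) (D : bounds f L c).
Notation K := (bK D).
Notation B := (bB D).
Notation LF := (bLF D).
Notation LL := (bLL D).
Notation C0 := (bC0 D).
Notation C1 := (bC1 D).
Notation C := (bC D).
Notation mu := (@lebesgue_measure R).

Lemma measurable_L (A : set (measurableTypeR R)) (g : R -> 'rV[R]_d) (u : R -> 'rV[R]_m) :
  measurable A -> (forall i, measurable_fun A (fun s => g s 0 i)) ->
  (forall j, measurable_fun A (fun s => u s 0 j)) ->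
  measurable_fun A (fun s => L (g s) (u s)).
Proof.
move=> mA mg mu'.
have := @measurable_cts_comp _ (measurableTypeR R) R _ A (fun s => row_mx (g s) (u s)) (Lhat L)
  (Sm_cts (Lhat_Sm (bHL D))) mA.
rewrite (_ : _ \o _ = fun s => L (g s) (u s)); last first.
  by apply/funext => s /=; rewrite Lhat_row_mx.
apply=> i; have [j ->|j ->] := split_ordP i.
  by under eq_fun do rewrite row_mxEl; exact: mg.
by under eq_fun do rewrite row_mxEr; exact: mu'.
Qed.

Section Global.
Variables (g : R -> 'rV[R]_d) (l : R -> R).
Hypothesis wgl : forall p q, wk D g l p q.

Let g_lip := wk_lipschitz wgl.

Lemma wk_coord_lipschitz i x y : `|g x 0 i - g y 0 i| <= B * K * `|x - y|.
Proof.
apply: le_trans (g_lip x y).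
by rewrite (_ : _ - _ = (g x - g y) 0 i) ?coord_norm_le// !mxE.
Qed.

Lemma measurable_wk i A : measurable A -> measurable_fun (A : set (measurableTypeR R)) (fun s => g s 0 i).
Proof.
move=> mA; apply: (measurable_funS measurableT) => //.
by apply: continuous_measurable_fun; exact: (lipschitz_cts (@wk_coord_lipschitz i)).
Qed.

(** The function [psi], running action plus [c * t] minus accumulated cost, satisfies the hypotheses
    of [dini_nondecreasing]: on short steps around almost every [s] the step control is close to
    [u s], so [l] grows at a rate of almost [L (g s) (u s) - c] or more. *)
Lemma wk_cost (u : R -> 'rV[R]_m) (a b : R) : a <= b ->
  (forall j, measurable_fun `[a, b] (fun s => u s 0 j)) ->
  (forall s, `|u s| <= K) ->
  {ae mu, forall s, s \in `[a, b] -> is_derive s (1 : R) g (Fapp f (g s) (u s))} ->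
  exists2 k, cost L a b g u = k%:E & k - c * (b - a) <= l b - l a.
Proof.
move=> ab um uK gd.
have [M M0 HM] := L_bounded (bHL D) K.
pose r s := L (g s) (u s).
have mr : measurable_fun `[a, b] r.
  by apply: measurable_L => //; move=> i; exact: measurable_wk.
have rb s : `|r s| <= M by exact: HM.
have fin_ab : (mu `[a, b] < +oo)%E by rewrite lebesgue_measure_itv/=; case: ifP => _; rewrite ltry.
have fin_oc (p q : R) : (mu `]p, q]%classic < +oo)%E.
  by rewrite lebesgue_measure_itv/=; case: ifP => _; rewrite ltry.
have ri : mu.-integrable `[a, b] (EFin \o r).
  apply: measurable_bounded_integrable => //.
  by exists M; split => [|x Mx t _]; [exact: num_real|exact: le_trans (rb t) (ltW Mx)].
exists (\int[mu]_(s in `[a, b]) r s).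
  by rewrite /cost /Rintegral fineK//; exact: integrable_fin_num.
pose r1 := r \_ `[a, b].
have r1i : mu.-integrable setT (EFin \o r1).
  by rewrite /r1 -restrict_EFin -integrable_mkcond.
have -> : \int[mu]_(s in `[a, b]) r s = \int[mu]_(t in `]a, b]) r1 t.
  rewrite Rintegral_itv_obnd_cbnd; last by apply: integrableS r1i.
  by apply: eq_Rintegral => t tab; rewrite /r1 patchE tab.
pose La t := \int[mu]_(z in `]a, t]) r1 z.
have r1i' A : measurable A -> mu.-integrable A (EFin \o r1).
  by move=> mA; apply: integrableS r1i.
have locr : locally_integrable setT r1.
  by apply: open_integrable_locally => //; exact: openT.
have Fd := FTC1 (a := BRight a) (fun y => r1i' _ (measurable_itv _)) locr.
pose N := [set s | (s \in `[a, b] -> is_derive s (1 : R) g (Fapp f (g s) (u s))) /\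
                  ((BRight a < BRight s)%E -> derivable La s 1 /\ (La^`())%classic s = r1 s)].
have Nn : {ae mu, forall s, N s} by apply: (ae_mono2 gd Fd) => s.
pose psi t := l t + c * t - La t.
have Laa : La a = 0.
  by rewrite /La (_ : `]a, a]%classic = set0) ?Rintegral_set0// set_itv_ge// bnd_simp ltxx.
have La_diff p q : a <= p -> p <= q -> La q - La p = \int[mu]_(z in `]p, q]) r1 z.
  move=> ap pq; have := @Rintegral_itvB R r1 (BRight a) (BRight q) p (r1i' _ (measurable_itv _)).
  by rewrite !bnd_simp => /(_ ap pq) <-.
have La_lip p q : a <= p -> p <= q -> `|La q - La p| <= M * (q - p).
  move=> ap pq; rewrite La_diff//.
  have r1pq : mu.-integrable `]p, q] (EFin \o r1) by exact: r1i'.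
  apply: (le_trans (le_normr_Rintegral (mu := mu) (measurable_itv _) r1pq)).
  have -> : M * (q - p) = \int[mu]_(t in `]p, q]) M.
    have E : mu `]p, q]%classic = (q - p)%:E.
      rewrite lebesgue_measure_itv/= lte_fin.
      by case: ltP => //= qp; rewrite (_ : q = p) ?subrr//; apply/eqP; rewrite eq_le pq qp.
    rewrite Rintegral_cst//; congr (_ * _).
    by rewrite -[LHS]/(fine (q - p)%:E) -E.
  apply: le_Rintegral => //.
  - exact: integrable_norm.
  - apply: measurable_bounded_integrable => //.
      exact: fin_oc.
    by exists M; split => [|x Mx t _]; [exact: num_real|rewrite ger0_norm// ltW].
  - by move=> t _; rewrite /r1 patchE; case: ifP => _; rewrite ?normr0.
suff : psi a <= psi b.
  rewrite /psi Laa -/(La b) subr0 => H.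
  by rewrite mulrBr; move: H; lra.
apply: (@dini_nondecreasing R psi (C1 + `|c| + M) (~` N `|` [set a; b]) a b ab).
- move=> p q ap pq qb; have [_ H1 _] := wgl (lexx p) pq (lexx q).
  have := La_lip p q ap pq; have := ler_norm (La q - La p).
  have : 0 <= (`|c| + c) * (q - p).
    by rewrite mulr_ge0 ?subr_ge0// -lerBlDr sub0r -normrN ler_norm.
  by rewrite /psi; lra.
- by apply: negligibleU => //; exact: negligible2.
move=> s /andP[]; rewrite le_eqVlt => /predU1P[->|as_]; first by move=> _ []; right; left.
rewrite le_eqVlt => /predU1P[->|sb]; first by move=> []; right; right.
move=> /not_orP[/contrapT[H1 H2] _] e e0.
have sab : s \in `[a, b] by rewrite in_itv/= !ltW.
have gs := H1 sab.
have [dLa La's] := H2 as_.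
have r1s : r1 s = r s by rewrite /r1 patchE mem_set.
have e40 : 0 < e / 4 by rewrite divr_gt0.
have hd : is_derive s (1 : R) (fun t => La t - r s * t) 0.
  have Lad : is_derive s (1 : R) La (r s).
    by apply: DeriveDef; [exact: dLa|move: La's; rewrite derive1E r1s].
  rewrite -(subrr (r s)); apply: is_deriveB.
  exact: is_derive_mulc.
have [d1 d10 Hd1] := is_derive_dist e40 hd.
have cLs : continuous (L (g s)) := Sm_cts (L_Sm (bHL D) (g s)).
have /cvgrPdist_le/(_ _ e40)/nbhs_ballP[eta /= eta0 Heta] := cLs (u s).
have eta20 : 0 < eta / 2 by rewrite divr_gt0.
have [d2 d20 Hd2] := step_velocity wgl eta20 gs.
have C20 : 0 < C + LL * (B * K) + 1.
  by rewrite ltr_wpDl// addr_ge0 ?bC_ge0// !mulr_ge0 ?bLL0 ?bB0 ?bK0.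
have d30 : 0 < (e / 4) / (C + LL * (B * K) + 1) by rewrite divr_gt0.
pose dl := Num.min d1 (Num.min d2 ((e / 4) / (C + LL * (B * K) + 1))).
have dl0 : 0 < dl by rewrite !lt_min d10 d20.
have [dl1 dl2 dl3] : [/\ dl <= d1, dl <= d2 & dl <= (e / 4) / (C + LL * (B * K) + 1)].
  by rewrite /dl; split; rewrite !ge_min lexx ?orbT.
clearbody dl.
(* Of the loss [e / 2], one quarter of [e] comes from replacing the control [w] by [u s], the other
   from the base point and the quadratic error. The accumulated cost [La] takes a further quarter
   below. *)
have key p q : p < q -> (p == s) || (q == s) -> s - dl < p -> q < s + dl ->
    (q - p) * (r s - c - e / 2) <= l q - l p.
  move=> pq pqs sp qs.
  have [_ _ [w [w1 w2 w3]]] := wgl (lexx p) (ltW pq) (lexx q).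
  have sp2 : s - d2 < p by apply: le_lt_trans sp; rewrite lerB.
  have qs2 : q < s + d2 by apply: (lt_le_trans qs); rewrite lerD.
  have [Hw _] := Hd2 p q w pq pqs sp2 qs2 w1 w2.
  rewrite (velocity_Fapp D) in Hw.
  have Lw : `|L (g s) (u s) - L (g s) w| <= e / 4.
    apply: Heta; rewrite -ball_normE /ball_/= distrC (le_lt_trans Hw)//.
    by rewrite ltr_pdivrMr// ltr_pMr// ltr1n.
  have tau0 : 0 < q - p by rewrite subr_gt0.
  have taudl : q - p < dl by case/orP: pqs => /eqP E; move: sp qs; rewrite E; lra.
  have gps : `|g s - g p| <= B * K * (q - p).
    apply: (le_trans (g_lip s p)); rewrite ler_wpM2l ?bBK0//.
    case/orP: pqs => /eqP <-; first by rewrite subrr normr0 ltW.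
    by rewrite gtr0_norm.
  have Lp : `|L (g s) w - L (g p) w| <= LL * (B * K) * (q - p).
    by apply: (le_trans (bLlip D (g s) (g p) w1)); rewrite -mulrA ler_wpM2l// bLL0.
  have X : (C + LL * (B * K) + 1) * (q - p) <= e / 4.
    by rewrite mulrC -ler_pdivlMr// ltW// (lt_le_trans taudl).
  have L1 : r s - e / 4 - LL * (B * K) * (q - p) <= L (g p) w.
    move: Lw Lp => /ler_normlP[_ A1] /ler_normlP[_ A2].
    by move: A1 A2; rewrite /r; lra.
  apply: le_trans w3.
  have -> : (q - p) * (L (g p) w - c) - C * (q - p) ^+ 2 = (q - p) * (L (g p) w - c - C * (q - p)) by ring.
  rewrite ler_wpM2l ?(ltW tau0)//.
  by move: L1 X (ltW tau0) => L1 X tau0'; nra.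
have key' p q : p <= q -> (p == s) || (q == s) -> s - dl < p -> q < s + dl ->
    - e * (q - p) <= psi q - psi p.
  rewrite le_eqVlt => /predU1P[->|pq]; first by rewrite !subrr mulr0.
  move=> pqs sp qs; have H := key p q pq pqs sp qs.
  have tau0 : 0 < q - p by rewrite subr_gt0.
  have HLa : `|(La q - La p) - r s * (q - p)| <= e / 4 * (q - p).
    have -> : La q - La p - r s * (q - p) = La q - r s * q - (La p - r s * p) by ring.
    case/orP: pqs => /eqP E.
      have := Hd1 q; move: tau0 qs; rewrite E => tau0 qs; rewrite (gtr0_norm tau0); apply.
      by rewrite ltrBlDl (lt_le_trans qs)// lerD.
    have := Hd1 p; move: tau0 sp; rewrite E => tau0 sp.
    rewrite (distrC p) (gtr0_norm tau0) distrC; apply.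
    by move: sp dl1; lra.
  move: HLa => /ler_normlP[_ HLa].
  by rewrite /psi; move: H HLa; nra.
exists dl => // p q ap ps sq qb sp qs.
(* An interval around [s] is split at [s], because the estimates hold for steps with [s] as an
   endpoint. *)
have k1 := key' p s ps. have k2 := key' s q sq.
move: k1 k2; rewrite !eqxx orbT/= => /(_ isT sp) k1 /(_ isT) k2.
have {}k1 := k1 (ltac:(by rewrite ltrDl)).
have {}k2 := k2 (ltac:(by rewrite ltrBlDr ltrDl)) qs.
by move: k1 k2; lra.
Qed.

End Global.
End Cost.

(** * A measurable control for every weak trajectory *)

Section Control.
Variables (R : realType) (d m : nat) (f : 'I_m -> 'rV[R]_d -> 'rV[R]_d).
Variables (L : 'rV[R]_d -> 'rV[R]_m -> R) (c : R) (D : bounds f L c).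
Notation K := (bK D).
Notation B := (bB D).
Notation mu := (@lebesgue_measure R).

Lemma difference_quotient_cvg n (g : R -> 'rV[R]_n) (s : R) v i :
  is_derive s (1 : R) g v ->
  (fun k => k.+1%:R * (g (s + k.+1%:R^-1) 0 i - g s 0 i)) @ \oo --> v 0 i.
Proof.
move=> [dg gv].
have : (fun z : R => z^-1 *: ((g \o shift s) (z *: 1) - g s)) @ 0^' --> 'D_1 g s by exact: dg.
rewrite gv => /cvgrPdist_le H; apply/cvgrPdist_le => e e0.
have [dl /= dl0 Hd] := H e e0.
near=> k.
have k0 : k.+1%:R^-1 != 0 :> R by rewrite invr_eq0.
have /= := Hd k.+1%:R^-1; rewrite sub0r normrN ger0_norm// => /(_ _ k0).
have -> : k.+1%:R^-1 < dl by near: k; exact: (near_infty_natSinv_lt (PosNum dl0)).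
move=> /(_ isT); apply: le_trans.
apply: le_trans (coord_norm_le _ i).
by rewrite invrK [_ *: 1]mulr1 (addrC _ s) !mxE.
Unshelve. all: by end_near. Qed.

Section Global.
Variables (g : R -> 'rV[R]_d) (l : R -> R).
Hypothesis wgl : forall p q, wk D g l p q.

Let q n s i : R := n.+1%:R * (g (s + n.+1%:R^-1) 0 i - g s 0 i).

(** The upper limit of difference quotients is measurable and defined everywhere, and equals the
    derivative wherever the latter exists. *)
Let rho s : 'rV[R]_d := \row_i limn_sup (fun n => q n s i).

Let q_bound n s i : `|q n s i| <= B * K.
Proof.
rewrite /q normrM ger0_norm//.
have := wk_coord_lipschitz wgl i (s + n.+1%:R^-1) s.
rewrite [s + _]addrC addrK [`|n.+1%:R^-1|]ger0_norm// => H.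
rewrite -(ler_pM2l (_ : 0 < n.+1%:R^-1 :> R)) ?invr_gt0//.
by rewrite mulrA mulVf// mul1r mulrC.
Qed.

Let rho_measurable i : measurable_fun setT (fun s => rho s 0 i).
Proof.
under eq_fun do rewrite mxE.
apply: (measurable_fun_limn_sup (h := fun n s => q n s i)).
- by move=> s _; exists (B * K) => _ [n _ <-]; exact: le_trans (ler_norm _) (q_bound _ _ _).
- by move=> s _; exists (- (B * K)) => _ [n _ <-]; have /ler_normlP[+ _] := q_bound n s i; rewrite lerNl.
move=> n; apply: continuous_measurable_fun => s.
have cg : continuous (fun s => g s 0 i) := lipschitz_cts (wk_coord_lipschitz wgl i).
apply: cvgM; first exact: cvg_cst.
apply: cvgB; last exact: cg.
apply: (@continuous_comp R R R (fun s => s + n.+1%:R^-1) (fun s => g s 0 i) s); last exact: cg.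
by apply: cvgD; [exact: cvg_id|exact: cvg_cst].
Qed.

Let v s : 'rV[R]_m := velocity f g s (rho s).

Let v_measurable j : measurable_fun setT (fun s => v s 0 j).
Proof.
have -> : (fun s => v s 0 j) = fun s => \sum_i Fpinv f (g s) j i * rho s 0 i.
  by apply/funext => s; rewrite /v /velocity !mxE; apply: eq_bigr => i _; rewrite !mxE.
apply: measurable_sum => i; apply: measurable_funM; last exact: rho_measurable.
apply: (measurable_cts_comp (G := fun x => Fpinv f x j i)) => //.
  exact: (Fpinv_continuous (bHF D)).
by move=> k; exact: (measurable_wk wgl).
Qed.

(** The cut-off acts only where [g] is not differentiable, by [velocity_spec]; it makes the bound
    [K] hold at every time. *)
Let u s : 'rV[R]_m := if `|v s| <= K then v s else 0.

Let u_measurable j : measurable_fun setT (fun s => u s 0 j).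
Proof.
have -> : (fun s => u s 0 j) = fun s => if `|v s| <= K then v s 0 j else 0.
  by apply/funext => s; rewrite /u; case: ifP => _ //; rewrite mxE.
apply: measurable_fun_ifT => //; apply: measurable_fun_ler; last exact: measurable_cst.
apply: (measurable_cts_comp (G := fun x : 'rV[R]_m => `|x|)) => //.
exact: norm_continuous.
Qed.

Let u_bound s : `|u s| <= K.
Proof. by rewrite /u; case: ifP => // _; rewrite normr0 bK0. Qed.

Let u_derive : {ae mu, forall s, is_derive s (1 : R) g (Fapp f (g s) (u s))}.
Proof.
have H : {ae mu, forall s, forall i, derivable (fun s => g s 0 i) s 1}.
  by apply: ae_forall_ord => i; exact: (lipschitz_ae_derivable (wk_coord_lipschitz wgl i)).
apply: (ae_mono H) => s dgs.
have dg : derivable g s 1 by apply/derivable_mxP => i j; rewrite ord1; exact: dgs.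
have gD : is_derive s (1 : R) g ('D_1 g s) by exact: derivableP.
have rE : rho s = 'D_1 g s.
  apply/rowP => i; rewrite mxE.
  have Hq := @difference_quotient_cvg _ _ _ _ i gD.
  rewrite cvg_limn_supE; first exact: cvg_lim Hq.
  by apply/cvg_ex; eexists; exact: Hq.
have [Fv vK] := velocity_spec wgl gD.
by rewrite /u /v rE vK Fv.
Qed.

Lemma wk_admissible : exists u : R -> 'rV[R]_m,
  (forall a b, a <= b -> admissible f a b g u) /\
  (forall a b, a <= b -> exists2 k, cost L a b g u = k%:E & k - c * (b - a) <= l b - l a).
Proof.
exists u; split => a b ab; last first.
  apply: (wk_cost wgl) => //.
    by move=> j; apply: measurable_funS (u_measurable j).
  by apply: (ae_mono u_derive).
split; first by move=> i; exact: lipschitz_abs_cont (wk_coord_lipschitz wgl i).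
split; last by apply: (ae_mono u_derive).
move=> i; split; first by apply: measurable_funS (u_measurable i).
have fin_ab : (mu `[a, b] < +oo)%E by rewrite lebesgue_measure_itv/=; case: ifP => _; rewrite ltry.
have : mu.-integrable `[a, b] (EFin \o (fun s => (u s 0 i) ^+ 2)).
  apply: measurable_bounded_integrable => //.
  - by apply: measurable_funX; apply: measurable_funS (u_measurable i).
  exists (K ^+ 2); split => [|x Kx t _]; first exact: num_real.
  apply: le_trans (ltW Kx); rewrite normrX lerXn2r ?nnegrE ?bK0//.
  by apply: le_trans (coord_norm_le _ _) _.
move=> /integrableP[_]; apply: le_lt_trans; apply: ge0_le_integral => //.
- by move=> s _; rewrite lee_fin sqr_ge0.
- by apply/measurable_EFinP; apply: measurable_funX; apply: measurable_funS (u_measurable i).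
- apply: measurableT_comp => //; apply/measurable_EFinP.
  by apply: measurable_funX; apply: measurable_funS (u_measurable i).
by move=> s _; rewrite /= lee_fin ler_norm.
Qed.

End Global.
End Control.

(** * Integrals of real functions over compact intervals *)

Section IntegrableReal.
Variable R : realType.
Notation mu := (@lebesgue_measure R).
Implicit Types (p q : R) (h k : R -> R).

Definition itv_integrable p q h := mu.-integrable `[p, q] (EFin \o h).

Lemma itv_integrableD p q h k : itv_integrable p q h -> itv_integrable p q k ->
  itv_integrable p q (fun s => h s + k s).
Proof. by move=> ih ik; apply: (integrableD (mu := mu) (measurable_itv _) ih ik). Qed.

Lemma itv_integrableZ p q h (x : R) : itv_integrable p q h ->
  itv_integrable p q (fun s => x * h s).
Proof. by move=> ih; apply: (integrableZl (mu := mu) (measurable_itv _) x ih). Qed.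

Lemma itv_integrable_cst p q (x : R) : itv_integrable p q (fun=> x).
Proof.
have fin_ab : (mu `[p, q] < +oo)%E.
  by rewrite lebesgue_measure_itv/=; case: ifP => _; rewrite ltry.
apply: measurable_bounded_integrable => //.
by exists `|x|; split => [|y xy t _]; [exact: num_real|rewrite ltW].
Qed.

Lemma itv_integrable_sum p q n (h : 'I_n -> R -> R) :
  (forall j, itv_integrable p q (h j)) ->
  itv_integrable p q (fun s => \sum_j h j s).
Proof.
elim: n h => [|n IH] h ih.
  rewrite (_ : (fun s => _) = fun=> 0); first exact: itv_integrable_cst.
  by apply/funext => s; rewrite big_ord0.
rewrite (_ : (fun s => _) = fun s => h ord0 s + \sum_j h (lift ord0 j) s).
  by apply: itv_integrableD; [exact: ih|apply: IH].
by apply/funext => s; rewrite big_ord_recl.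
Qed.

Lemma itv_integrable_le p q h k : measurable_fun `[p, q] h ->
  (forall s, p <= s <= q -> `|h s| <= k s) -> itv_integrable p q k -> itv_integrable p q h.
Proof.
move=> mh hk ik; apply: (le_integrable (mu := mu) _ _ _ ik) => //.
  exact/measurable_EFinP.
move=> s; rewrite /= in_itv/= => /hk H; rewrite lee_fin.
exact: le_trans H (ler_norm _).
Qed.

Lemma itv_integrable_sub p q p' q' h : p <= p' -> q' <= q ->
  itv_integrable p q h -> itv_integrable p' q' h.
Proof.
move=> pp qq; apply: integrableS => //.
by apply: subset_itv; rewrite bnd_simp.
Qed.

Lemma itv_integrable_measurable p q h : itv_integrable p q h -> measurable_fun `[p, q] h.
Proof. by move=> /integrableP[/measurable_EFinP]. Qed.

Lemma Rintegral_linear p q n (A : R) (w : R -> R) (x : 'I_n -> R) (h : 'I_n -> R -> R) :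
  itv_integrable p q w -> (forall j, itv_integrable p q (h j)) ->
  \int[mu]_(s in `[p, q]) (A * w s + \sum_j x j * h j s) =
  A * (\int[mu]_(s in `[p, q]) w s) + \sum_j x j * \int[mu]_(s in `[p, q]) h j s.
Proof.
elim: n w h x A => [|n IH] w h x A iw ih.
  rewrite big_ord0 addr0 -RintegralZl//.
  by apply: eq_Rintegral => s _; rewrite big_ord0 addr0.
rewrite big_ord_recl addrCA -IH// -RintegralZl//; last exact: ih.
rewrite -RintegralD//.
- by apply: eq_Rintegral => s _; rewrite big_ord_recl addrCA.
- exact: itv_integrableZ.
- apply: itv_integrableD; first exact: itv_integrableZ.
  by apply: itv_integrable_sum => j; exact: itv_integrableZ.
Qed.

Lemma Rintegral_itv_le p q h k : itv_integrable p q h -> itv_integrable p q k ->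
  (forall s, p <= s <= q -> h s <= k s) ->
  \int[mu]_(s in `[p, q]) h s <= \int[mu]_(s in `[p, q]) k s.
Proof. by move=> ih ik H; apply: le_Rintegral => // s; rewrite /= in_itv/=; exact: H. Qed.

Lemma Rintegral_itv_norm p q h k : itv_integrable p q h -> itv_integrable p q k ->
  (forall s, p <= s <= q -> `|h s| <= k s) ->
  `|\int[mu]_(s in `[p, q]) h s| <= \int[mu]_(s in `[p, q]) k s.
Proof.
move=> ih ik H; apply: (le_trans (le_normr_Rintegral (mu := mu) (measurable_itv _) ih)).
by apply: Rintegral_itv_le => //; exact: integrable_norm.
Qed.

Lemma Rintegral_itv_cst p q (x : R) : p <= q -> \int[mu]_(s in `[p, q]) x = x * (q - p).
Proof.
move=> pq; have E : mu `[p, q]%classic = (q - p)%:E.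
  rewrite lebesgue_measure_itv/= lte_fin.
  by case: ltP => //= qp; rewrite (_ : q = p) ?subrr//; apply/eqP; rewrite eq_le pq qp.
by rewrite Rintegral_cst//; congr (_ * _); rewrite -[RHS]/(fine (q - p)%:E) -E.
Qed.

End IntegrableReal.

(** * From admissible pairs to weak trajectories by a time change *)

Section Reparametrization.
Variables (R : realType) (d m : nat) (f : 'I_m -> 'rV[R]_d -> 'rV[R]_d).
Variables (L : 'rV[R]_d -> 'rV[R]_m -> R) (c : R) (D : bounds f L c).
Notation K := (bK D).
Notation B := (bB D).
Notation LF := (bLF D).
Notation LL := (bLL D).
Notation C0 := (bC0 D).
Notation C := (bC D).
Notation mu := (@lebesgue_measure R).
Variables (g : R -> 'rV[R]_d) (u : R -> 'rV[R]_m) (a b : R).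
Hypotheses (ab : a <= b) (adm : admissible f a b g u).

Let um j : measurable_fun `[a, b] (fun s => u s 0 j).
Proof. by have [_ [H _]] := adm; exact: (H j).1. Qed.

(* The time-change density: pieces with [|u| > K] are slowed down to unit speed. *)
Let w s := if `|u s| <= K then 1 else `|u s|.

Let w1 s : 1 <= w s.
Proof.
rewrite /w; case: ifPn => // uK; apply: le_trans (bK1 D) _.
by rewrite ltW// ltNge.
Qed.

Let w0 s : 0 < w s. Proof. exact: lt_le_trans (w1 s). Qed.

Let uKw s : `|u s| <= K * w s.
Proof.
rewrite /w; case: ifPn => uK; first by rewrite mulr1.
by rewrite ler_peMl// bK1.
Qed.

Let norm_u_measurable : measurable_fun `[a, b] (fun s => `|u s|).
Proof.
apply: (measurable_cts_comp (G := fun x : 'rV[R]_m => `|x|)) => //.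
exact: norm_continuous.
Qed.

Let w_measurable : measurable_fun `[a, b] w.
Proof.
apply: measurable_fun_if => //.
- by apply: measurable_fun_ler.
- by apply: measurable_funS norm_u_measurable => //; exact: subIsetl.
Qed.

Let u2_measurable j : measurable_fun `[a, b] (fun s => (u s 0 j) ^+ 2).
Proof. exact: measurable_funX (um j). Qed.

Let u2_integrable j : itv_integrable a b (fun s => (u s 0 j) ^+ 2).
Proof.
have [_ [H _]] := adm; apply/integrableP; split; first by apply/measurable_EFinP; exact: u2_measurable.
under eq_integral => s _ do rewrite gee0_abs ?lee_fin ?sqr_ge0//.
exact: (H j).2.
Qed.

(** Square integrability of [u] dominates [w], since [2 * |x| <= 1 + x^2] for each coordinate. *)
Let w_integrable : itv_integrable a b w.
Proof.
apply: (@itv_integrable_le _ _ _ _ (fun s => 2 + \sum_j (u s 0 j) ^+ 2)) => //; last first.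
  apply: itv_integrableD; first exact: itv_integrable_cst.
  exact: itv_integrable_sum.
move=> s _; rewrite ger0_norm ?(ltW (w0 s))//.
have S0 : 0 <= \sum_j (u s 0 j) ^+ 2 by apply: sumr_ge0 => j _; exact: sqr_ge0.
rewrite /w; case: ifPn => uK; first by move: S0; lra.
apply: norm_le_coord => [|j]; first by move: S0; lra.
have : (u s 0 j) ^+ 2 <= \sum_j (u s 0 j) ^+ 2.
  by rewrite (bigD1 j)//= lerDl sumr_ge0// => i _; exact: sqr_ge0.
have := sqr_ge0 (`|u s 0 j| - 1).
rewrite sqrrB1 -normrX ger0_norm ?sqr_ge0// -mulr_natl.
by move: S0; lra.
Qed.

Let u_integrable j : itv_integrable a b (fun s => u s 0 j).
Proof.
apply: (@itv_integrable_le _ _ _ _ (fun s => K * w s)) => //; last exact: itv_integrableZ.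
by move=> s _; apply: le_trans (coord_norm_le _ _) _.
Qed.

(** Composition with the clamp [cl] onto [[a, b]] extends the coordinate to a continuous function on
    the line. *)
Let g_measurable i : measurable_fun `[a, b] (fun s => g s 0 i).
Proof.
have [/(_ i) ac _] := adm.
pose cl (s : R) := Num.max a (Num.min s b).
have clP s : a <= cl s <= b by rewrite /cl le_max lexx/= ge_max ab ge_min lexx orbT.
have cl_dist s t : s <= t -> (cl s <= cl t) && (cl t - cl s <= t - s).
  move=> st; rewrite /cl.
  have [m1 m2] : Num.min s b <= Num.min t b /\ Num.min t b - Num.min s b <= t - s.
    by case: (leP s b) => ?; case: (leP t b) => ?; split; lra.
  move: (Num.min s b) (Num.min t b) m1 m2 => x y xy yx.
  by case: (leP a x) => ?; case: (leP a y) => ?; apply/andP; split; lra.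
have cont : continuous (fun s => g (cl s) 0 i).
  move=> s; apply/cvgrPdist_le => e e0; have [dl d0 H] := ac e e0.
  have H' x y : x <= y -> y - x < dl -> `|g (cl y) 0 i - g (cl x) 0 i| <= e.
    move=> xy yx; have /andP[c1 c2] := cl_dist x y xy.
    have := H [:: (cl x, cl y)]; rewrite /= !big_seq1/= => Hs; apply/ltW/Hs => //.
      by have /andP[-> _] := clP x; have /andP[_ ->] := clP y; rewrite c1.
    exact: le_lt_trans yx.
  near=> t.
  have st : `|s - t| < dl by near: t; apply: cvgr_dist_lt => //; exact: cvg_id.
  have [ts|/ltW ts] := leP t s.
    by apply: H' => //; apply: le_lt_trans st; exact: ler_norm.
  by rewrite distrC; apply: H' => //; apply: le_lt_trans st; rewrite distrC ler_norm.
apply: (eq_measurable_fun (fun s => g (cl s) 0 i)).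
  move=> s; rewrite inE/= in_itv/= => /andP[as_ sb].
  by rewrite /cl (min_idPl sb) (max_idPr as_).
by apply: measurable_funS (continuous_measurable_fun cont).
Unshelve. all: by end_near. Qed.

Let Fu_measurable i : measurable_fun `[a, b] (fun s => Fapp f (g s) (u s) 0 i).
Proof.
have -> : (fun s => Fapp f (g s) (u s) 0 i) = fun s => \sum_j u s 0 j * f j (g s) 0 i.
  by apply/funext => s; rewrite Fapp_coord.
apply: measurable_sum => j; apply: measurable_funM => //.
apply: (measurable_cts_comp (G := fun x => f j x 0 i)) => //.
exact: (Sm_cts (f_Sm (bHF D) 0 j i)).
Qed.

Let Fu_integrable i : itv_integrable a b (fun s => Fapp f (g s) (u s) 0 i).
Proof.
apply: (@itv_integrable_le _ _ _ _ (fun s => B * K * w s)) => //; last exact: itv_integrableZ.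
move=> s _; apply: le_trans (coord_norm_le _ _) _.
by apply: (le_trans (bFapp D _ _)); rewrite -mulrA ler_wpM2l// bB0.
Qed.

Let g_ftc i p q : a <= p -> p <= q -> q <= b ->
  g q 0 i - g p 0 i = \int[mu]_(s in `[p, q]) Fapp f (g s) (u s) 0 i.
Proof.
have [/(_ i) ac [_ gd]] := adm.
move=> ap pq qb; apply: (abs_cont_ftc ac (Fu_integrable i)) => //.
apply: (ae_mono gd) => s + sab => /(_ sab) -[dg gv].
have dgi : derivable (fun s => g s 0 i) s 1 by move/derivable_mxP : dg; exact.
apply: DeriveDef => //.
by move: gv; rewrite derive_mx// => /rowP/(_ i); rewrite !mxE.
Qed.

Let usK s : `|(w s)^-1 *: u s| <= K.
Proof.
by rewrite normrZ ger0_norm ?invr_ge0 ?(ltW (w0 s))// ler_pdivrMl// mulrC.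
Qed.

Let slow s : w s * (L (g s) ((w s)^-1 *: u s) - c) <= L (g s) (u s) - c.
Proof.
rewrite /w; case: ifPn => [uK|uK]; first by rewrite invr1 scale1r mul1r.
apply: (bslow D); first by rewrite ltW// ltNge.
by rewrite normrZ normfV normr_id mulVf// gt_eqF// (le_lt_trans (bK0 D))// ltNge.
Qed.

Definition reparam t := \int[mu]_(s in `[a, t]) w s.

Let reparamB p q : a <= p -> p <= q -> q <= b ->
  reparam q - reparam p = \int[mu]_(s in `[p, q]) w s.
Proof.
move=> ap pq qb; rewrite /reparam (Rintegral_split ap pq); first by ring.
exact: itv_integrable_sub w_integrable.
Qed.

Lemma reparam_expand p q : a <= p -> p <= q -> q <= b -> q - p <= reparam q - reparam p.
Proof.
move=> ap pq qb; rewrite reparamB// -[q - p]mul1r -Rintegral_itv_cst//.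
apply: Rintegral_itv_le => //; first exact: itv_integrable_cst.
exact: itv_integrable_sub w_integrable.
Qed.

(** The step control is the mean of the slowed control in the new time, so that [tau *: v] is the
    integral of [u]. The displacement is then exact up to the shift of base point, and the cost
    estimate is Jensen's inequality. The cost enters through an integrable [r], so that the first
    two estimates also serve curves of infinite cost. *)
Lemma reparam_step p q : a <= p -> p <= q -> q <= b ->
  let tau := reparam q - reparam p in
  `|g q - g p| <= B * K * tau /\ exists v : 'rV[R]_m,
  [/\ `|v| <= K, `|g q - g p - tau *: Fapp f (g p) v| <= C * tau ^+ 2 &
   forall r, (forall s, p <= s <= q -> r s = L (g s) (u s) - c) -> itv_integrable p q r ->
     - bC1 D * tau <= \int[mu]_(s in `[p, q]) r s /\
     tau * (L (g p) v - c) - C * tau ^+ 2 <= \int[mu]_(s in `[p, q]) r s].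
Proof.
move=> ap pq qb tau.
have sub h : itv_integrable a b h -> itv_integrable p q h by exact: itv_integrable_sub.
have tauE : tau = \int[mu]_(s in `[p, q]) w s by rewrite /tau reparamB.
have dist s : p <= s <= q -> `|g s - g p| <= B * K * tau.
  move=> /andP[ps sq].
  have tau_s : reparam s - reparam p <= tau.
    rewrite /tau lerD2r -subr_ge0; apply: le_trans (reparam_expand (le_trans ap ps) sq qb).
    by rewrite subr_ge0.
  apply: (@le_trans _ _ (B * K * (reparam s - reparam p))); last first.
    by rewrite ler_wpM2l// bBK0.
  have sb := le_trans sq qb.
  have wi : itv_integrable p s w by exact: itv_integrable_sub w_integrable.
  apply: norm_le_coord => [|i].
    rewrite mulr_ge0 ?bBK0//; apply: le_trans (reparam_expand ap ps sb).
    by rewrite subr_ge0.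
  rewrite !mxE g_ftc// reparamB// -RintegralZl//.
  apply: Rintegral_itv_norm.
  - exact: itv_integrable_sub (Fu_integrable i).
  - exact: itv_integrableZ.
  move=> z _; apply: le_trans (coord_norm_le _ _) _.
  by apply: (le_trans (bFapp D _ _)); rewrite -mulrA ler_wpM2l// bB0.
split; first by apply: dist; rewrite pq lexx.
have tau0 : 0 <= tau by apply: le_trans (reparam_expand ap pq qb); rewrite subr_ge0.
have BKtau : 0 <= B * K * tau by rewrite mulr_ge0// bBK0.
pose V : 'rV[R]_m := \row_j \int[mu]_(s in `[p, q]) u s 0 j.
have VK : `|V| <= K * tau.
  apply: norm_le_coord => [|j]; first by rewrite mulr_ge0// bK0.
  rewrite mxE tauE -RintegralZl//; last exact: sub.
  apply: Rintegral_itv_norm; [exact: sub|exact/itv_integrableZ/sub|].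
  by move=> s _; apply: le_trans (coord_norm_le _ _) _.
have [v [vK vV]] : exists v : 'rV[R]_m, `|v| <= K /\ tau *: v = V.
  (* For [tau = 0] the integral of [u] vanishes and the control 0 will do. *)
  have [tau00|taun0] := eqVneq tau 0.
    exists 0; split; first by rewrite normr0 bK0.
    rewrite scaler0; apply/esym/eqP; rewrite -normr_le0.
    by apply: (le_trans VK); rewrite tau00 mulr0.
  have taup : 0 < tau by rewrite lt0r taun0.
  exists (tau^-1 *: V); split; last by rewrite scalerA mulfV// scale1r.
  by rewrite normrZ ger0_norm ?invr_ge0// ler_pdivrMl// mulrC.
have wi := sub _ w_integrable.
exists v; split => //.
  rewrite -FappZ vV.
  apply: norm_le_coord => [|i]; first by rewrite mulr_ge0 ?bC_ge0// sqr_ge0.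
  have subE (x y : 'rV[R]_d) : (x - y) 0 i = x 0 i - y 0 i by rewrite !mxE.
  have FpE s : Fapp f (g p) (u s) 0 i = 0 * w s + \sum_j f j (g p) 0 i * u s 0 j.
    by rewrite mul0r add0r Fapp_coord; apply: eq_bigr => j _; rewrite mulrC.
  have Fpi : itv_integrable p q (fun s => Fapp f (g p) (u s) 0 i).
    rewrite (_ : (fun s => _) = fun s => 0 * w s + \sum_j f j (g p) 0 i * u s 0 j).
      apply: itv_integrableD; first exact: itv_integrableZ.
      by apply: itv_integrable_sum => j; apply/itv_integrableZ/sub.
    by apply/funext => s; rewrite FpE.
  have -> : (g q - g p - Fapp f (g p) V) 0 i =
      \int[mu]_(s in `[p, q]) (Fapp f (g s) (u s) 0 i - Fapp f (g p) (u s) 0 i).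
    rewrite RintegralB//.
    - rewrite !subE g_ftc//; congr (_ - _).
      transitivity (\int[mu]_(s in `[p, q]) (0 * w s + \sum_j f j (g p) 0 i * u s 0 j)); last first.
        by apply: eq_Rintegral => s _; rewrite FpE.
      rewrite Rintegral_linear//; last by move=> j; exact: sub.
      rewrite mul0r add0r Fapp_coord.
      by apply: eq_bigr => j _; rewrite mxE mulrC.
    - exact: sub.
  apply: (@le_trans _ _ (\int[mu]_(s in `[p, q]) (LF * (B * K * tau) * K * w s))).
    apply: Rintegral_itv_norm; last 1 first.
    - move=> s psq.
      rewrite -subE.
      apply: (le_trans (coord_norm_le _ _)); apply: (le_trans (bFlip D _ _ _)).
      rewrite -[leRHS]mulrA; apply: ler_pM => //; first by rewrite mulr_ge0// bLF0.
      by rewrite ler_wpM2l ?bLF0// dist.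
    - apply: itv_integrableD; first exact: sub.
      rewrite (_ : (fun s => _) = fun s => (-1) * Fapp f (g p) (u s) 0 i); last first.
        by apply/funext => s; rewrite mulN1r.
      exact: itv_integrableZ.
    - exact: itv_integrableZ.
  rewrite RintegralZl// -tauE.
  rewrite (_ : _ * tau = LF * (B * K) * K * tau ^+ 2); last by ring.
  by rewrite ler_wpM2r ?sqr_ge0// bC_F.
move=> r rE ri; split.
  rewrite tauE -RintegralZl//; apply: Rintegral_itv_le => // [|s psq].
    exact: itv_integrableZ.
  rewrite rE//; apply: le_trans (slow s); rewrite mulrC ler_wpM2l ?(ltW (w0 s))//.
  exact: bLlow.
have [q' Hq'] := L_subgradient (bHL D) (g p) v.
(* The constant term of an affine minorant of [L (g s) - c] over controls bounded by [K], valid for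
   all [s] in [[p, q]]; its integral against [w] gives the lower bound. *)
pose A := L (g p) v - c - LL * (B * K * tau) - \sum_j q' j * v 0 j.
have -> : tau * (L (g p) v - c) - C * tau ^+ 2 =
  A * tau + \sum_j q' j * V 0 j - (C - LL * (B * K)) * tau ^+ 2.
  have -> : \sum_j q' j * V 0 j = tau * \sum_j q' j * v 0 j.
    rewrite mulr_sumr; apply: eq_bigr => j _; rewrite -vV mxE; ring.
  by rewrite /A; ring.
apply: (@le_trans _ _ (A * tau + \sum_j q' j * V 0 j)).
  by rewrite gerBl mulr_ge0 ?sqr_ge0// subr_ge0 bC_L.
rewrite tauE; under [X in _ + X]eq_bigr do rewrite mxE.
rewrite -Rintegral_linear//; last by move=> j; exact: sub.
apply: Rintegral_itv_le => //.
  apply: itv_integrableD; first exact: itv_integrableZ.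
  by apply: itv_integrable_sum => j; apply/itv_integrableZ/sub.
move=> s psq; rewrite rE//.
pose us := (w s)^-1 *: u s.
have us1 : `|us| <= K by exact: usK.
have wus j : w s * us 0 j = u s 0 j.
  by rewrite mxE mulrA mulfV ?mul1r// gt_eqF.
apply: le_trans (slow s).
have H1 : L (g p) us - LL * (B * K * tau) <= L (g s) us.
  have := bLlip D (g s) (g p) us1.
  have := ler_wpM2l (bLL0 D) (dist s psq).
  by have := ler_norm (- (L (g s) us - L (g p) us)); rewrite normrN; lra.
have H2 := Hq' us.
have -> : A * w s + \sum_j q' j * u s 0 j =
   w s * (L (g p) v + \sum_j q' j * (us 0 j - v 0 j) - c - LL * (B * K * tau)).
  have -> : \sum_j q' j * u s 0 j = w s * \sum_j q' j * us 0 j.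
    by rewrite mulr_sumr; apply: eq_bigr => j _; rewrite -wus; ring.
  have -> : \sum_j q' j * (us 0 j - v 0 j) = \sum_j q' j * us 0 j - \sum_j q' j * v 0 j.
    by rewrite -sumrB; apply: eq_bigr => j _; rewrite mulrBr.
  by rewrite /A; ring.
by rewrite ler_wpM2l ?(ltW (w0 s))//; move: H1 H2; lra.
Qed.

Let reparam_a : reparam a = 0.
Proof. by rewrite /reparam set_itv1 Rintegral_set1. Qed.

Let reparam_inv (s : R) : 0 <= s <= reparam b -> exists2 t, a <= t <= b & reparam t = s.
Proof.
move=> /andP[s0 sb].
have cr : {within `[a, b], continuous reparam}.
  exact: parameterized_integral_continuous.
have [|t tab ts] := IVT (v := s) ab cr.
  rewrite reparam_a ge_min le_max s0 sb orbT//.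
by exists t => //; move: tab; rewrite in_itv.
Qed.

Let Lgu := EFin \o (fun s => L (g s) (u s)).

Let Lgu_measurable : measurable_fun (`[a, b] : set (measurableTypeR R)) Lgu.
Proof. apply/measurable_EFinP; exact: (measurable_L D). Qed.

Let Lgu_neg : mu.-integrable `[a, b] Lgu^\-%E.
Proof.
have [M M0 HM] := L_bounded_below (bHL D).
apply: (le_integrable (mu := mu) _ _ _ (itv_integrable_cst a b M)) => //.
  exact: measurable_funeneg.
move=> s _; rewrite gee0_abs ?funeneg_ge0// /= ger0_norm//.
by rewrite funenegE /Lgu /= ge_max !lee_fin M0 andbT lerNl HM.
Qed.

(** L is bounded below, so its negative part along the curve is integrable over the bounded
    interval. *)
Lemma cost_ltNy : (-oo < cost L a b g u)%E.
Proof.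
rewrite /cost integralE -/Lgu.
have := integrable_fin_num (mu := mu) (measurable_itv _) Lgu_neg.
have := integral_ge0 mu (D := `[a, b]) (f := Lgu^\+%E) (fun s _ => funepos_ge0 Lgu s).
move: (\int[mu]_(s in `[a, b]) Lgu^\+ s)%E (\int[mu]_(s in `[a, b]) Lgu^\- s)%E.
by case=> [z| |] [y| |] //= _ _; rewrite ?ltNyr ?ltNye.
Qed.

Let cost_integrable k : cost L a b g u = k%:E -> itv_integrable a b (fun s => L (g s) (u s) - c).
Proof.
move=> costE.
have hp : mu.-integrable `[a, b] Lgu^\+%E.
  apply/integrableP; split; first exact: measurable_funepos.
  under eq_integral => s _ do rewrite gee0_abs//.
  have : (\int[mu]_(s in `[a, b]) Lgu^\+ s - \int[mu]_(s in `[a, b]) Lgu^\- s)%E = k%:E.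
    by rewrite -integralE; exact: costE.
  have := integrable_fin_num (mu := mu) (measurable_itv _) Lgu_neg.
  have := integral_ge0 mu (D := `[a, b]) (f := Lgu^\+%E) (fun s _ => funepos_ge0 Lgu s).
  move: (\int[mu]_(s in `[a, b]) Lgu^\+ s)%E (\int[mu]_(s in `[a, b]) Lgu^\- s)%E.
  by case=> [z| |] [y| |] //=; rewrite ?ltry.
have hi : itv_integrable a b (fun s => L (g s) (u s)).
  have := integrableB (mu := mu) (measurable_itv _) hp Lgu_neg.
  by rewrite -funeposneg.
by apply: itv_integrableD => //; exact: itv_integrable_cst.
Qed.

(** The curve is composed with the inverse of [reparam]. Slowed controls are bounded, so the running
    action [C0 * s] is always allowed; if the cost is finite, the true action accumulated in the old
    time is allowed as well. *)
Lemma admissible_wk : exists (T : R) (g' : R -> 'rV[R]_d),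
  [/\ b - a <= T, g' 0 = g a, g' T = g b, wk D g' (fun s => C0 * s) 0 T &
   forall k, cost L a b g u = k%:E ->
     exists2 l', wk D g' l' 0 T & l' T - l' 0 = k - c * (b - a)].
Proof.
(* The inverse is chosen by the intermediate value theorem, with the dummy value 0 outside the
   range; [reparam_expand] makes it monotone. *)
have ex s : exists t, 0 <= s <= reparam b -> a <= t <= b /\ reparam t = s.
  have [/reparam_inv[t tab ts]|N] := pselect (is_true (0 <= s <= reparam b)).
    by exists t.
  by exists 0.
have [th Hth] := choice ex.
have Tab : b - a <= reparam b.
  by have := reparam_expand (lexx a) ab (lexx b); rewrite reparam_a subr0.
have T0 : 0 <= reparam b by apply: le_trans Tab; rewrite subr_ge0.
have th_le s t : 0 <= s -> s <= t -> t <= reparam b -> th s <= th t.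
  move=> s0 st tb.
  have [/andP[sa sb] s1] : a <= th s <= b /\ reparam (th s) = s.
    by apply: Hth; rewrite s0 (le_trans st).
  have [/andP[ta tb'] t1] : a <= th t <= b /\ reparam (th t) = t.
    by apply: Hth; rewrite tb (le_trans s0).
  rewrite leNgt; apply/negP => tsl.
  have := reparam_expand ta (ltW tsl) sb; rewrite s1 t1.
  by move: tsl st; lra.
have th0 : th 0 = a.
  have [|/andP[ta tb] t1] := Hth 0; first by rewrite lexx.
  have := reparam_expand (lexx a) ta tb; rewrite t1 reparam_a.
  by move=> H; apply/eqP; rewrite eq_le ta andbT; move: H; lra.
have thT : th (reparam b) = b.
  have [|/andP[ta tb] t1] := Hth (reparam b); first by rewrite lexx T0.
  have := reparam_expand ta tb (lexx b); rewrite t1.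
  by move=> H; apply/eqP; rewrite eq_le tb/=; move: H; lra.
have rp s t : 0 <= s -> s <= t -> t <= reparam b ->
    [/\ a <= th s, th s <= th t, th t <= b & reparam (th t) - reparam (th s) = t - s].
  move=> s0 st tb.
  have [/andP[sa sb] s1] : a <= th s <= b /\ reparam (th s) = s.
    by apply: Hth; rewrite s0 (le_trans st).
  have [/andP[ta tb'] t1] : a <= th t <= b /\ reparam (th t) = t.
    by apply: Hth; rewrite tb (le_trans s0).
  by split; rewrite ?s1 ?t1// th_le.
exists (reparam b), (g \o th); split => //; rewrite /= ?th0 ?thT//.
  move=> s t s0 st tb; have [h1 h2 h3 h4] := rp s t s0 st tb.
  have := reparam_step h1 h2 h3; rewrite h4 => -[H1 [v [v1 v2 _]]].
  have ts0 : 0 <= t - s by rewrite subr_ge0.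
  have C01 : - bC1 D <= C0 by apply: le_trans (bLlow D (g (th s)) v) _; exact: bLup.
  rewrite -mulrBr; split => //=; first by rewrite ler_wpM2r.
  exists v; split => //.
  have Ct : 0 <= C * (t - s) ^+ 2 by rewrite mulr_ge0 ?bC_ge0// sqr_ge0.
  by have := ler_wpM2l ts0 (bLup D (g (th s)) v1); move: Ct; lra.
move=> k costE; have ri := cost_integrable costE.
exists (fun s => \int[mu]_(z in `[a, th s]) (L (g z) (u z) - c)).
  move=> s t s0 st tb; have [h1 h2 h3 h4] := rp s t s0 st tb.
  have := reparam_step h1 h2 h3; rewrite h4 => -[H1 [v [v1 v2 v3]]].
  have ri' : itv_integrable (th s) (th t) (fun z => L (g z) (u z) - c).
    exact: itv_integrable_sub ri.
  have [v4 v5] := v3 _ (fun _ _ => erefl) ri'.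
  rewrite (Rintegral_split h1 h2); last first.
    exact: itv_integrable_sub ri.
  by rewrite addrAC subrr add0r; split => //; exists v.
rewrite th0 thT set_itv1 Rintegral_set1 subr0.
have <- : (\int[mu]_(z in `[a, b]) L (g z) (u z)) = k.
  by move: costE; rewrite /cost /Rintegral => ->.
have -> : \int[mu]_(z in `[a, b]) L (g z) (u z) =
    \int[mu]_(z in `[a, b]) ((L (g z) (u z) - c) + c).
  by apply: eq_Rintegral => z _; rewrite subrK.
have -> := RintegralD (mu := mu) (measurable_itv _) ri (itv_integrable_cst a b c).
by rewrite Rintegral_itv_cst// addrK.
Qed.

End Reparametrization.

(** * Connections by weak trajectories: concatenation and limits *)

Section Paths.
Variables (R : realType) (d m : nat) (f : 'I_m -> 'rV[R]_d -> 'rV[R]_d).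
Variables (L : 'rV[R]_d -> 'rV[R]_m -> R) (c : R) (D : bounds f L c).
Notation C0 := (bC0 D).

Definition path_to (tau : R) (y z : 'rV[R]_d) (a : R) : Prop :=
  exists g l, [/\ wk D g l 0 tau, g 0 = y, g tau = z & l tau - l 0 = a].

Lemma path_cat t1 t2 y z w a1 a2 : 0 <= t1 -> 0 <= t2 ->
  path_to t1 y z a1 -> path_to t2 z w a2 -> path_to (t1 + t2) y w (a1 + a2).
Proof.
move=> t10 t20 [g1 [l1 [H1 g10 g1t l1E]]] [g2 [l2 [H2 g20 g2t l2E]]].
pose g s := if s <= t1 then g1 s else g2 (s - t1).
pose l s := if s <= t1 then l1 s else l2 (s - t1) - l2 0 + l1 t1.
have gl s : s <= t1 -> g s = g1 s /\ l s = l1 s by rewrite /g /l => ->.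
have gr s : t1 <= s -> g s = g2 (s - t1) /\ l s = l2 (s - t1) - l2 0 + l1 t1.
  rewrite le_eqVlt => /predU1P[<-|ts]; rewrite /g /l.
    by rewrite lexx !subrr g20 g1t add0r.
  by rewrite leNgt ts.
have t12 : t1 <= t1 + t2 by rewrite lerDl.
exists g, l; split.
- apply: (wk_cat (p := t1)) => s t as_ st tb.
    have [-> ->] := gl s (le_trans st tb); have [-> ->] := gl t tb.
    exact: H1.
  have [-> ->] := gr s as_; have [-> ->] := gr t (le_trans as_ st).
  have := H2 (s - t1) (t - t1); rewrite subr_ge0 lerD2r lerBlDr (addrC t2).
  move=> /(_ as_ st tb); congr step; by ring.
- by have [-> _] := gl 0 t10.
- by have [-> _] := gr _ t12; rewrite (addrC t1) addrK.
have [_ ->] := gr _ t12; have [_ ->] := gl 0 t10.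
by rewrite (addrC t1) addrK -l1E -l2E; ring.
Qed.

(** The surplus action is spread linearly over time, which requires a positive duration. *)
Lemma path_le tau y z a a' : 0 < tau -> a <= a' -> path_to tau y z a -> path_to tau y z a'.
Proof.
move=> tau0 aa' [g [l [H g0 gt lE]]].
exists g, (fun s => l s + (a' - a) * (s / tau)); split => //; last first.
  by rewrite divff ?gt_eqF// mul0r -lE; ring.
move=> s t s0 st tt; apply: step_le (H s t s0 st tt).
rewrite (_ : _ + _ - _ = l t - l s + (a' - a) * ((t - s) / tau)).
  by rewrite lerDl mulr_ge0 ?subr_ge0// divr_ge0 ?subr_ge0// ltW.
by field; rewrite gt_eqF.
Qed.

Lemma path_C0 tau y z a : path_to tau y z a -> path_to tau y z (C0 * tau).
Proof.
move=> [g [l [H g0 gt lE]]].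
exists g, (fun s => C0 * s); split => //; last by rewrite mulr0 subr0.
move=> s t s0 st tt; rewrite -mulrBr.
by apply: (step_C0 _ (H s t s0 st tt)); rewrite subr_ge0.
Qed.

Lemma path_wait (tau : R) y : path_to tau y y (C0 * tau).
Proof.
exists (fun=> y), (fun s => C0 * s); split => //; last by rewrite mulr0 subr0.
by move=> s t s0 st tt; rewrite -mulrBr; apply: step_const; rewrite subr_ge0.
Qed.

Lemma path_shift tau y z a k : intvec k -> path_to tau y z a -> path_to tau (y + k) (z + k) a.
Proof.
move=> ik [g [l [H g0 gt lE]]].
exists (fun s => g s + k), l; split; rewrite ?g0 ?gt//.
by move=> s t s0 st tt; apply: step_shift => //; exact: H.
Qed.

Lemma wk_limit (T : Type) (U : set_system T) {UU : UltraFilter U}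
    (g : T -> R -> 'rV[R]_d) (l : T -> R -> R) (g' : R -> 'rV[R]_d) (l' : R -> R) a b :
  (forall s, a <= s <= b -> (fun t => g t s) @ U --> g' s) ->
  (forall s, a <= s <= b -> (fun t => l t s) @ U --> l' s) ->
  (\forall t \near U, wk D (g t) (l t) a b) -> wk D g' l' a b.
Proof.
move=> cg cl H s t as_ st tb.
have sab : a <= s <= b by rewrite as_ (le_trans st).
have tab : a <= t <= b by rewrite tb (le_trans as_).
apply: (@step_limit _ _ _ _ _ _ D T U UU (t - s) (fun n => g n s) (fun n => g n t)
  (fun n => l n t - l n s)).
- by rewrite subr_ge0.
- exact: cg.
- exact: cg.
- by apply: cvgB; exact: cl.
- by apply: filterS H => n; exact.
Qed.

(** With the common running action [C0 * s], only the curves have to converge; they are uniformly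
    Lipschitz and start at bounded points. *)
Lemma path_limit (T : Type) (U : set_system T) {UU : UltraFilter U} (tau : R)
    (y z : T -> 'rV[R]_d) (v w : 'rV[R]_d) : 0 <= tau -> y @ U --> v -> z @ U --> w ->
  (forall t, path_to tau (y t) (z t) (C0 * tau)) -> path_to tau v w (C0 * tau).
Proof.
move=> tau0 yv zw H.
have H' t : exists g, [/\ wk D g (fun s => C0 * s) 0 tau, g 0 = y t & g tau = z t].
  have [g [l [Hg g0 gt lE]]] := H t; exists g; split => //.
  move=> s s' s0 st tt; rewrite -mulrBr.
  by apply: (step_C0 _ (Hg s s' s0 st tt)); rewrite subr_ge0.
have [g Hg] := choice H'.
have yb : \forall t \near U, `|y t| <= `|v| + 1.
  move/cvgrPdist_le : yv => /(_ 1 ltr01); apply: filterS => t Ht.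
  by rewrite -(subrK v (y t)) addrC (le_trans (ler_normD _ _))// lerD2l distrC.
have ex (s : R) : exists g' : 'rV[R]_d, 0 <= s <= tau -> (fun t => g t s) @ U --> g'.
  have [/andP[s0 st]|N] := pselect (is_true (0 <= s <= tau)); last by exists 0.
  have gb : \forall t \near U, `|g t s| <= `|v| + 1 + bB D * bK D * tau.
    apply: filterS yb => t yt; have [W g0 _] := Hg t.
    have [W1 _ _] := W 0 s (lexx _) s0 st.
    rewrite -(subrK (y t) (g t s)) addrC (le_trans (ler_normD _ _))// lerD//.
    by rewrite -g0 (le_trans W1)// subr0 ler_wpM2l// bBK0.
  by have [l Hl] := ultra_bounded_cvg gb; exists l.
have [g' Hg'] := choice ex.
exists g', (fun s => C0 * s); split; last by rewrite mulr0 subr0.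
- apply: (wk_limit (g := g) (l := fun _ s => C0 * s)).
  + by move=> s; exact: Hg'.
  + by move=> s _; exact: cvg_cst.
  + by apply: nearW => t; have [] := Hg t.
- have c0 := Hg' 0; rewrite lexx tau0 in c0.
  apply: (cvg_unique _ (c0 isT)); first exact: norm_hausdorff.
  by rewrite (_ : (fun t => g t 0) = y)//; apply/funext => t; have [] := Hg t.
have c0 := Hg' tau; rewrite lexx tau0 in c0.
apply: (cvg_unique _ (c0 isT)); first exact: norm_hausdorff.
by rewrite (_ : (fun t => g t tau) = z)//; apply/funext => t; have [] := Hg t.
Qed.

End Paths.

(** * Integral curves of a bounded Lipschitz field *)

Section Flow.
Variables (R : realType) (d : nat) (X : 'rV[R]_d -> 'rV[R]_d) (M Lam : R).
Hypotheses (M0 : 0 <= M) (Lam0 : 0 <= Lam).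
Hypothesis XM : forall x, `|X x| <= M.
Hypothesis XL : forall x y, `|X x - X y| <= Lam * `|x - y|.

Let euler (n : nat) (w : 'rV[R]_d) (k : nat) := iter k (fun y => y + n.+1%:R^-1 *: X y) w.

Let euler_dist n w k l : `|euler n w (k + l) - euler n w k| <= M * (l%:R / n.+1%:R).
Proof.
elim: l => [|l IH]; first by rewrite addn0 subrr normr0 mul0r mulr0.
rewrite addnS /euler iterS -/(euler n w (k + l)) addrAC.
have -> : M * (l.+1%:R / n.+1%:R) = M * (l%:R / n.+1%:R) + n.+1%:R^-1 * M.
  by rewrite -[l.+1%:R]natr1; ring.
by rewrite (le_trans (ler_normD _ _))// lerD// normrZ ger0_norm// ler_wpM2l.
Qed.

Let euler_incr n w k l x : (forall i, (i <= l)%N -> `|X (euler n w (k + i)) - X x| <= Lam * M * (l%:R / n.+1%:R)) ->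
  `|euler n w (k + l) - euler n w k - (l%:R / n.+1%:R) *: X x| <= Lam * M * (l%:R / n.+1%:R) ^+ 2.
Proof.
move=> H.
suff K i : (i <= l)%N -> `|euler n w (k + i) - euler n w k - (i%:R / n.+1%:R) *: X x|
    <= Lam * M * (l%:R / n.+1%:R) * (i%:R / n.+1%:R).
  by apply: (le_trans (K l (leqnn _))); rewrite expr2 !mulrA lexx.
elim: i => [|i IH] il.
  by rewrite addn0 !mul0r scale0r subrr subr0 normr0 mulr0.
have -> : euler n w (k + i.+1) - euler n w k - (i.+1%:R / n.+1%:R) *: X x =
  (euler n w (k + i) - euler n w k - (i%:R / n.+1%:R) *: X x) + n.+1%:R^-1 *: (X (euler n w (k + i)) - X x).
  rewrite addnS [euler _ _ _.+1]/euler iterS -/(euler n w (k + i)).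
  by apply/rowP => j; rewrite !mxE -natr1; ring.
have -> : Lam * M * (l%:R / n.+1%:R) * (i.+1%:R / n.+1%:R) =
    Lam * M * (l%:R / n.+1%:R) * (i%:R / n.+1%:R) + n.+1%:R^-1 * (Lam * M * (l%:R / n.+1%:R)).
  by rewrite -[i.+1%:R]natr1; ring.
rewrite (le_trans (ler_normD _ _))// lerD//; first by apply: IH; exact: ltnW.
by rewrite normrZ ger0_norm// ler_wpM2l// H// ltnW.
Qed.

(** Euler polygons of mesh 1/(n+1) satisfy discrete versions of the three estimates, which survive
    the limit along an ultrafilter. The last estimate, based at the end point, serves when the curve
    is run backwards. *)
Lemma flow_exists w : exists g : R -> 'rV[R]_d, g 0 = w /\
  forall s t, 0 <= s -> s <= t ->
   [/\ `|g t - g s| <= M * (t - s),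
       `|g t - g s - (t - s) *: X (g s)| <= Lam * M * (t - s) ^+ 2 &
       `|g t - g s - (t - s) *: X (g t)| <= Lam * M * (t - s) ^+ 2].
Proof.
have [U [UU Uoo]] := @ultraFilterLemma nat \oo _.
pose fl n (s : R) := Num.trunc (n.+1%:R * s).
pose gn n s := euler n w (fl n s).
have fl_itv n s : 0 <= s -> (fl n s)%:R <= n.+1%:R * s < (fl n s).+1%:R.
  by move=> s0; rewrite /fl truncn_itv// mulr_ge0.
have fl_le n s t : 0 <= s -> s <= t -> (fl n s <= fl n t)%N.
  by move=> s0 st; rewrite /fl; apply: le_truncn; rewrite ler_wpM2l.
pose q n s t : R := (fl n t - fl n s)%:R / n.+1%:R.
have q_close n s t : 0 <= s -> s <= t -> `|q n s t - (t - s)| <= n.+1%:R^-1.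
  move=> s0 st.
  have /andP[a1 a2] := fl_itv n s s0; have /andP[b1 b2] := fl_itv n t (le_trans s0 st).
  have n0 : 0 < n.+1%:R :> R by [].
  rewrite -(ler_pM2l n0) mulfV ?gt_eqF// -{1}(gtr0_norm n0) -normrM mulrBr /q.
  rewrite mulrCA mulfV ?gt_eqF// mulr1 natrB ?fl_le//.
  move: a2 b2; rewrite -!natr1 => a2 b2.
  by rewrite ler_norml; apply/andP; split; move: a1 a2 b1 b2; rewrite mulrBr; lra.
have q_cvg s t : 0 <= s -> s <= t -> (fun n => q n s t) @ U --> t - s.
  move=> s0 st; apply/cvgrPdist_le => e e0; apply: Uoo; near=> n.
  rewrite distrC (le_trans (q_close n s t s0 st))//.
  by apply/ltW; near: n; exact: (near_infty_natSinv_lt (PosNum e0)).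
have flE n s t : 0 <= s -> s <= t -> fl n t = (fl n s + (fl n t - fl n s))%N.
  by move=> s0 st; rewrite subnKC// fl_le.
have gn_dist n s t : 0 <= s -> s <= t -> `|gn n t - gn n s| <= M * q n s t.
  by move=> s0 st; rewrite /gn {1}(flE n s t s0 st); exact: euler_dist.
have ex (s : R) : exists x : 'rV[R]_d, 0 <= s -> (fun n => gn n s) @ U --> x.
  have [s0|N] := pselect (is_true (0 <= s)); last by exists 0.
  have gb : \forall n \near U, `|gn n s| <= `|w| + M * (s + 1).
    apply: nearW => n; have := gn_dist n 0 s (lexx _) s0.
    have -> : gn n 0 = w by rewrite /gn /fl mulr0 truncn0.
    move=> H; rewrite -(subrK w (gn n s)) addrC (le_trans (ler_normD _ _))// lerD2l.
    rewrite (le_trans H)// ler_wpM2l//.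
    have /ler_normlP[_] := q_close n 0 s (lexx _) s0; rewrite subr0.
    rewrite lerBlDr => /le_trans; apply; rewrite addrC lerD2l.
    by rewrite invf_le1// ler1n.
  by have [x Hx] := ultra_bounded_cvg gb; exists x.
have [g Hg] := choice ex.
have cle (a b : nat -> R) (la lb : R) : a @ U --> la -> b @ U --> lb ->
    (forall n, a n <= b n) -> la <= lb.
  move=> ca cb ab; rewrite -subr_ge0.
  have gh' : \forall t \near U, 0 <= b t - a t by apply: nearW => t; rewrite subr_ge0.
  exact: (@closed_cvg _ _ U _ (fun t => b t - a t) (fun x : R => 0 <= x) (@closed_ge _ 0) gh' _ (cvgB cb ca)).
have cX s : 0 <= s -> (fun n => X (gn n s)) @ U --> X (g s).
  move=> s0; apply/cvgrPdist_le => e e0.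
  have L10 : 0 < Lam + 1 by rewrite ltr_wpDl.
  have e1 : 0 < e / (Lam + 1) by rewrite divr_gt0.
  move/cvgrPdist_le : (Hg s s0) => /(_ _ e1); apply: filterS => n Hn.
  apply: (le_trans (XL _ _)); apply: (@le_trans _ _ ((Lam + 1) * `|g s - gn n s|)).
    by rewrite ler_wpM2r// lerDl.
  by rewrite mulrC -ler_pdivlMr.
have est n s t x : 0 <= s -> s <= t -> (x = fl n s \/ x = fl n t) ->
   `|gn n t - gn n s - q n s t *: X (euler n w x)| <= Lam * M * (q n s t) ^+ 2.
  move=> s0 st xE; rewrite /gn {1}(flE n s t s0 st); apply: euler_incr => i il.
  apply: (le_trans (XL _ _)); rewrite -mulrA ler_wpM2l//.
  have [->|->] := xE.
    apply: (le_trans (euler_dist _ _ _ _)); rewrite ler_wpM2l// ler_wpM2r//.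
    by rewrite ler_nat.
  rewrite distrC {1}(flE n s t s0 st) -{1}(subnKC il) addnA.
  apply: (le_trans (euler_dist _ _ _ _)); rewrite ler_wpM2l// ler_wpM2r//.
  by rewrite ler_nat leq_subr.
exists g; split.
  have c0 := Hg 0 (lexx _); apply: (cvg_unique _ c0) => //.
  rewrite (_ : (fun n => gn n 0) = fun=> w); first exact: cvg_cst.
  by apply/funext => n; rewrite /gn /fl mulr0 truncn0.
move=> s t s0 st; have t0 := le_trans s0 st.
have cd := cvgB (Hg t t0) (Hg s s0).
have cq := q_cvg s t s0 st.
have cq2 : (fun n => Lam * M * (q n s t) ^+ 2) @ U --> Lam * M * (t - s) ^+ 2.
  by apply: cvgM; [exact: cvg_cst|rewrite expr2; under eq_fun do rewrite expr2; exact: cvgM].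
split.
- have c1 : (fun n => `|gn n t - gn n s|) @ U --> `|g t - g s|.
    by apply: cvg_norm; exact: cd.
  have c2 : (fun n => M * q n s t) @ U --> M * (t - s) by apply: cvgM => //; exact: cvg_cst.
  by apply: (cle _ _ _ _ c1 c2) => n; exact: gn_dist.
- have c1 : (fun n => `|gn n t - gn n s - q n s t *: X (gn n s)|) @ U -->
      `|g t - g s - (t - s) *: X (g s)|.
    by apply: cvg_norm; apply: cvgB; [exact: cd|exact: (cvgZ cq (cX s s0))].
  by apply: (cle _ _ _ _ c1 cq2) => n; exact: (est n s t _ s0 st (or_introl erefl)).
- have c1 : (fun n => `|gn n t - gn n s - q n s t *: X (gn n t)|) @ U -->
      `|g t - g s - (t - s) *: X (g t)|.
    by apply: cvg_norm; apply: cvgB; [exact: cd|exact: (cvgZ cq (cX t t0))].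
  by apply: (cle _ _ _ _ c1 cq2) => n; exact: (est n s t _ s0 st (or_intror erefl)).
Unshelve. all: by end_near. Qed.

End Flow.

(** * Vector fields as derivations; the commutator is the Lie bracket *)

Section SmoothFunctions.
Variables (R : realType) (d : nat).
Notation "'e_ i" := (delta_mx 0 i) (at level 8, i at level 2, format "''e_' i").
Notation "'d_ i g" := (fun x => 'D_('e_i) g x) (at level 8, i at level 2, g at level 9).

(* The derivatives, but not the functions, are periodic: this class contains the
   coordinates of R^d, and all iterated derivatives are bounded. *)
Definition regular (g : 'rV[R]_d -> R) : Prop :=
  (forall k, Sm k g) /\ forall i, Zperiodic ('d_i g).

Lemma regular_cst (c : R) : regular (fun=> c).
Proof.
split=> [k|i x k ik]; first exact: Sm_cst.
by rewrite !(derive_cst c).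
Qed.

Lemma derive_lincomb (a : R) (g h : 'rV[R]_d -> R) i x : Sm 1 g -> Sm 1 h ->
  'D_('e_i) (fun y => a * g y + h y) x = a * 'd_i g x + 'd_i h x.
Proof.
move=> Hg Hh.
have dg : derivable g x 'e_i by exact: (Sm_derivable Hg).
have dh : derivable h x 'e_i by exact: (Sm_derivable Hh).
have E : (fun y => a * g y + h y) = (a *: g + h) by [].
rewrite E deriveD ?deriveZ//; exact: derivableZ.
Qed.

Lemma regular_lincomb (a : R) g h : regular g -> regular h -> regular (fun x => a * g x + h x).
Proof.
move=> [g1 g2] [h1 h2]; split=> [k|i x k ik].
  by apply: Sm_add => //; apply: Sm_mul => //; exact: Sm_cst.
by rewrite !derive_lincomb// (g2 i x k ik) (h2 i x k ik).
Qed.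

Lemma regular_coord j : regular (fun x : 'rV[R]_d => x 0 j).
Proof.
split=> [k|i]; first exact: Sm_coord.
move=> x k ik; have E y := @derive_val _ _ _ _ _ _ _ (is_derive_coord i j (y : 'rV[R]_d)).
by rewrite !E.
Qed.

Lemma regular_bounded g : regular g -> forall i, exists2 M, 0 <= M & forall x, `|'d_i g x| <= M.
Proof.
move=> [g1 g2] i; exact: (periodic_bounded (Sm_cts (Sm_d i (g1 1%N))) (g2 i)).
Qed.

Definition vfield (X : 'rV[R]_d -> 'rV[R]_d) : Prop :=
  forall j, (forall k, Sm k (fun x => X x 0 j)) /\ Zperiodic (fun x => X x 0 j).

Lemma vfield_derive X g : vfield X -> regular g -> regular (fun x => \sum_i X x 0 i * 'd_i g x).
Proof.
move=> HX [g1 g2]; split=> [k|i].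
  apply: Sm_sum => j; apply: Sm_mul; first by have [] := HX j.
  exact: (Sm_d _ (g1 k.+1)).
move=> x k ik; apply: derive_shift => y.
by apply: eq_bigr => j _; rewrite (g2 j y k ik); have [_ ->] := HX j.
Qed.

Lemma derive_sum_mul (a h : 'I_d -> 'rV[R]_d -> R) i x :
  (forall j, Sm 1 (a j)) -> (forall j, Sm 1 (h j)) ->
  'D_('e_i) (fun y => \sum_j a j y * h j y) x =
  \sum_j ('d_i (a j) x * h j x + a j x * 'd_i (h j) x).
Proof.
move=> Ha Hh.
have E : (fun y => \sum_j a j y * h j y) = \sum_j (a j * h j).
  by apply/funext => y; rewrite fct_sumE.
rewrite E derive_sum => [|j].
  apply: eq_bigr => j _; rewrite deriveM; [|exact: (Sm_derivable (Ha j))|exact: (Sm_derivable (Hh j))].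
  by rewrite /GRing.scale/=; ring.
by apply: derivableM; [exact: (Sm_derivable (Ha j))|exact: (Sm_derivable (Hh j))].
Qed.

Lemma lie_bracket_coord X Y x j : vfield X -> vfield Y ->
  lie_bracket X Y x 0 j = \sum_i (X x 0 i * 'd_i (fun y => Y y 0 j) x - Y x 0 i * 'd_i (fun y => X y 0 j) x).
Proof.
move=> HX HY.
have K (Z : 'rV[R]_d -> 'rV[R]_d) v : vfield Z ->
    ('D_v Z x) 0 j = \sum_i v 0 i * 'd_i (fun y => Z y 0 j) x.
  move=> HZ; rewrite derive_mx; last first.
    apply/derivable_mxP => i k; have [H _] := HZ k.
    rewrite (ord1 i); have Dk := Sm_is_derive x v (H 1%N).
    exact: (@ex_derive _ _ _ _ _ _ _ Dk).
  rewrite mxE; have [H _] := HZ j.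
  exact: (@derive_val _ _ _ _ _ _ _ (Sm_is_derive x v (H 1%N))).
by rewrite /lie_bracket !mxE !K// -sumrB.
Qed.

Lemma vfield_bracket X Y : vfield X -> vfield Y -> vfield (lie_bracket X Y).
Proof.
move=> HX HY j.
have E : (fun x => lie_bracket X Y x 0 j) =1 fun x =>
   \sum_i (X x 0 i * 'd_i (fun y => Y y 0 j) x + (-1) * (Y x 0 i * 'd_i (fun y => X y 0 j) x)).
  by move=> x; rewrite lie_bracket_coord//; apply: eq_bigr => i _; rewrite mulN1r.
have [Xj Xp] := HX j; have [Yj Yp] := HY j.
split=> [k|x k ik].
  apply: (Sm_ext (fun x => esym (E x))).
  apply: Sm_sum => i; apply: Sm_add; last apply: Sm_mul; try exact: Sm_cst.
    by apply: Sm_mul; [have [] := HX i|exact: (Sm_d _ (Yj k.+1))].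
  by apply: Sm_mul; [have [] := HY i|exact: (Sm_d _ (Xj k.+1))].
rewrite !E; apply: eq_bigr => i _.
have [_ Xi] := HX i; have [_ Yi] := HY i.
have dX := derive_shift (k := k) 'e_i (fun y => Xp y k ik) x.
have dY := derive_shift (k := k) 'e_i (fun y => Yp y k ik) x.
by rewrite dX dY (Xi x k ik) (Yi x k ik).
Qed.

(** The second derivatives of [g] cancel by [schwarz]; only derivatives of the coefficients
    survive. *)
Lemma commutator_bracket X Y g x : vfield X -> vfield Y -> regular g ->
  \sum_i X x 0 i * 'd_i (fun y => \sum_j Y y 0 j * 'd_j g y) x
  - \sum_i Y x 0 i * 'd_i (fun y => \sum_j X y 0 j * 'd_j g y) x
  = \sum_j lie_bracket X Y x 0 j * 'd_j g x.
Proof.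
move=> HX HY [g1 g2].
have EX i : 'd_i (fun y => \sum_j X y 0 j * 'd_j g y) x =
    \sum_j ('d_i (fun y => X y 0 j) x * 'd_j g x + X x 0 j * 'd_i 'd_j g x).
  by apply: derive_sum_mul => j; [have [] := HX j|exact: (Sm_d _ (g1 2%N))].
have EY i : 'd_i (fun y => \sum_j Y y 0 j * 'd_j g y) x =
    \sum_j ('d_i (fun y => Y y 0 j) x * 'd_j g x + Y x 0 j * 'd_i 'd_j g x).
  by apply: derive_sum_mul => j; [have [] := HY j|exact: (Sm_d _ (g1 2%N))].
pose a i : R := X x 0 i; pose b i : R := Y x 0 i.
pose da i j : R := 'd_i (fun y => X y 0 j) x; pose db i j : R := 'd_i (fun y => Y y 0 j) x.
pose p i : R := 'd_i g x; pose q i j : R := 'd_i 'd_j g x.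
have qs i j : q i j = q j i by exact: schwarz i j (g1 2%N) x.
have EX' i : 'd_i (fun y => \sum_j X y 0 j * 'd_j g y) x = \sum_j (da i j * p j + a j * q i j) := EX i.
have EY' i : 'd_i (fun y => \sum_j Y y 0 j * 'd_j g y) x = \sum_j (db i j * p j + b j * q i j) := EY i.
have EL j : lie_bracket X Y x 0 j = \sum_i (a i * db i j - b i * da i j) by rewrite lie_bracket_coord.
transitivity (\sum_i a i * (\sum_j (db i j * p j + b j * q i j))
   - \sum_i b i * (\sum_j (da i j * p j + a j * q i j))).
  by congr (_ - _); apply: eq_bigr => i _; rewrite ?EX' ?EY'.
transitivity (\sum_j (\sum_i (a i * db i j - b i * da i j)) * p j); last first.
  by apply: eq_bigr => j _; rewrite EL.
clearbody a b da db p q.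
have -> : \sum_j (\sum_i (a i * db i j - b i * da i j)) * p j =
    \sum_i \sum_j (a i * db i j - b i * da i j) * p j.
  by rewrite exchange_big/=; apply: eq_bigr => j _; rewrite mulr_suml.
have S : \sum_i \sum_j a i * (b j * q i j) = \sum_i \sum_j b i * (a j * q i j).
  rewrite exchange_big/=; apply: eq_bigr => j _; apply: eq_bigr => i _.
  by rewrite (qs i j); ring.
have F (u v : 'I_d -> R) (w : 'I_d -> 'I_d -> R) :
    \sum_i u i * (\sum_j (w i j * p j + v j * q i j)) =
    \sum_i \sum_j u i * (w i j * p j) + \sum_i \sum_j u i * (v j * q i j).
  rewrite -big_split/=; apply: eq_bigr => i _; rewrite mulr_sumr -big_split/=.
  by apply: eq_bigr => j _; rewrite mulrDr.
rewrite !F S opprD addrACA subrr addr0 -sumrB; apply: eq_bigr => i _.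
by rewrite -sumrB; apply: eq_bigr => j _; ring.
Qed.

End SmoothFunctions.

(** * The ring of additive operators on test functions *)

Section OperatorRing.
Variables (R : realType) (d : nat).
Notation "'e_ i" := (delta_mx 0 i) (at level 8, i at level 2, format "''e_' i").
Notation "'d_ i g" := (fun x => 'D_('e_i) g x) (at level 8, i at level 2, g at level 9).

Definition regular_pred : {pred 'rV[R]_d -> R} := fun g => `[< regular g >].

Lemma regular_zmod_closed : zmod_closed regular_pred.
Proof.
split=> [|g h /asboolP Hg /asboolP Hh]; apply/asboolP; first exact: regular_cst.
have := regular_lincomb (-1) Hh Hg; congr regular.
by apply/funext => x; rewrite mulN1r addrC.
Qed.

HB.instance Definition _ := GRing.isZmodClosed.Build _ regular_pred regular_zmod_closed.

Record sfun := Sfun { sfun_val :> 'rV[R]_d -> R; sfunP : sfun_val \in regular_pred }.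

HB.instance Definition _ := [isSub of sfun for sfun_val].
HB.instance Definition _ := [Choice of sfun by <:].
HB.instance Definition _ := [SubChoice_isSubZmodule of sfun by <:].

Lemma sfun_regular (g : sfun) : regular g.
Proof. by have /asboolP := sfunP g. Qed.

Definition mk_sfun (g : 'rV[R]_d -> R) (H : regular g) : sfun := Sfun (introT (asboolP _) H : g \in regular_pred).

Lemma sfun_eq (g h : sfun) : (forall x, g x = h x) -> g = h.
Proof. by move=> gh; apply/val_inj/funext. Qed.

Lemma sfunDE (g h : sfun) x : (g + h) x = g x + h x.
Proof. by rewrite [LHS](congr1 (fun k : 'rV[R]_d -> R => k x) (raddfD (val : sfun -> _) g h)). Qed.
Lemma sfunNE (g : sfun) x : (- g) x = - g x.
Proof. by rewrite [LHS](congr1 (fun k : 'rV[R]_d -> R => k x) (raddfN (val : sfun -> _) g)). Qed.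
Lemma sfun0E x : (0 : sfun) x = 0.
Proof. by rewrite [LHS](congr1 (fun k : 'rV[R]_d -> R => k x) (raddf0 (val : sfun -> _))). Qed.

Definition op_pred : {pred sfun -> sfun} :=
  fun p => `[< forall g h, p (g - h) = p g - p h >].

Lemma op_zmod_closed : zmod_closed op_pred.
Proof.
split=> [|p q /asboolP Hp /asboolP Hq]; apply/asboolP => g h; first by rewrite subrr.
have E k : (p - q) k = p k - q k by [].
by rewrite !E Hp Hq opprD addrACA -opprD.
Qed.

HB.instance Definition _ := GRing.isZmodClosed.Build _ op_pred op_zmod_closed.

(** Additive operators form a noncommutative ring under composition, so truncated power series of
    operators are elements of [{poly op}]. Real scalars enter as the operators [op_scale]. *)
Record op := Op { op_val :> sfun -> sfun; opP : op_val \in op_pred }.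

HB.instance Definition _ := [isSub of op for op_val].
HB.instance Definition _ := [Choice of op by <:].
HB.instance Definition _ := [SubChoice_isSubZmodule of op by <:].

Lemma opB (p : op) g h : p (g - h) = p g - p h.
Proof. by have /asboolP := opP p; apply. Qed.

Definition mk_op p (H : forall g h, p (g - h) = p g - p h) : op :=
  Op (introT (asboolP _) H : p \in op_pred).

Lemma op_eq (p q : op) : (forall g, p g = q g) -> p = q.
Proof. by move=> pq; apply/val_inj/funext. Qed.

Lemma op0 (p : op) : p 0 = 0.
Proof. by have := opB p 0 0; rewrite !subrr. Qed.
Lemma opN (p : op) g : p (- g) = - p g.
Proof. by rewrite -sub0r opB op0 sub0r. Qed.
Lemma opD (p : op) g h : p (g + h) = p g + p h.
Proof. by rewrite -{1}[h]opprK opB opN opprK. Qed.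

Definition op_one : op := mk_op (fun g h => erefl (g - h)).

Lemma op_mul_subproof (p q : op) g h : p (q (g - h)) = p (q g) - p (q h).
Proof. by rewrite !opB. Qed.

Definition op_mul (p q : op) : op := mk_op (op_mul_subproof p q).

Lemma op_mulA : associative op_mul.
Proof. by move=> p q r; apply: op_eq. Qed.
Lemma op_mul1 : left_id op_one op_mul.
Proof. by move=> p; apply: op_eq. Qed.
Lemma op_mulr1 : right_id op_one op_mul.
Proof. by move=> p; apply: op_eq. Qed.
Lemma op_mulDl : left_distributive op_mul +%R.
Proof. by move=> p q r; apply: op_eq. Qed.
Lemma op_mulDr : right_distributive op_mul +%R.
Proof. by move=> p q r; apply: op_eq => g; rewrite /= opD. Qed.
Lemma op_one_neq0 : op_one != 0.
Proof.
apply/eqP => /(congr1 (fun p : op => p (mk_sfun (regular_cst d 1)) 0)) /= /eqP.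
by rewrite oner_eq0.
Qed.

HB.instance Definition _ := GRing.Zmodule_isNzRing.Build op
  op_mulA op_mul1 op_mulr1 op_mulDl op_mulDr op_one_neq0.

Lemma opDE (p q : op) g : (p + q) g = p g + q g. Proof. by []. Qed.
Lemma opNE (p : op) g : (- p) g = - p g. Proof. by []. Qed.
Lemma opME (p q : op) g : (p * q) g = p (q g). Proof. by []. Qed.
Lemma op1E g : (1 : op) g = g. Proof. by []. Qed.
Lemma op0E g : (0 : op) g = 0. Proof. by []. Qed.

Lemma op_sumE n (p : 'I_n -> op) g x : (\sum_i p i) g x = \sum_i p i g x.
Proof. by elim/big_rec2 : _ => // i a b _ <-. Qed.

Lemma regular_scale (a : R) (g : 'rV[R]_d -> R) : regular g -> regular (fun x => a * g x).
Proof.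
move=> Hg; have -> : (fun x => a * g x) = fun x => a * g x + 0.
  by apply/funext => x; rewrite addr0.
exact: regular_lincomb (regular_cst d 0).
Qed.

Lemma op_scale_subproof (a : R) (g h : sfun) :
  mk_sfun (regular_scale a (sfun_regular (g - h))) =
  mk_sfun (regular_scale a (sfun_regular g)) - mk_sfun (regular_scale a (sfun_regular h)).
Proof. by apply: sfun_eq => x; rewrite /= mulrBr. Qed.

Definition op_scale (a : R) : op := mk_op (op_scale_subproof a).

Lemma op_scaleE a g x : op_scale a g x = a * g x. Proof. by []. Qed.

Section LieDerivative.
Variables (X : 'rV[R]_d -> 'rV[R]_d) (HX : vfield X).

Lemma op_lie_subproof (g h : sfun) :
  mk_sfun (vfield_derive HX (sfun_regular (g - h))) =
  mk_sfun (vfield_derive HX (sfun_regular g)) - mk_sfun (vfield_derive HX (sfun_regular h)).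
Proof.
have [g1 _] := sfun_regular g; have [h1 _] := sfun_regular h.
have E i x : 'd_i (g - h) x = 'd_i g x - 'd_i h x :> R.
  have := derive_lincomb (-1) i x (h1 1%N) (g1 1%N); rewrite mulN1r addrC => <-.
  by congr ('D_ _ _ x); apply/funext => y; rewrite sfunDE sfunNE mulN1r addrC.
apply: sfun_eq => x; rewrite sfunDE sfunNE /=.
rewrite -(sumrB _ _ (fun i => X x 0 i * 'd_i g x : R) (fun i => X x 0 i * 'd_i h x : R)).
by apply: eq_bigr => i _; rewrite E mulrBr.
Qed.

Definition op_lie : op := mk_op op_lie_subproof.

Lemma op_lieE (g : sfun) x : op_lie g x = \sum_i X x 0 i * 'd_i g x.
Proof. by []. Qed.

Lemma op_lie_scale a : op_lie * op_scale a = op_scale a * op_lie.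
Proof.
apply: op_eq => g; apply: sfun_eq => x; rewrite !opME op_scaleE !op_lieE mulr_sumr.
apply: eq_bigr => i _; rewrite mulrCA; congr (_ * _).
have [g1 _] := sfun_regular g.
have := derive_lincomb a i x (g1 1%N) (Sm_cst 1 d 0); rewrite (derive_cst (0 : R)) addr0 => <-.
by congr ('D_ _ _ x); apply/funext => y; rewrite addr0.
Qed.

End LieDerivative.

Lemma op_lie_bracket X Y (HX : vfield X) (HY : vfield Y) (HXY : vfield (lie_bracket X Y)) :
  op_lie HX * op_lie HY - op_lie HY * op_lie HX = op_lie HXY.
Proof.
apply: op_eq => g; apply: sfun_eq => x.
exact: (commutator_bracket x HX HY (sfun_regular g)).
Qed.

Lemma op_lieN X (HX : vfield X) (HN : vfield (fun x => - X x)) : op_lie HN = - op_lie HX.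
Proof.
apply: op_eq => g; apply: sfun_eq => x; rewrite opNE sfunNE !op_lieE -sumrN.
by apply: eq_bigr => i _; rewrite mxE mulNr.
Qed.

End OperatorRing.

(** * Congruences modulo powers of the variable, and group commutators *)

Section PolynomialCongruence.
Variable A : nzRingType.
Implicit Types (a b p q r : {poly A}).

Definition dvdX n p := exists r, p = r * 'X^n.

Lemma dvdX_coef n p : (forall i, (i < n)%N -> p`_i = 0) -> dvdX n p.
Proof.
move=> H; exists (drop_poly n p); rewrite -[LHS](poly_take_drop n) -[RHS]add0r; congr (_ + _).
by apply/polyP => i; rewrite coef_take_poly coef0; case: ifP => // /H.
Qed.

Lemma coef_dvdX n p i : dvdX n p -> (i < n)%N -> p`_i = 0.
Proof. by move=> [r ->] ni; rewrite coefMXn ni. Qed.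

Lemma dvdXD n p q : dvdX n p -> dvdX n q -> dvdX n (p + q).
Proof. by move=> [r ->] [s ->]; exists (r + s); rewrite mulrDl. Qed.

Lemma dvdXN n p : dvdX n p -> dvdX n (- p).
Proof. by move=> [r ->]; exists (- r); rewrite mulNr. Qed.

Lemma dvdXB n p q : dvdX n p -> dvdX n q -> dvdX n (p - q).
Proof. by move=> Hp Hq; apply: dvdXD => //; exact: dvdXN. Qed.

Lemma dvdXM m n p q : dvdX m p -> dvdX n q -> dvdX (m + n) (p * q).
Proof.
move=> [r ->] [s ->]; exists (r * s).
by rewrite -!mulrA exprD; congr (_ * _); rewrite mulrA -commr_polyXn -mulrA.
Qed.

Lemma dvdX_le m n p : (m <= n)%N -> dvdX n p -> dvdX m p.
Proof. by move=> mn [r ->]; exists (r * 'X^(n - m)); rewrite -mulrA -exprD subnK. Qed.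

Lemma dvdX0 p : dvdX 0 p.
Proof. by exists p; rewrite expr0 mulr1. Qed.

Lemma dvdX_Ml n p q : dvdX n q -> dvdX n (p * q).
Proof. exact: (dvdXM (dvdX0 p)). Qed.

Lemma dvdX_Mr n p q : dvdX n p -> dvdX n (p * q).
Proof. by move=> H; have := dvdXM H (dvdX0 q); rewrite addn0. Qed.

Lemma dvdX_inv n a a' b b' : dvdX n (a * a' - 1) -> dvdX n (b * b' - 1) ->
  dvdX n (a * b * (b' * a') - 1).
Proof.
move=> Ha Hb.
have -> : a * b * (b' * a') - 1 = a * (b * b' - 1) * a' + (a * a' - 1).
  by rewrite mulrBr mulrBl mulr1 addrA subrK !mulrA.
by apply: dvdXD => //; apply: dvdX_Mr; exact: dvdX_Ml.
Qed.

(** As [a'] and [b'] are inverses modulo ['X^N.+1], the group commutator minus 1 is congruent to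
    [(a b - b a) a' b']. Here [a b - b a] is the ring commutator of [a - 1] and [b - 1], with
    leading coefficient [x y - y x] in degree [k + l], and [a' b'] is 1 modulo the variable. *)
Lemma dvdX_commutator N k l a a' b b' x y : (k + l <= N)%N -> (0 < k)%N -> (0 < l)%N ->
  dvdX k.+1 (a - 1 - x%:P * 'X^k) -> dvdX l.+1 (b - 1 - y%:P * 'X^l) ->
  dvdX 1 (a' - 1) -> dvdX 1 (b' - 1) ->
  dvdX N.+1 (a * a' - 1) -> dvdX N.+1 (b * b' - 1) ->
  dvdX (k + l).+1 (a * b * (a' * b') - 1 - (x * y - y * x)%:P * 'X^(k + l)).
Proof.
move=> klN k0 l0 Ha Hb Ha' Hb' Haa Hbb.
have kln : ((k + l).+1 <= N.+1)%N by [].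
have low c z n : dvdX n.+1 (c - 1 - z%:P * 'X^n) -> dvdX n (c - 1).
  move=> H; rewrite -(subrK (z%:P * 'X^n) (c - 1)); apply: dvdXD; first exact: dvdX_le H.
  by exists z%:P.
have prod c c' z z' m n : dvdX m.+1 (c - 1 - z%:P * 'X^m) -> dvdX n.+1 (c' - 1 - z'%:P * 'X^n) ->
    dvdX (m + n).+1 ((c - 1) * (c' - 1) - (z * z')%:P * 'X^(m + n)).
  move=> Hc Hc'.
  have -> : (z * z')%:P * 'X^(m + n) = z%:P * 'X^m * (z'%:P * 'X^n).
    rewrite polyCM exprD -!mulrA; congr (_ * _); rewrite !mulrA; congr (_ * _).
    by rewrite commr_polyXn.
  have G (u v w t : {poly A}) : u * v - w * t = (u - w) * v + w * (v - t).
    by rewrite mulrBl mulrBr addrA subrK.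
  rewrite G.
  apply: dvdXD; first by have := dvdXM Hc (low _ _ _ Hc').
  by rewrite -addnS; apply: dvdXM => //; exists z%:P.
have E : a * b - b * a = (a - 1) * (b - 1) - (b - 1) * (a - 1).
  have G (u v : {poly A}) : (u - 1) * (v - 1) = u * v - (u + v - 1).
    by rewrite mulrBl mul1r mulrBr mulr1 -addrA -opprD addrA.
  by rewrite !G (addrC b); set t := a + b - 1; rewrite [- (_ - t)]opprB addrA subrK.
have H1 : dvdX (k + l).+1 (a * b - b * a - (x * y - y * x)%:P * 'X^(k + l)).
  have P2 := prod _ _ _ _ _ _ Hb Ha; rewrite (addnC l) in P2.
  have G (u v w t : {poly A}) : u - v - (w - t) = u - w - (v - t).
    by rewrite !opprB addrACA (addrC (- v)) addrACA.
  by rewrite E polyCB [_ * 'X^_]mulrBl G; exact: dvdXB (prod _ _ _ _ _ _ Ha Hb) P2.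
have H2 : dvdX (k + l) (a * b - b * a).
  by rewrite E; apply: dvdXB; [|rewrite addnC]; apply: dvdXM; [exact: low Ha|exact: low Hb|exact: low Hb|exact: low Ha].
have H3 : dvdX 1 (a' * b' - 1).
  have -> : a' * b' - 1 = (a' - 1) * b' + (b' - 1) by rewrite mulrBl mul1r addrA subrK.
  by apply: dvdXD => //; exact: dvdX_Mr.
have -> : a * b * (a' * b') - 1 - (x * y - y * x)%:P * 'X^(k + l) =
  (a * b - b * a) * (a' * b' - 1) + (a * b - b * a - (x * y - y * x)%:P * 'X^(k + l))
  + b * (a * a' - 1) * b' + (b * b' - 1).
  have G (u v w t e : {poly A}) : u + (v - t) + w + (e - 1) = u + v + w + e - 1 - t.
    rewrite !addrA [RHS]addrAC; congr (_ - _); rewrite [RHS]addrAC; congr (_ + _).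
    by rewrite [RHS]addrAC.
  rewrite G; congr (_ - 1 - _); rewrite [_ * (_ - 1)]mulrBr mulr1 subrK.
  have -> : b * (a * a' - 1) * b' = b * a * (a' * b') - b * b'.
    by rewrite mulrBr mulr1 mulrBl !mulrA.
  by rewrite mulrBl addrA !subrK.
apply: dvdXD; last exact: dvdX_le Hbb.
apply: dvdXD; last by apply: dvdX_Mr; apply: dvdX_Ml; exact: dvdX_le Haa.
by apply: dvdXD => //; rewrite -addn1; exact: dvdXM.
Qed.

End PolynomialCongruence.

(** * Flows for positive and negative times *)

Section TwoSidedFlow.
Variables (R : realType) (d : nat).

Lemma quadratic_is_derive (g : R -> 'rV[R]_d) (s : R) v (K dl : R) : 0 < dl ->
  (forall h : R, `|h| < dl -> `|g (h + s) - g s - h *: v| <= K * h ^+ 2) ->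
  is_derive s (1 : R) g v.
Proof.
move=> dl0 H.
have C : (fun h : R => h^-1 *: ((g \o shift s) (h *: (1 : R)) - g s)) @ 0^' --> v.
  apply/cvgrPdist_le => e e0; near=> h.
  have h0 : h != 0 by near: h; exact: nbhs_dnbhs_neq.
  have hd : `|h| < dl.
    near: h; apply: nbhs_dnbhs; exists dl => //= x; by rewrite /ball_/= sub0r normrN.
  have he : `|h| < e / (`|K| + 1).
    near: h; apply: nbhs_dnbhs; exists (e / (`|K| + 1)) => //=.
      by rewrite divr_gt0// ltr_wpDl.
    by move=> x; rewrite /ball_/= sub0r normrN.
  have -> : v - h^-1 *: ((g \o shift s) (h *: (1 : R)) - g s) =
      - (h^-1 *: (g (h + s) - g s - h *: v)).
    rewrite /= [h *: (1 : R)]mulr1; set u := g (h + s) - g s.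
    by rewrite [in RHS]scalerBr [in RHS]scalerA mulVf// scale1r opprB.
  rewrite normrN normrZ normfV ler_pdivrMl ?normr_gt0//.
  apply: (le_trans (H h hd)); rewrite -real_normK ?num_real// expr2.
  have K1 : 0 < `|K| + 1 by rewrite ltr_wpDl.
  have := he; rewrite ltr_pdivlMr// => /ltW he'.
  have h0' : 0 <= `|h| by [].
  have := ler_wpM2l h0' he'; have := ler_norm K.
  have : 0 <= `|h| * `|h| by rewrite mulr_ge0.
  by nra.
by apply: DeriveDef; [apply/cvg_ex; eexists; exact: C|exact: cvg_lim].
Unshelve. all: by end_near. Qed.

Definition flow_estimate (X : 'rV[R]_d -> 'rV[R]_d) (M K : R) (g : R -> 'rV[R]_d) : Prop :=
  forall s t : R, 0 <= s -> s <= t ->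
   [/\ `|g t - g s| <= M * (t - s),
       `|g t - g s - (t - s) *: X (g s)| <= K * (t - s) ^+ 2 &
       `|g t - g s - (t - s) *: X (g t)| <= K * (t - s) ^+ 2].

(** Forward integral curves of [X] and of [- X] are glued at time 0. The derivative at each time
    follows from quadratic estimates, based at the start or at the end of the increment according to
    its sign. *)
Lemma two_sided_flow_exists (X : 'rV[R]_d -> 'rV[R]_d) (M Lam : R) w : 0 <= M -> 0 <= Lam ->
  (forall x, `|X x| <= M) -> (forall x y, `|X x - X y| <= Lam * `|x - y|) ->
  exists g : R -> 'rV[R]_d, [/\ g 0 = w,
    forall s : R, is_derive s (1 : R) g (X (g s)),
    flow_estimate X M (Lam * M) g &
    flow_estimate (fun x => - X x) M (Lam * M) (fun s => g (- s))].
Proof.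
move=> M0 Lam0 XM XL.
have [g [g0 Hg]] := flow_exists M0 Lam0 XM XL w.
have [h [h0 Hh]] : exists h : R -> 'rV[R]_d, h 0 = w /\ flow_estimate (fun x => - X x) M (Lam * M) h.
  apply: (flow_exists M0 Lam0) => x; first by rewrite normrN.
  by move=> y; rewrite -opprD normrN XL.
pose G (s : R) := if 0 <= s then g s else h (- s).
have Gp s : 0 <= s -> G s = g s by rewrite /G => ->.
have Gn s : s <= 0 -> G s = h (- s).
  by rewrite le_eqVlt => /predU1P[->|s0]; rewrite /G ?lexx ?oppr0 ?g0 ?h0// leNgt s0.
have Hp : flow_estimate X M (Lam * M) G.
  by move=> s t s0 st; rewrite !Gp ?(le_trans s0)//; exact: Hg.
have Hn : flow_estimate (fun x => - X x) M (Lam * M) (fun s => G (- s)).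
  move=> s t s0 st; rewrite !Gn ?oppr_le0 ?(le_trans s0)// !opprK; exact: Hh.
exists G; split=> //; first by rewrite Gp.
move=> s; set v := X (G s).
have fwd (r k : R) : 0 <= k -> 0 <= r -> `|G (k + r) - G r - k *: X (G r)| <= Lam * M * k ^+ 2.
  move=> k0 r0; have := Hp r (k + r) r0; rewrite lerDr => /(_ k0) [_ + _].
  by rewrite addrK.
have bwd (r k : R) : k <= 0 -> 0 <= k + r -> `|G (k + r) - G r - k *: X (G r)| <= Lam * M * k ^+ 2.
  move=> k0 r0; have := Hp (k + r) r r0; rewrite gerDr => /(_ k0) [_ _].
  rewrite (_ : r - (k + r) = - k); last by ring.
  by rewrite sqrrN scaleNr -normrN !opprD !opprK (addrC (- G r)).
have nfwd (r k : R) : k <= 0 -> r <= 0 -> `|G (k + r) - G r - k *: X (G r)| <= Lam * M * k ^+ 2.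
  move=> k0 r0; have := Hn (- r) (- (k + r)); rewrite oppr_ge0 => /(_ r0).
  rewrite lerN2 gerDr => /(_ k0) [_ + _].
  rewrite (_ : - (k + r) - - r = - k); last by ring.
  by rewrite !opprK sqrrN scaleNr scalerN opprK.
have nbwd (r k : R) : 0 <= k -> k + r <= 0 -> `|G (k + r) - G r - k *: X (G r)| <= Lam * M * k ^+ 2.
  move=> k0 r0; have := Hn (- (k + r)) (- r); rewrite oppr_ge0 => /(_ r0).
  rewrite lerN2 lerDr => /(_ k0) [_ _].
  rewrite (_ : - r - - (k + r) = k); last by ring.
  by rewrite !opprK scalerN -normrN !opprD !opprK (addrC (- G r)).
have [s0|s0|s0] := ltrgt0P s.
- apply: (quadratic_is_derive s0) => k ks.
  have [k0|k0] := leP 0 k; first by apply: fwd => //; exact: ltW.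
  apply: bwd; first exact: ltW.
  by move: ks; rewrite ltr0_norm// -subr_gt0 opprK addrC => /ltW.
- have s0' : 0 < - s by rewrite oppr_gt0.
  apply: (quadratic_is_derive s0') => k ks.
  have [k0|k0] := leP k 0; first by apply: nfwd => //; exact: ltW.
  apply: nbwd; first exact: ltW.
  by move: ks; rewrite gtr0_norm// -subr_gt0 -oppr_lt0 opprB opprK => /ltW.
- apply: (quadratic_is_derive (ltr01 : 0 < 1)) => k _.
  have [k0|k0] := leP 0 k; first by apply: fwd; rewrite // s0.
  by apply: nfwd; rewrite ?s0// ltW.
Qed.

End TwoSidedFlow.

(** * Taylor expansions of flows as truncated exponentials of operators *)

Section Expansions.
Variables (R : realType) (d : nat).
Notation "'e_ i" := (delta_mx 0 i) (at level 8, i at level 2, format "''e_' i").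
Notation "'d_ i g" := (fun x => 'D_('e_i) g x) (at level 8, i at level 2, g at level 9).
Notation op := (op R d).
Notation sfun := (sfun R d).

(* [g(M_s w) = \sum_n s^n (p_n g)(w)] up to order N, for all test functions [g]. *)
Definition expands (N : nat) (M : R -> 'rV[R]_d -> 'rV[R]_d) (p : {poly op}) : Prop :=
  forall n, (n <= N)%N -> forall g : sfun, exists C : R, forall (s : R) w, 0 <= s <= 1 ->
    `|g (M s w) - \sum_(i < n.+1) s ^+ i * (p`_i g) w| <= C * s ^+ n.+1.

Lemma triangular_sum (a : nat -> nat -> R) (s : R) n :
  \sum_(i < n.+1) s ^+ i * (\sum_(k < (n - i).+1) s ^+ k * a k i) =
  \sum_(j < n.+1) s ^+ j * \sum_(i < j.+1) a (j - i)%N i.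
Proof.
elim: n => [|n IH]; first by rewrite !(big_ord_recr, big_ord0)/= !add0r expr0 !mul1r.
rewrite [RHS]big_ord_recr/= -IH big_ord_recr/= subnn big_ord1 expr0 mul1r.
rewrite [X in _ = _ + _ * X]big_ord_recr/= subnn mulrDr addrA; congr (_ + _).
rewrite mulr_sumr -big_split/=; apply: eq_bigr => i _.
have il : (i <= n)%N by rewrite -ltnS.
rewrite (subSn il) big_ord_recr/= mulrDr; congr (_ + _).
by rewrite mulrA -exprD addnS subnKC.
Qed.

Lemma expands_comp N M M' p q : expands N M p -> expands N M' q ->
  (expands N (fun s w => M' s (M s w)) (p * q)).
Proof.
move=> Hp Hq n nN g.
have [C HC] := Hq n nN g.
have ex (i : 'I_n.+1) : exists C : R, forall (s : R) w, 0 <= s <= 1 ->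
    `|(q`_i g) (M s w) - \sum_(k < (n - i).+1) s ^+ k * (p`_k (q`_i g)) w| <= C * s ^+ (n - i).+1.
  by apply: Hp; rewrite (leq_trans (leq_subr _ _)).
have {ex}[c Hc] := choice ex.
exists (C + \sum_i c i) => s w s01.
have -> : \sum_(i < n.+1) s ^+ i * ((p * q)`_i g) w =
    \sum_(i < n.+1) s ^+ i * (\sum_(k < (n - i).+1) s ^+ k * (p`_k (q`_i g)) w).
  rewrite (triangular_sum (fun k i => (p`_k (q`_i g)) w)); apply: eq_bigr => j _.
  by rewrite coefMr op_sumE.
rewrite -(subrKA (\sum_(i < n.+1) s ^+ i * (q`_i g) (M s w))) (le_trans (ler_normD _ _))//.
rewrite mulrDl lerD//; first exact: HC.
rewrite -sumrB mulr_suml (le_trans (ler_norm_sum _ _ _))//; apply: ler_sum => i _.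
have s0 : 0 <= s by have /andP[] := s01.
rewrite -mulrBr normrM ger0_norm ?exprn_ge0// mulrC.
have -> : c i * s ^+ n.+1 = c i * s ^+ (n - i).+1 * s ^+ i.
  have il : (i <= n)%N by rewrite -ltnS.
  by rewrite -mulrA -exprD addSn subnK.
by rewrite ler_wpM2r ?exprn_ge0// Hc.
Qed.

Variables (X : 'rV[R]_d -> 'rV[R]_d) (HX : vfield X).

(** By induction on the order: the derivative of the remainder for [g] is the remainder for
    [op_lie HX g]. The constant is uniform over all integral curves because Lie derivatives of test
    functions are periodic, hence bounded. *)
Lemma flow_taylor n : forall g : sfun, exists C : R, forall (c : R -> 'rV[R]_d),
  (forall s : R, is_derive s (1 : R) c (X (c s))) -> forall s : R,
  `|g (c s) - \sum_(i < n.+1) s ^+ i * ((i`!)%:R^-1 * ((op_lie HX ^+ i) g) (c 0))| <= C * `|s| ^+ n.+1.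
Proof.
have dg (g : sfun) c (s : R) : (forall s : R, is_derive s (1 : R) c (X (c s))) ->
    is_derive s (1 : R) (fun s => g (c s)) ((op_lie HX g) (c s)).
  move=> Hc; rewrite op_lieE; apply: derive_comp_curve => //.
  by have [H _] := sfun_regular g.
elim: n => [|n IH] g.
  have [B B0 HB] : exists2 B : R, 0 <= B & forall x, `|op_lie HX g x| <= B.
    have [g1 g2] := sfun_regular g; apply: periodic_bounded.
      by have [h1 _] := sfun_regular (op_lie HX g); exact: Sm_cts (h1 0%N).
    move=> x k ik; rewrite !op_lieE; apply: eq_bigr => i _.
    by rewrite (g2 i x k ik); have [_ ->] := HX i.
  exists B => c Hc s.
  have [x _ E] := mvt_any 0 s (fun x => dg g c x Hc).
  by rewrite big_ord1 expr0 mul1r fact0 invr1 mul1r expr0 op1E E subr0 normrM expr1 ler_wpM2r.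
have [C HC] := IH (op_lie HX g).
exists C => c Hc s.
pose a i := (i`!)%:R^-1 * ((op_lie HX ^+ i) g) (c 0).
pose phi (s : R) := g (c s) - \sum_(i < n.+2) s ^+ i * a i.
pose psi (s : R) := op_lie HX g (c s) - \sum_(i < n.+1) s ^+ i * ((i`!)%:R^-1 * ((op_lie HX ^+ i) (op_lie HX g)) (c 0)).
have dphi (x : R) : is_derive x (1 : R) phi (psi x).
  have ds : is_derive x (1 : R) (fun s => \sum_(i < n.+2) s ^+ i * a i)
     (\sum_(i < n.+1) x ^+ i * ((i`!)%:R^-1 * ((op_lie HX ^+ i) (op_lie HX g)) (c 0))).
    have -> : (fun s : R => \sum_(i < n.+2) s ^+ i * a i) = \sum_(i < n.+2) (a i \*: (@GRing.exp R^~ i)).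
      by apply/funext => t; rewrite fct_sumE; apply: eq_bigr => i _; rewrite mulrC.
    have -> : \sum_(i < n.+1) x ^+ i * ((i`!)%:R^-1 * ((op_lie HX ^+ i) (op_lie HX g)) (c 0)) =
        \sum_(i < n.+2) a i *: (i%:R * x ^+ i.-1 : R).
      rewrite [RHS]big_ord_recl/= mul0r scaler0 add0r; apply: eq_bigr => i _.
      rewrite /a /= /bump/= add1n exprSr opME factS natrM invfM /GRing.scale/=.
      have N0 : i.+1%:R != 0 :> R by [].
      move: (i.+1%:R) N0 (_^-1) (x ^+ i) (_ (c 0)) => N N0 F y z.
      by field.
    apply: is_derive_sum => i; apply: is_deriveZ.
    have := @is_deriveX R R (id : R -> R) i x 1 1 (is_derive_id _ _).
    by rewrite exprfctE /GRing.scale/= mulr1.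
  exact: (is_deriveB (dg g c x Hc) ds).
have [x xs E] := mvt_any 0 s dphi.
have phi0 : phi 0 = 0.
  rewrite /phi big_ord_recl big1 => [|i _]; last by rewrite /= /bump/= expr0n mul0r.
  by rewrite addr0 expr0 mul1r /a fact0 invr1 mul1r expr0 op1E subrr.
have -> : g (c s) - \sum_(i < n.+2) s ^+ i * ((i`!)%:R^-1 * ((op_lie HX ^+ i) g) (c 0)) = phi s - phi 0.
  by rewrite phi0 subr0.
rewrite E subr0 normrM exprSr mulrA ler_wpM2r//.
apply: (le_trans (HC c Hc x)); move: xs; rewrite !subr0 => xs.
have C0 : 0 <= C by have := le_trans (normr_ge0 _) (HC c Hc 1); rewrite normr1 expr1n mulr1.
by rewrite ler_wpM2l// ler_pXn2r// nnegrE.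
Qed.

(** The exponential series of [a] times the Lie derivative, truncated after degree [N]. *)
Definition exp_poly (N : nat) (a : R) : {poly op} :=
  \poly_(i < N.+1) (op_scale d (a ^+ i / (i`!)%:R) * op_lie HX ^+ i).

Lemma exp_poly_expands N (a : R) (c : 'rV[R]_d -> R -> 'rV[R]_d) : `|a| = 1 ->
  (forall w, c w 0 = w) -> (forall w (s : R), is_derive s (1 : R) (c w) (X (c w s))) ->
  expands N (fun s w => c w (a * s)) (exp_poly N a).
Proof.
move=> a1 c0 Hc n nN g.
have [C HC] := flow_taylor n g.
exists C => s w /andP[s0 _].
have := HC (c w) (Hc w) (a * s); rewrite normrM a1 mul1r (ger0_norm s0) c0.
congr (`|_ - _| <= _); apply: eq_bigr => i _.
have il : (i <= n)%N by rewrite -ltnS.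
rewrite coef_poly ltnS (leq_trans il nN) opME op_scaleE exprMn.
by rewrite -!mulrA mulrCA.
Qed.

Lemma op_scale_sum n (a : 'I_n -> R) : op_scale d (\sum_i a i) = \sum_i op_scale d (a i).
Proof.
by apply: op_eq => g; apply: sfun_eq => x; rewrite op_sumE op_scaleE mulr_suml.
Qed.

Lemma op_scaleM (a b : R) : op_scale d a * op_scale d b = op_scale d (a * b).
Proof. by apply: op_eq => g; apply: sfun_eq => x; rewrite opME !op_scaleE mulrA. Qed.

Lemma op_lieX_scale i (a : R) : op_lie HX ^+ i * op_scale d a = op_scale d a * op_lie HX ^+ i.
Proof. by apply: commr_sym; apply: commrX; apply: commr_sym; exact: op_lie_scale. Qed.

(** The binomial formula gives the coefficients [(a + b)^n / n!], since scalars commute with the Lie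
    derivative. *)
Lemma exp_polyM N (a b : R) : a + b = 0 -> dvdX N.+1 (exp_poly N a * exp_poly N b - 1).
Proof.
move=> ab; apply: dvdX_coef => n nN.
rewrite coefB coefM coef1.
have -> : \sum_(j < n.+1) (exp_poly N a)`_j * (exp_poly N b)`_(n - j) =
   op_scale d (\sum_(j < n.+1) (a ^+ j / (j`!)%:R) * (b ^+ (n - j) / ((n - j)`!)%:R)) * op_lie HX ^+ n.
  rewrite op_scale_sum mulr_suml; apply: eq_bigr => j _.
  have jn : (j <= n)%N by rewrite -ltnS.
  rewrite !coef_poly (leq_ltn_trans jn nN) (leq_ltn_trans (leq_subr _ _) nN).
  have G (p q r t : op) : q * r = r * q -> p * q * (r * t) = p * r * (q * t).
    by move=> qr; rewrite -!mulrA (mulrA q) qr !mulrA.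
  rewrite (G _ _ _ _ (op_lieX_scale _ _)) op_scaleM -exprD subnKC//.
have -> : \sum_(j < n.+1) (a ^+ j / (j`!)%:R) * (b ^+ (n - j) / ((n - j)`!)%:R) =
   (b + a) ^+ n / (n`!)%:R.
  rewrite exprDn mulr_suml; apply: eq_bigr => j _.
  have jn : (j <= n)%N by rewrite -ltnS.
  rewrite -(bin_fact jn) !natrM -mulr_natr; field.
  by rewrite !pnatr_eq0 -!lt0n !fact_gt0 bin_gt0 jn.
rewrite (addrC b) ab expr0n; case: n {nN} => [|n] /=.
  rewrite fact0 invr1 !mulr1 (_ : op_scale d 1 = 1) ?subrr//.
  by apply: op_eq => g; apply: sfun_eq => x; rewrite op_scaleE mul1r.
rewrite mul0r subr0 (_ : op_scale d 0 = 0) ?mul0r//.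
by apply: op_eq => g; apply: sfun_eq => x; rewrite op_scaleE mul0r.
Qed.

Lemma exp_poly_lead N (a : R) : (0 < N)%N ->
  dvdX 2 (exp_poly N a - 1 - (op_scale d a * op_lie HX)%:P * 'X^1).
Proof.
move=> N0; apply: dvdX_coef => -[|[|//]] _.
  rewrite !coefB coef1 coefMXn coef_poly/= fact0 invr1 !mulr1 subr0.
  rewrite (_ : op_scale d 1 = 1) ?subrr//.
  by apply: op_eq => g; apply: sfun_eq => x; rewrite op_scaleE mul1r.
rewrite !coefB coef1 coefMXn coef_poly/= ltnS N0 subr0 coefC/=.
by rewrite invr1 !mulr1 subrr.
Qed.

End Expansions.

(** * Displacements along iterated brackets by group commutators of flows *)

Section BracketMoves.
Variables (R : realType) (d m : nat) (f : 'I_m -> 'rV[R]_d -> 'rV[R]_d).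
Variables (L : 'rV[R]_d -> 'rV[R]_m -> R) (c : R) (D : bounds f L c).
Notation C0 := (bC0 D).
Notation op := (op R d).

Lemma FappN x u : Fapp f x (- u) = - Fapp f x u.
Proof. by rewrite -(scaleN1r u) FappZ scaleN1r. Qed.

(** Both directions are carried along because the closing argument departs from one point of the
    limit curve and arrives at another. *)
Definition two_way (tau : R) (y z : 'rV[R]_d) : Prop :=
  path_to D tau y z (C0 * tau) /\ path_to D tau z y (C0 * tau).

Lemma two_way_sym tau y z : two_way tau y z -> two_way tau z y.
Proof. by case. Qed.

Lemma two_way_trans (t1 t2 : R) y z w : 0 <= t1 -> 0 <= t2 ->
  two_way t1 y z -> two_way t2 z w -> two_way (t1 + t2) y w.
Proof.
move=> t10 t20 [H1 H2] [H3 H4]; split.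
  by rewrite mulrDr; exact: path_cat H1 H3.
by rewrite (addrC t1) mulrDr; exact: path_cat H4 H2.
Qed.

Lemma two_way_le (t1 t2 : R) y z : 0 <= t1 -> t1 <= t2 -> two_way t1 y z -> two_way t2 y z.
Proof.
move=> t10 t12 H; rewrite -(subrKC t1 t2); apply: two_way_trans H _ => //; first by rewrite subr_ge0.
by split; exact: path_wait.
Qed.

Lemma norm_delta_le1 n j : `|delta_mx 0 j : 'rV[R]_n| <= 1.
Proof.
apply: norm_le_coord => // i; rewrite mxE.
by case: (_ && _); rewrite ?normr1 ?normr0.
Qed.

(** Backwards, the curve follows the control [- v], and the estimate based at the end point becomes
    the one based at the starting point. *)
Lemma flow_two_way (v : 'rV[R]_m) (g : R -> 'rV[R]_d) (t : R) : `|v| <= 1 -> 0 <= t ->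
  flow_estimate (fun x => Fapp f x v) (bB D) (bLF D * bB D) g -> two_way t (g 0) (g t).
Proof.
move=> v1 t0 H.
have K1 := bK1 D; have B0 := bB0 D; have LF0 := bLF0 D.
have vK (u : 'rV[R]_m) : `|u| <= 1 -> `|u| <= bK D by move=> u1; exact: le_trans K1.
have BK : bB D <= bB D * bK D by rewrite ler_peMr.
have LC : bLF D * bB D <= bC D.
  apply: le_trans (bC_F D); rewrite (le_trans (ler_wpM2l LF0 BK))// ler_peMr//.
  by rewrite mulr_ge0// bBK0.
have mk (tau : R) y y' (u : 'rV[R]_m) : 0 <= tau -> `|u| <= 1 -> `|y' - y| <= bB D * tau ->
    `|y' - y - tau *: Fapp f y u| <= bLF D * bB D * tau ^+ 2 -> step D tau y y' (C0 * tau).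
  move=> tau0 u1 H1 H2; split.
  - by rewrite (le_trans H1)// ler_wpM2r.
  - by rewrite ler_wpM2r// (le_trans (bLlow D y u))// bLup// vK.
  exists u; split; first exact: vK.
    by rewrite (le_trans H2)// ler_wpM2r// sqr_ge0.
  rewrite lerBlDr (mulrC C0) -[leLHS]addr0 lerD ?mulr_ge0 ?bC_ge0 ?sqr_ge0//.
  by rewrite ler_wpM2l// bLup// vK.
split.
  exists g, (fun s => C0 * s); split => //; last by rewrite mulr0 subr0.
  move=> s r s0 sr rt; rewrite -mulrBr.
  by have [H1 H2 _] := H s r s0 sr; apply: (mk _ _ _ v); rewrite ?subr_ge0.
exists (fun s => g (t - s)), (fun s => C0 * s); split; rewrite ?subr0 ?subrr//; last by rewrite mulr0 subr0.
move=> s r s0 sr rt; rewrite -mulrBr.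
have := H (t - r) (t - s); rewrite subr_ge0 lerD2l lerN2 => /(_ rt sr).
rewrite (_ : t - s - (t - r) = r - s); last by ring.
move=> [H1 _ H2]; apply: (mk _ _ _ (- v)); rewrite ?subr_ge0 ?normrN//; first by rewrite distrC.
rewrite FappN scalerN -normrN !opprD !opprK.
by move: H2; rewrite (addrC (g (t - s))).
Qed.

Lemma f_vfield j : vfield (f j).
Proof. by move=> i; split=> [k|]; [exact: (f_Sm (bHF D))|exact: (f_periodic (bHF D))]. Qed.

(** The maps [M] and [M'] are inverse to each other only formally, up to order [N]; this is all that
    the commutator computation uses. They displace points by plus and minus [s ^+ k] along [X], to
    leading order, in time [b * s]. *)
Definition moves (N k : nat) (X : 'rV[R]_d -> 'rV[R]_d) : Prop :=
  exists (HX : vfield X) (M M' : R -> 'rV[R]_d -> 'rV[R]_d) (p p' : {poly op}) (b : R),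
  [/\ 0 <= b,
   forall (s : R) w, 0 <= s <= 1 -> two_way (b * s) w (M s w) /\ two_way (b * s) w (M' s w),
   expands N M p /\ expands N M' p',
   dvdX N.+1 (p * p' - 1) /\ dvdX N.+1 (p' * p - 1) &
   dvdX k.+1 (p - 1 - (op_lie HX)%:P * 'X^k) /\
   dvdX k.+1 (p' - 1 - (- op_lie HX)%:P * 'X^k)].

Lemma moves_base N j : (0 < N)%N -> moves N 1 (f j).
Proof.
move=> N0.
have fB x : `|f j x| <= bB D.
  by rewrite -(Fapp_delta f) (le_trans (bFapp D _ _))// ler_piMr ?bB0// norm_delta_le1.
have fL x y : `|f j x - f j y| <= bLF D * `|x - y|.
  rewrite -!(Fapp_delta f) (le_trans (bFlip D _ _ _))// ler_piMr ?norm_delta_le1//.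
  by rewrite mulr_ge0// bLF0.
have [g Hg] := choice (fun w => two_sided_flow_exists w (bB0 D) (bLF0 D) fB fL).
exists (f_vfield j), (fun s w => g w (1 * s)), (fun s w => g w (- 1 * s)).
exists (exp_poly (f_vfield j) N 1), (exp_poly (f_vfield j) N (- 1)), 1.
have g0 w : g w 0 = w by have [] := Hg w.
have gD w (s : R) : is_derive s (1 : R) (g w) (f j (g w s)) by have [_ + _ _] := Hg w.
split=> //.
- move=> s w /andP[s0 _]; have [_ _ H1 H2] := Hg w; rewrite !mul1r mulN1r; split.
    rewrite -{1}(g0 w); apply: (@flow_two_way (delta_mx 0 j)); rewrite ?norm_delta_le1//.
    by move: H1; congr flow_estimate; apply/funext => x; rewrite Fapp_delta.
  have -> : g w (- s) = (fun s => g w (- s)) s by [].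
  rewrite -{1}(g0 w) -{1}oppr0.
  apply: (@flow_two_way (- delta_mx 0 j) (fun s => g w (- s))); rewrite ?normrN ?norm_delta_le1//.
  move: H2; congr flow_estimate; apply/funext => x.
  by rewrite FappN Fapp_delta.
- by split; apply: exp_poly_expands => //; rewrite ?normrN normr1.
- by split; apply: exp_polyM; rewrite ?subrr ?addNr.
split.
  have := exp_poly_lead (f_vfield j) 1 N0; rewrite (_ : op_scale d 1 = 1) ?mul1r//.
  by apply: op_eq => h; apply: sfun_eq => x; rewrite op_scaleE mul1r.
have := exp_poly_lead (f_vfield j) (-1) N0; rewrite (_ : op_scale d (- 1) = - 1) ?mulN1r//.
by apply: op_eq => h; apply: sfun_eq => x; rewrite op_scaleE opNE sfunNE mulN1r.
Qed.

(** Running [M], [Q], [M'], [Q'] in turn realizes the bracket by [dvdX_commutator]. Its formal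
    inverse is [Q], [M], [Q'], [M'], whose leading term has the opposite sign. *)
Lemma moves_bracket N k l X Y : (0 < k)%N -> (0 < l)%N -> (k + l <= N)%N ->
  moves N k X -> moves N l Y -> moves N (k + l) (lie_bracket X Y).
Proof.
move=> k0 l0 klN [HX [M [M' [p [p' [b [b0 tM [eM eM'] [pp p'p] [lp lp']]]]]]]].
move=> [HY [Q [Q' [q [q' [e [e0 tQ [eQ eQ'] [qq q'q] [lq lq']]]]]]]].
pose HXY := vfield_bracket HX HY.
exists HXY, (fun s w => Q' s (M' s (Q s (M s w)))), (fun s w => M' s (Q' s (M s (Q s w)))).
exists (p * q * (p' * q')), (q * p * (q' * p')), (b + e + (b + e)).
have low n z (r : {poly op}) : (0 < n)%N -> dvdX n.+1 (r - 1 - z%:P * 'X^n) -> dvdX 1 (r - 1).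
  move=> n0 H; rewrite -(subrK (z%:P * 'X^n) (r - 1)); apply: dvdXD.
    by apply: dvdX_le H.
  by apply: (dvdX_le n0); exists z%:P.
have twos (s u v : R) x y z : 0 <= s <= 1 -> 0 <= u -> 0 <= v -> two_way (u * s) x y -> two_way (v * s) y z ->
    two_way ((u + v) * s) x z.
  by move=> /andP[s0 _] u0 v0 H1 H2; rewrite mulrDl; apply: two_way_trans H1 H2; exact: mulr_ge0.
have be0 : 0 <= b + e by exact: addr_ge0.
split.
- by rewrite addr_ge0.
- move=> s w s01; split.
    apply: (twos s (b + e) (b + e) _ (Q s (M s w))) => //.
      by apply: (twos s b e _ (M s w)) => //; [case: (tM s w s01)|case: (tQ s (M s w) s01)].
    by apply: (twos s b e _ (M' s (Q s (M s w)))) => //; [case: (tM s (Q s (M s w)) s01)|case: (tQ s (M' s (Q s (M s w))) s01)].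
  apply: (twos s (b + e) (b + e) _ (M s (Q s w))) => //; rewrite (addrC b).
    by apply: (twos s e b _ (Q s w)) => //; [case: (tQ s w s01)|case: (tM s (Q s w) s01)].
  by apply: (twos s e b _ (Q' s (M s (Q s w)))) => //; [case: (tQ s (M s (Q s w)) s01)|case: (tM s (Q' s (M s (Q s w))) s01)].
- split.
    exact: (expands_comp (expands_comp eM eQ) (expands_comp eM' eQ')).
  exact: (expands_comp (expands_comp eQ eM) (expands_comp eQ' eM')).
- have I (a a' r r' : {poly op}) : dvdX N.+1 (a * a' - 1) -> dvdX N.+1 (a' * a - 1) ->
     dvdX N.+1 (r * r' - 1) -> dvdX N.+1 (r' * r - 1) ->
     dvdX N.+1 (a * r * (a' * r') * (r * a * (r' * a')) - 1).
    move=> h1 h2 h3 h4.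
    rewrite -(mulrA (a * r)) (_ : a' * r' * (r * a * (r' * a')) = (a' * r') * (r * a) * (r' * a')); last by rewrite !mulrA.
    rewrite mulrA; rewrite (_ : a * r * (a' * r' * (r * a)) * (r' * a') - 1 =
      (a * r) * (a' * r' * (r * a) - 1) * (r' * a') + (a * r * (r' * a') - 1)); last first.
      by rewrite [in RHS]mulrBr mulr1 [in RHS]mulrBl addrA subrK.
    apply: dvdXD; last exact: dvdX_inv.
    by apply: dvdX_Mr; apply: dvdX_Ml; exact: dvdX_inv.
  by split; apply: I.
have Hb : op_lie HX * op_lie HY - op_lie HY * op_lie HX = op_lie HXY by exact: op_lie_bracket.
split.
  rewrite -Hb; apply: (dvdX_commutator klN k0 l0 lp lq _ _ pp qq); [exact: low k0 lp'|exact: low l0 lq'].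
rewrite -Hb opprB addnC; rewrite addnC in klN.
by apply: (dvdX_commutator klN l0 k0 lq lp _ _ qq pp); [exact: low l0 lq'|exact: low k0 lp'].
Qed.

(** The order [N] stays free in the induction: a bracket of degree [k + l] needs both factors
    expanded to the order of the whole. *)
Lemma bracket_moves X : iter_bracket f X ->
  exists2 k, (0 < k)%N & forall N, (k <= N)%N -> moves N k X.
Proof.
elim=> [j|g h _ [k k0 Hk] _ [l l0 Hl]]; first by exists 1%N => // N N0; exact: moves_base.
exists (k + l)%N; first by rewrite addn_gt0 k0.
move=> N klN; apply: moves_bracket => //.
  by apply: Hk; rewrite (leq_trans _ klN)// leq_addr.
by apply: Hl; rewrite (leq_trans _ klN)// leq_addl.
Qed.

(** The expansion is tested on the coordinate functions, where only the coefficients 1 in degree 0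
    and [T] in degree [k] contribute. *)
Lemma expands_displacement k M (p : {poly op}) (Y : 'rV[R]_d -> 'rV[R]_d) (T : op) : (0 < k)%N ->
  expands k M p -> dvdX k.+1 (p - 1 - T%:P * 'X^k) ->
  (forall j x, T (mk_sfun (regular_coord R j)) x = Y x 0 j) ->
  exists2 C : R, 0 <= C & forall (s : R) w, 0 <= s <= 1 -> `|M s w - w - s ^+ k *: Y w| <= C * s ^+ k.+1.
Proof.
move=> k0 eM lp TY.
have coefp i : (i < k.+1)%N -> p`_i = (i == 0%N)%:R + T * (i == k)%:R.
  move=> ik; have := coef_dvdX lp ik.
  by rewrite !coefB coef1 coefCM coefXn => /eqP; rewrite subr_eq0 subr_eq addrC => /eqP.
have p0 : p`_0 = 1 by rewrite coefp// eqxx eq_sym gtn_eqF// mulr0 addr0.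
have pk : p`_k = T by rewrite coefp// eqxx gtn_eqF// add0r mulr1.
have pi i : (0 < i < k)%N -> p`_i = 0.
  by move=> /andP[i0 ik]; rewrite coefp ?ltnS 1?ltnW// gtn_eqF// ltn_eqF// mulr0 addr0.
have ex (j : 'I_d) : exists C : R, forall (s : R) w, 0 <= s <= 1 ->
    `|(M s w - w - s ^+ k *: Y w) 0 j| <= C * s ^+ k.+1.
  have [C HC] := eM k (leqnn _) (mk_sfun (regular_coord R j)).
  exists C => s w s01; have := HC s w s01; congr (_ <= _); congr `|_|.
  rewrite !mxE big_ord_recl expr0 mul1r p0 op1E.
  case: k k0 {eM lp HC coefp} pk pi => // k _ pk pi.
  rewrite big_ord_recr/= big1 => [|i _]; last first.
    by rewrite pi ?mulr0// /bump/= add1n ltnS.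
  by rewrite /bump/= add1n pk add0r TY opprD addrA.
have [C HC] := choice ex.
exists (\sum_j `|C j|) => [|s w s01]; first by apply: sumr_ge0.
have s0 : 0 <= s by have /andP[] := s01.
apply: norm_le_coord => [|j]; first by rewrite mulr_ge0 ?exprn_ge0 ?sumr_ge0.
apply: (le_trans (HC j s w s01)); rewrite ler_wpM2r ?exprn_ge0//.
by rewrite (le_trans (ler_norm _))// (bigD1 j)//= lerDl sumr_ge0.
Qed.

Lemma bracket_displacement X : iter_bracket f X ->
  vfield X /\ exists (k : nat) (b C : R), [/\ (0 < k)%N, 0 <= b, 0 <= C &
  forall (e : bool) (s : R) w, 0 <= s <= 1 -> exists2 w', two_way (b * s) w w' &
    `|w' - w - s ^+ k *: ((-1) ^+ e *: X w)| <= C * s ^+ k.+1].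
Proof.
move=> HX; have [k k0 Hk] := bracket_moves HX.
have [vX [M [M' [p [p' [b [b0 tM [eM eM'] _ [lp lp']]]]]]]] := Hk k (leqnn _).
split=> //.
have TX j x : op_lie vX (mk_sfun (regular_coord R j)) x = X x 0 j.
  rewrite op_lieE /= (bigD1 j)//= big1 ?addr0 => [|i ij].
    by rewrite (@derive_val _ _ _ _ _ _ _ (is_derive_coord j j x)) eqxx mulr1.
  by rewrite (@derive_val _ _ _ _ _ _ _ (is_derive_coord i j x)) (negbTE ij) mulr0.
have [C C0 HC] := expands_displacement k0 eM lp TX.
have TX' j x : (- op_lie vX) (mk_sfun (regular_coord R j)) x = (- X x) 0 j.
  by rewrite opNE sfunNE TX mxE.
have [C' C0' HC'] := expands_displacement k0 eM' lp' TX'.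
exists k, b, (C + C'); split=> //; first exact: addr_ge0.
move=> e s w s01; have [t1 t2] := tM s w s01.
have sk : 0 <= s ^+ k.+1 by have /andP[s0 _] := s01; rewrite exprn_ge0.
case: e; [exists (M' s w)|exists (M s w)] => //.
  rewrite expr1 scaleN1r (le_trans (HC' s w s01))// ler_wpM2r//.
  by rewrite lerDr.
by rewrite expr0 scale1r (le_trans (HC s w s01))// ler_wpM2r// lerDl.
Qed.

End BracketMoves.

(** * The Hoermander condition provides motions in all directions *)

Section LocalReach.
Variables (R : realType) (d m : nat) (f : 'I_m -> 'rV[R]_d -> 'rV[R]_d).
Variables (L : 'rV[R]_d -> 'rV[R]_m -> R) (c : R) (D : bounds f L c).

Lemma vfield_bounded (X : 'rV[R]_d -> 'rV[R]_d) : vfield X ->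
  exists2 M, 0 <= M & forall x, `|X x| <= M.
Proof.
move=> HX.
have ex j : exists M, 0 <= M /\ forall x, `|X x 0 j| <= M.
  by have [h1 h2] := HX j; have [M M0 HM] := periodic_bounded (Sm_cts (h1 0%N)) h2; exists M.
have [M HM] := choice ex.
have M0 : 0 <= \sum_j M j by apply: sumr_ge0 => j _; have [] := HM j.
exists (\sum_j M j) => // x; apply: norm_le_coord => // j.
have [_ H] := HM j; rewrite (le_trans (H x))// (bigD1 j)//= lerDl sumr_ge0// => i _.
by have [] := HM i.
Qed.

Lemma vfield_lipschitz (X : 'rV[R]_d -> 'rV[R]_d) : vfield X ->
  exists2 M, 0 <= M & forall x y, `|X x - X y| <= M * `|x - y|.
Proof.
move=> HX.
have ex j : exists M, 0 <= M /\ forall x y, `|X x 0 j - X y 0 j| <= M * `|x - y|.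
  by have [h1 h2] := HX j; have [M M0 HM] := periodic_lipschitz (h1 1%N) h2; exists M.
have [M HM] := choice ex.
have M0 : 0 <= \sum_j M j by apply: sumr_ge0 => j _; have [] := HM j.
exists (\sum_j M j) => // x y; apply: norm_le_coord => [|j]; first exact: mulr_ge0.
have [_ H] := HM j; rewrite !mxE (le_trans (H x y))// ler_wpM2r// (bigD1 j)//= lerDl sumr_ge0// => i _.
by have [] := HM i.
Qed.

(* Along [X] one can move both ways by [s^k] in time of order [s], for some [k <= N]. *)
Definition motion (N : nat) (X : 'rV[R]_d -> 'rV[R]_d) : Prop :=
  [/\ forall x, `|X x| <= N%:R,
   forall x y, `|X x - X y| <= N%:R * `|x - y| &
   exists2 k : nat, (0 < k <= N)%N &
   forall (e : bool) (s : R) w, 0 <= s <= 1 -> exists2 w', two_way D (N%:R * s) w w' &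
    `|w' - w - s ^+ k *: ((-1) ^+ e *: X w)| <= N%:R * s ^+ k.+1].

Lemma motion_le N N' X : (N <= N')%N -> motion N X -> motion N' X.
Proof.
move=> NN [H1 H2 [k /andP[k0 kN] H3]].
have NN' : N%:R <= N'%:R :> R by rewrite ler_nat.
split=> [x|x y|].
- exact: le_trans NN'.
- by rewrite (le_trans (H2 x y))// ler_wpM2r.
exists k; first by rewrite k0 (leq_trans kN).
move=> e s w s01; have [w' h1 h2] := H3 e s w s01; have /andP[s0 _] := s01.
exists w'; last by rewrite (le_trans h2)// ler_wpM2r// exprn_ge0.
by apply: two_way_le h1; rewrite ?mulr_ge0// ler_wpM2r.
Qed.

Lemma bracket_motion X : iter_bracket f X -> exists N, motion N X.
Proof.
move=> bX; have [vX [k [b [C [k0 b0 C0 H]]]]] := bracket_displacement D bX.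
have [M M0 HM] := vfield_bounded vX; have [K K0 HK] := vfield_lipschitz vX.
pose N := (Num.bound (M + K + b + C) + k)%N.
have S0 : 0 <= M + K + b + C by rewrite !addr_ge0.
have NS : M + K + b + C <= N%:R.
  by rewrite (le_trans (ltW (archi_boundP S0)))// ler_nat leq_addr.
exists N; split=> [x|x y|].
- by rewrite (le_trans (HM x))// (le_trans _ NS)//; clear -M0 K0 b0 C0; lra.
- by rewrite (le_trans (HK x y))// ler_wpM2r// (le_trans _ NS)//; move: M0 K0 b0 C0; lra.
exists k; first by rewrite k0 leq_addl.
move=> e s w s01; have [w' h1 h2] := H e s w s01; have /andP[s0 _] := s01.
exists w'.
  apply: two_way_le h1; rewrite ?mulr_ge0// ler_wpM2r// (le_trans _ NS)//; move: M0 K0 b0 C0; lra.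
by rewrite (le_trans h2)// ler_wpM2r ?exprn_ge0// (le_trans _ NS)//; move: M0 K0 b0 C0; lra.
Qed.

Definition dot (u v : 'rV[R]_d) : R := \sum_i u 0 i * v 0 i.

Lemma dotD u v w : dot (u + v) w = dot u w + dot v w.
Proof. by rewrite /dot -big_split; apply: eq_bigr => i _; rewrite mxE mulrDl. Qed.
Lemma dotZ a u w : dot (a *: u) w = a * dot u w.
Proof. by rewrite /dot mulr_sumr; apply: eq_bigr => i _; rewrite mxE mulrA. Qed.
Lemma dotN u w : dot (- u) w = - dot u w.
Proof. by rewrite -scaleN1r dotZ mulN1r. Qed.
Lemma dotC u w : dot u w = dot w u.
Proof. by apply: eq_bigr => i _; rewrite mulrC. Qed.
Lemma dot_norm u w : `|dot u w| <= d%:R * (`|u| * `|w|).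
Proof.
have -> : d%:R * (`|u| * `|w|) = \sum_(i < d) (`|u| * `|w|) by rewrite sumr_const card_ord mulr_natl.
rewrite (le_trans (ler_norm_sum _ _ _))//; apply: ler_sum => i _; rewrite normrM; apply: ler_pM => //; exact: coord_norm_le.
Qed.

Lemma enorm_ge0 n (u : 'rV[R]_n) : 0 <= enorm u.
Proof. exact: sqrtr_ge0. Qed.

Lemma enorm_sqr (u : 'rV[R]_d) : enorm u ^+ 2 = dot u u.
Proof. by rewrite sqr_sqrtr// sumr_ge0// => i _; exact: sqr_ge0. Qed.

Lemma enorm_eq0 (u : 'rV[R]_d) : enorm u = 0 -> u = 0.
Proof. by move=> u0; apply/eqP; rewrite -normr_le0 -u0 norm_le_enorm. Qed.

(** Each unit vector is a combination of finitely many brackets at [y], so one [N] serves all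
    directions [u]. If every motion were too little correlated with [u], these combinations would
    bound each coordinate of [u], and then its Euclidean norm by less than itself. *)
Lemma spanning_motions y : exists2 N : nat, (0 < N)%N & forall u, u != 0 ->
  exists2 X, motion N X & enorm u <= (d%:R * N%:R + 1) * `|dot (X y) u|.
Proof.
have ex (i : 'I_d) : exists N : nat, forall u : 'rV[R]_d, u 0 i != 0 ->
    exists2 X, motion N X & `|u 0 i| <= N%:R * `|dot (X y) u|.
  have [_ _ hor _ _] := bHF D.
  have [n [g [a [Hg E]]]] := hor y (delta_mx 0 i).
  have [b Hb] := choice (fun k => bracket_motion (Hg k)).
  have A0 : 0 <= \sum_k `|a k| by apply: sumr_ge0.
  pose N := (\sum_k b k + Num.bound (\sum_k `|a k|))%N.
  have AN : \sum_k `|a k| < N%:R.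
    by rewrite (lt_le_trans (archi_boundP A0))// ler_nat leq_addl.
  exists N => u ui.
  have uE : u 0 i = \sum_k a k * dot (g k y) u.
    have -> : u 0 i = dot (delta_mx 0 i) u.
      rewrite /dot (bigD1 i)//= big1 ?addr0 ?mxE ?eqxx ?mul1r// => j ji.
      by rewrite mxE eqxx (negbTE ji) mul0r.
    rewrite E; elim/big_rec2 : _ => [|k z w _ <-]; first by rewrite /dot big1// => j _; rewrite mxE mul0r.
    by rewrite dotD dotZ.
  have [//|no] := pselect (exists2 X, motion N X & `|u 0 i| <= N%:R * `|dot (X y) u|).
  have N0 : 0 < N%:R :> R by exact: le_lt_trans AN.
  have lt k : `|dot (g k y) u| <= `|u 0 i| / N%:R.
    rewrite leNgt; apply/negP => /ltW; rewrite ler_pdivrMr// mulrC => h; apply: no.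
    exists (g k) => //; apply: motion_le (Hb k).
    by rewrite (leq_trans _ (leq_addr _ _))// (bigD1 k)//= leq_addr.
  have : `|u 0 i| <= (\sum_k `|a k|) * (`|u 0 i| / N%:R).
    rewrite {1}uE (le_trans (ler_norm_sum _ _ _))// mulr_suml; apply: ler_sum => k _.
    by rewrite normrM ler_wpM2l.
  rewrite mulrCA ler_pMr ?normr_gt0// ler_pdivlMr// mul1r => h.
  by have := lt_le_trans AN h; rewrite ltxx.
have [b Hb] := choice ex.
pose N := (\sum_i b i).+1.
have bN i : (b i <= N)%N by rewrite /N (bigD1 i)//= ltnW// ltnS leq_addr.
exists N => // u u0.
have [//|no] := pselect (exists2 X, motion N X & enorm u <= (d%:R * N%:R + 1) * `|dot (X y) u|).
have E0 : 0 < enorm u.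
  by rewrite lt0r enorm_ge0 andbT; apply: contra_neq u0 => /enorm_eq0.
have dN : 0 < d%:R * N%:R + 1 :> R by rewrite ltr_wpDl// mulr_ge0.
have [r [r0 Er]] : exists r : R, 0 < r /\ enorm u = r * (d%:R * N%:R + 1).
  by exists (enorm u / (d%:R * N%:R + 1)); rewrite divr_gt0// divfK// gt_eqF.
have lt X : motion N X -> `|dot (X y) u| <= r.
  move=> mX; rewrite leNgt; apply/negP => /ltW h; apply: no.
  by exists X => //; rewrite Er mulrC ler_wpM2l// ltW.
have ui i : u 0 i ^+ 2 <= (N%:R * r) ^+ 2.
  have r0' := ltW r0; rewrite -real_normK ?num_real// ler_pXn2r// ?nnegrE ?mulr_ge0//.
  have [->|h] := eqVneq (u 0 i) 0; first by rewrite normr0 mulr_ge0.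
  have [X mX HX] := Hb i u h.
  by rewrite (le_trans HX)// ler_pM// ?ler_nat// lt//; exact: motion_le mX.
have : enorm u ^+ 2 <= d%:R * (N%:R * r) ^+ 2.
  have -> : d%:R * (N%:R * r) ^+ 2 = \sum_(i < d) (N%:R * r) ^+ 2.
    by rewrite sumr_const card_ord mulr_natl.
  by rewrite enorm_sqr; apply: ler_sum => i _; rewrite -expr2 ui.
rewrite Er => h.
have [d0|d0] := eqVneq (d%:R : R) 0.
  move: h; rewrite d0 !mul0r add0r mulr1 => h.
  by have := lt_le_trans (exprn_gt0 2 r0) h; rewrite ltxx.
have d1 : 1 <= d%:R :> R by rewrite ler1n lt0n -(pnatr_eq0 R).
have Np : 0 <= N%:R :> R by [].
have : d%:R * (N%:R * r) ^+ 2 < (r * (d%:R * N%:R + 1)) ^+ 2; last by rewrite ltNge h.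
have -> : (r * (d%:R * N%:R + 1)) ^+ 2 = d%:R * (N%:R * r) ^+ 2 +
   ((d%:R - 1) * (d%:R * (N%:R * r) ^+ 2) + r ^+ 2 * (2 * d%:R * N%:R + 1)) by ring.
have P1 : 0 <= (d%:R - 1) * (d%:R * (N%:R * r) ^+ 2).
  by apply: mulr_ge0; rewrite ?subr_ge0// mulr_ge0// sqr_ge0.
have P2 : 0 < r ^+ 2 * (2 * d%:R * N%:R + 1).
  by apply: mulr_gt0; rewrite ?exprn_gt0// ltr_wpDl// !mulr_ge0.
by rewrite ltrDl ltr_wpDl.
Qed.

(** The motions have the common Lipschitz constant [N], so near [y] half of the correlation found at
    [y] is kept. *)
Lemma spanning_motions_near y : exists (N : nat) (a r : R), [/\ (0 < N)%N, 0 < a, 0 < r &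
  forall w u, `|w - y| <= r -> u != 0 -> exists2 X, motion N X & a * enorm u <= `|dot (X w) u|].
Proof.
have [N N0 H] := spanning_motions y.
have dN : 0 < d%:R * N%:R + 1 :> R by rewrite ltr_wpDl// mulr_ge0.
have [a [a0 aE]] : exists a : R, 0 < a /\ 2 * a = (d%:R * N%:R + 1)^-1.
  exists ((d%:R * N%:R + 1)^-1 / 2); split; first by rewrite divr_gt0 ?invr_gt0.
  by rewrite mulrCA mulfV// mulr1.
exists N, a, (a / (d%:R * N%:R + 1)); split=> //; first by rewrite divr_gt0.
move=> w u wy u0; have [X mX HX] := H u u0; exists X => //.
have [_ XL _] := mX.
have E0 := enorm_ge0 u.
have h1 : `|dot (X y - X w) u| <= a * enorm u.
  have h2 : `|X y - X w| <= N%:R * (a / (d%:R * N%:R + 1)).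
    by rewrite (le_trans (XL y w))// ler_wpM2l// distrC.
  rewrite (le_trans (dot_norm _ _))// mulrA ler_pM ?norm_le_enorm ?mulr_ge0//.
  rewrite (le_trans (ler_wpM2l _ h2))//.
  have -> : d%:R * (N%:R * (a / (d%:R * N%:R + 1))) = a * (d%:R * N%:R / (d%:R * N%:R + 1)).
    by rewrite !mulrA -(mulrA a) [a * _]mulrC.
  by rewrite ger_pMr// ler_pdivrMr// mul1r lerDl.
have h3 : 2 * a * enorm u <= `|dot (X y) u|.
  by rewrite aE ler_pdivrMl.
have : dot (X y) u = dot (X y - X w) u + dot (X w) u by rewrite -dotD subrK.
have := ler_normD (dot (X y - X w) u) (dot (X w) u).
move=> h4 h5; move: h3; rewrite h5 => h3.
have := le_trans h3 h4; move: h1; lra.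
Qed.

End LocalReach.

(** * One motion brings the target closer by a fixed factor *)

Section Descent.
Variables (R : realType) (d m : nat) (f : 'I_m -> 'rV[R]_d -> 'rV[R]_d).
Variables (L : 'rV[R]_d -> 'rV[R]_m -> R) (c : R) (D : bounds f L c).

Lemma root_exists (x : R) (k : nat) : 0 <= x -> (0 < k)%N -> exists2 s : R, 0 <= s & s ^+ k = x.
Proof.
move=> x0 k0; exists (x `^ (k%:R^-1)); first exact: powR_ge0.
by rewrite -powR_mulrn ?powR_ge0// -powRrM mulVf ?powRr1// pnatr_eq0 -lt0n.
Qed.

Lemma enorm_norm_le (u : 'rV[R]_d) : enorm u <= (d%:R + 1) * `|u|.
Proof.
rewrite -(@ler_pXn2r _ 2)// ?nnegrE ?enorm_ge0 ?mulr_ge0//.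
rewrite enorm_sqr (le_trans (ler_norm _))// (le_trans (dot_norm _ _))// exprMn -expr2.
rewrite ler_wpM2r ?sqr_ge0//; have : 0 <= d%:R :> R by []. 
by nra.
Qed.

(** With E the distance to the target, a displacement of [t = eta * E] along plus or minus [X]
    lowers the squared distance by [2 * t * a * E], up to terms of order [t * E * eta] and
    [t * E * s]. For small [eta] these use up at most half of the gain, and the factor [1 - eta * a]
    remains. The Euclidean norm is used so that the square can be expanded. *)
Lemma descent_step (N : nat) (a : R) : (0 < N)%N -> 0 < a -> exists mu eps : R,
  [/\ 0 < mu, mu < 1, 0 < eps, eps <= 1 &
   forall X, motion D N X -> forall (w u : 'rV[R]_d) (sg : R), enorm u <= eps -> 0 <= sg ->
     sg ^+ N = enorm u -> a * enorm u <= `|dot (X w) u| ->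
     exists2 w', two_way D (N%:R * sg) w w' & enorm (u - (w' - w)) <= mu * enorm u].
Proof.
move=> N0 a0.
pose n : R := N%:R; pose e : R := d%:R.
have n0 : 0 <= n by exact: ler0n.
have e0 : 0 <= e by exact: ler0n.
have en : 0 <= e * n by exact: mulr_ge0.
have enn : 0 <= e * n ^+ 2 by rewrite mulr_ge0// sqr_ge0.
(* Large enough for [eta = a / (2 * A)] to satisfy [eta <= 1], [eta * a <= 1 / 2] and the error
   bound [eta_enn]. *)
pose A := 4 * (e * n ^+ 2) + 2 * (e * n) + a + a ^+ 2 + 1.
have a2 : 0 < a ^+ 2 by rewrite exprn_gt0.
have A0 : 0 < A by rewrite /A; move: enn en a0 a2; lra.
pose eta := a / (2 * A).
have A20 : 0 < 2 * A by rewrite mulr_gt0.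
have eta0 : 0 < eta by rewrite divr_gt0.
have etaA : eta * A = a / 2 by rewrite /eta; field; rewrite gt_eqF.
have eta1 : eta <= 1 by rewrite /eta ler_pdivrMr// mul1r /A; move: enn en a0 a2; lra.
have etaa : eta * a <= 1 / 2.
  rewrite /eta mulrAC ler_pdivrMr// -expr2 /A; move: enn en a0 a2; lra.
have eta_enn : eta * (e * n ^+ 2) + eta * (2 * (e * n) + 3 * (e * n ^+ 2)) <= a.
  have : eta * (e * n ^+ 2) + eta * (2 * (e * n) + 3 * (e * n ^+ 2)) <= eta * A.
    rewrite -mulrDr ler_wpM2l ?(ltW eta0)// /A; move: enn en a0 a2; lra.
  by rewrite etaA; move: a0; lra.
have mu20 : 0 < 1 - eta * a by move: etaa; lra.
exists (Num.sqrt (1 - eta * a)), (eta ^+ N); split.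
- by rewrite sqrtr_gt0.
- rewrite -[X in _ < X]sqrtr1 ltr_sqrt// gtrBl mulr_gt0//.
- exact: exprn_gt0.
- by rewrite exprn_ile1// ltW.
move=> X [XN _ [k /andP[k0 kN] HX]] w u sg uE sg0 sgE au.
set E := enorm u in uE sgE au *.
have E0 : 0 <= E by exact: enorm_ge0.
have t0 : 0 <= eta * E by rewrite mulr_ge0// ltW.
have [s s0 sk] := root_exists t0 k0.
have tE : eta * E <= E by rewrite -[leRHS]mul1r ler_wpM2r.
have eta_le1 : eta ^+ N <= eta ^+ k.
  by rewrite ler_wiXn2l// ltW.
have s_eta : s <= eta.
  rewrite -(@ler_pXn2r _ k)// ?nnegrE ?(ltW eta0)// sk (le_trans tE)// (le_trans uE)//.
have s1 : s <= 1 by exact: le_trans eta1.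
have sg1 : sg <= 1.
  by rewrite -(@ler_pXn2r _ N)// ?nnegrE// sgE expr1n (le_trans uE)// exprn_ile1// ltW.
(* Here [s ^+ k = eta * E <= sg ^+ N <= sg ^+ k], since [sg <= 1] and [k <= N]; so the time used is
   at most [N * sg], whatever the order [k] of the motion. *)
have s_sg : s <= sg.
  by rewrite -(@ler_pXn2r _ k)// ?nnegrE// sk (le_trans tE)// -sgE ler_wiXn2l.
(* The sign is chosen so that the motion points towards the target. *)
pose b := dot (X w) u < 0.
have [w' w'1 w'2] := HX b s w (introT andP (conj s0 s1)).
exists w'.
  by apply: two_way_le w'1; rewrite ?mulr_ge0// ler_wpM2l.
set Y := (-1) ^+ b *: X w in w'2.
have Yu : a * E <= dot Y u.
  rewrite /Y dotZ; apply: (le_trans au); rewrite /b.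
  have [h|h] := ltrP (dot (X w) u) 0; first by rewrite ltr0_norm// expr1 mulN1r.
  by rewrite ger0_norm// expr0 mul1r.
have YN : `|Y| <= n by rewrite /Y normrZ normrX normrN1 expr1n mul1r.
set t := eta * E in t0 sk tE.
have errN : `|w' - w - t *: Y| <= n * s * t by rewrite -sk (le_trans w'2)// exprS mulrA.
set err := w' - w - t *: Y in errN.
have -> : u - (w' - w) = u - t *: Y - err by rewrite /err [in RHS]opprB addrA subrK.
have tdef : t = eta * E by [].
clearbody Y err t.
rewrite -(@ler_pXn2r _ 2)// ?nnegrE ?enorm_ge0 ?mulr_ge0 ?sqrtr_ge0//.
rewrite exprMn (sqr_sqrtr (ltW mu20)) enorm_sqr.
have uN : `|u| <= E by exact: norm_le_enorm.
have P1 : dot Y Y <= e * n ^+ 2.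
  rewrite (le_trans (ler_norm _))// (le_trans (dot_norm _ _))// ler_wpM2l// expr2 ler_pM//.
have nst : 0 <= n * s * t := mulr_ge0 (mulr_ge0 n0 s0) t0.
have P2 : `|dot u err| <= e * (E * (n * s * t)).
  by rewrite (le_trans (dot_norm _ _))// ler_wpM2l// ler_pM.
have P3 : `|dot Y err| <= e * (n * (n * s * t)).
  by rewrite (le_trans (dot_norm _ _))// ler_wpM2l// ler_pM.
have P4 : dot err err <= e * (n * s * t * (n * s * t)).
  by rewrite (le_trans (ler_norm _))// (le_trans (dot_norm _ _))// ler_wpM2l// ler_pM.
have -> : dot (u - t *: Y - err) (u - t *: Y - err) =
   E ^+ 2 - 2 * t * dot Y u + t ^+ 2 * dot Y Y - 2 * dot u err + 2 * t * dot Y err + dot err err.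
  rewrite enorm_sqr !(dotD, dotN, dotZ) !(dotC _ (u - t *: Y - err)) !(dotD, dotN, dotZ).
  by rewrite (dotC u Y) (dotC err u) (dotC err Y); ring.
have Q1 : - (2 * t * dot Y u) <= - (2 * t * (a * E)).
  by rewrite lerN2 ler_wpM2l// mulr_ge0.
have tt0 : 0 <= t * E by exact: mulr_ge0.
have Q2 : t ^+ 2 * dot Y Y <= t * E * (eta * (e * n ^+ 2)).
  have -> : t * E * (eta * (e * n ^+ 2)) = t ^+ 2 * (e * n ^+ 2) by rewrite tdef; ring.
  by rewrite ler_wpM2l// sqr_ge0.
have ens : 0 <= e * n * s := mulr_ge0 en s0.
have enns : 0 <= e * n ^+ 2 * s := mulr_ge0 enn s0.
have Q3 : - (2 * dot u err) <= t * E * (2 * (e * n * s)).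
  have := ler_norm (- dot u err); rewrite normrN => h.
  have -> : t * E * (2 * (e * n * s)) = 2 * (e * (E * (n * s * t))) by ring.
  by rewrite -mulrN ler_wpM2l// (le_trans h).
have Q4 : 2 * t * dot Y err <= t * E * (2 * (e * n ^+ 2 * s)).
  have h := le_trans (ler_norm _) P3.
  have t20 : 0 <= 2 * t by rewrite mulr_ge0.
  apply: (le_trans (ler_wpM2l t20 h)).
  have -> : 2 * t * (e * (n * (n * s * t))) = t * t * (2 * (e * n ^+ 2 * s)) by ring.
  by rewrite ler_wpM2r ?ler_wpM2l// mulr_ge0.
have Q5 : dot err err <= t * E * (e * n ^+ 2 * s).
  apply: (le_trans P4).
  have -> : e * (n * s * t * (n * s * t)) = t * (t * s) * (e * n ^+ 2 * s) by ring.
  by rewrite ler_wpM2r// ler_wpM2l// (le_trans (ler_piMr t0 s1)).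
have Q6 : t * E * (eta * (e * n ^+ 2) + s * (2 * (e * n) + 3 * (e * n ^+ 2))) <= t * E * a.
  rewrite ler_wpM2l// (le_trans _ eta_enn)// lerD2l ler_wpM2r//.
  by rewrite addr_ge0// mulr_ge0.
have -> : (1 - eta * a) * E ^+ 2 = E ^+ 2 - t * E * a by rewrite tdef; ring.
move: Q1 Q2 Q3 Q4 Q5 Q6; rewrite !mulrDr.
move: (dot _ _) (dot _ _) (dot _ _) (dot _ _) (dot _ _) => x1 x2 x3 x4 x5.
lra.
Qed.

End Descent.

(** * Small-time local controllability *)

Section LocalReachability.
Variables (R : realType) (d m : nat) (f : 'I_m -> 'rV[R]_d -> 'rV[R]_d).
Variables (L : 'rV[R]_d -> 'rV[R]_m -> R) (c : R) (D : bounds f L c).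

(** Repeated descents stay in the ball where correlated motions exist, since the distance to [z]
    never exceeds the initial one. *)
Let greedy y : exists (N : nat) (nu mu r : R), [/\ (0 < N)%N, 0 <= nu < 1, 0 <= mu < 1, 0 < r &
  forall z (sg : R), enorm (z - y) <= r -> 0 <= sg -> sg ^+ N = enorm (z - y) ->
  forall n, exists2 w, two_way D (N%:R * (sg * \sum_(j < n) nu ^+ j)) y w &
    enorm (z - w) <= mu ^+ n * enorm (z - y)].
Proof.
have [N [a [r [N0 a0 r0 near_y]]]] := spanning_motions_near D y.
have [mu [eps [mu0 mu1 eps0 eps1 desc]]] := descent_step D N0 a0.
(* A step takes time of the order of the [N]-th root of the remaining distance, so the times shrink
   by the [N]-th root [nu] of the contraction factor. *)
have [nu nu0 nuN] := root_exists (ltW mu0) N0.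
have nu1 : nu < 1 by rewrite -(@ltr_pXn2r _ N)// ?nnegrE// nuN expr1n.
exists N, nu, mu, (Num.min eps (r / 2)); split; rewrite ?nu0 ?(ltW mu0)//.
  by rewrite lt_min eps0 divr_gt0.
move=> z sg; rewrite le_min => /andP[E1 E2] sg0 sgE.
have E0 := enorm_ge0 (z - y).
elim=> [|n [w yw wz]].
  by exists y; [rewrite big_ord0 !mulr0; split; have := path_wait D 0 y; rewrite mulr0|rewrite expr0 mul1r].
have mun : 0 <= mu ^+ n by rewrite exprn_ge0// ltW.
have S0 k : 0 <= \sum_(j < k) nu ^+ j by apply: sumr_ge0 => j _; exact: exprn_ge0.
have NS k : 0 <= N%:R * (sg * \sum_(j < k) nu ^+ j) by rewrite mulr_ge0// mulr_ge0.
have SS : N%:R * (sg * \sum_(j < n.+1) nu ^+ j) =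
    N%:R * (sg * \sum_(j < n) nu ^+ j) + N%:R * (nu ^+ n * sg).
  by rewrite (mulrC (nu ^+ n)) -!mulrDr big_ord_recr.
have ns0 : 0 <= nu ^+ n * sg by rewrite mulr_ge0// exprn_ge0.
have [zw|zw] := eqVneq (z - w) 0.
  exists w; first by apply: two_way_le yw; rewrite // SS lerDl mulr_ge0.
  by rewrite zw (le_trans (enorm_norm_le _))// normr0 mulr0 mulr_ge0// exprn_ge0// ltW.
have wzE : enorm (z - w) <= enorm (z - y).
  by rewrite (le_trans wz)// ler_piMl ?exprn_ile1 ?(ltW mu0) ?(ltW mu1)//.
have wy : `|w - y| <= r.
  rewrite -(subrKA z) (le_trans (ler_normD _ _))// distrC.
  have := norm_le_enorm (z - w); have := norm_le_enorm (z - y); move: E2 wzE; lra.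
have [X mX HX] := near_y w (z - w) wy zw.
have [s s0 sE] := root_exists (enorm_ge0 (z - w)) N0.
have [w' ww' zw'] := desc X mX w (z - w) s (le_trans wzE E1) s0 sE HX.
have ss : s <= nu ^+ n * sg.
  rewrite -(@ler_pXn2r _ N)// ?nnegrE// sE (le_trans wz)// exprMn sgE -exprM mulnC exprM nuN.
  by [].
exists w'.
  rewrite SS; apply: two_way_trans yw _ => //; first by rewrite mulr_ge0.
  by apply: two_way_le ww'; rewrite ?mulr_ge0// ler_wpM2l.
move: zw'; rewrite opprB addrA subrK => /le_trans; apply.
by rewrite exprS -mulrA ler_wpM2l// ltW.
Qed.

(** The total time is bounded by [N * sg / (1 - nu)], which is small when [z] is near [y]. Waiting
    brings the duration to exactly [e], and [path_limit] reaches [z] itself as the limit of the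
    greedy points. *)
Lemma local_reach y (e : R) : 0 < e -> exists2 dl : R, 0 < dl &
  forall z, `|z - y| < dl -> two_way D e y z.
Proof.
move=> e0.
have [N [nu [mu [r [N0 /andP[nu0 nu1] /andP[mu0 mu1] r0 H]]]]] := greedy y.
have Np : 0 < N%:R :> R by rewrite ltr0n.
have nu10 : 0 < 1 - nu by rewrite subr_gt0.
have [tau [tau0 tauE]] : exists tau : R, 0 < tau /\ N%:R * (tau / (1 - nu)) = e.
  exists (e * (1 - nu) / N%:R); split; first by rewrite divr_gt0// mulr_gt0.
  by field; rewrite !gt_eqF.
have d1 : 0 < d%:R + 1 :> R by rewrite ltr_wpDl.
exists (Num.min r (tau ^+ N) / (d%:R + 1)).
  by rewrite divr_gt0// lt_min r0 exprn_gt0.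
move=> z; rewrite ltr_pdivlMr// mulrC => zy.
have := le_lt_trans (enorm_norm_le _) zy; rewrite lt_min => /andP[E1 E2].
have [sg sg0 sgE] := root_exists (enorm_ge0 (z - y)) N0.
have sgt : sg <= tau.
  by rewrite -(@ler_pXn2r _ N)// ?nnegrE ?(ltW tau0)// sgE ltW.
have H1 n : exists w, two_way D (N%:R * (sg * \sum_(j < n) nu ^+ j)) y w /\
    enorm (z - w) <= mu ^+ n * enorm (z - y).
  by have [w h1 h2] := H z sg (ltW E1) sg0 sgE n; exists w.
have [w Hw] := choice H1.
have S0 k : 0 <= \sum_(j < k) nu ^+ j by apply: sumr_ge0 => j _; exact: exprn_ge0.
have S1 k : \sum_(j < k) nu ^+ j <= (1 - nu)^-1.
  rewrite -[leRHS]mul1r ler_pdivlMr// mulrC.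
  rewrite -opprB mulNr -subrX1 opprB gerBl exprn_ge0//.
have yw n : two_way D e y (w n).
  have [h _] := Hw n; apply: two_way_le h; first by rewrite !mulr_ge0.
  by rewrite -tauE ler_wpM2l// ler_pM.
have [U [UU Uoo]] := @ultraFilterLemma nat \oo _.
have wz : w @ U --> z.
  suff wz : w @ \oo --> z by move=> A /wz; exact: Uoo.
  apply/cvgrPdist_le => t t0.
  have H0 : (fun n => mu ^+ n * enorm (z - y)) @ \oo --> (0 : R).
    rewrite -(mul0r (enorm (z - y))); apply: cvgM; last exact: cvg_cst.
    by apply: cvg_expr; rewrite ger0_norm.
  move/cvgrPdist_le : H0 => /(_ t t0); apply: filterS => n.
  rewrite sub0r normrN => Hn; have [_ h] := Hw n.
  by rewrite (le_trans (norm_le_enorm _))// (le_trans h)// (le_trans (ler_norm _)).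
split.
- apply: (path_limit (ltW e0) (cvg_cst y) wz) => n; by have [] := yw n.
- apply: (path_limit (ltW e0) wz (cvg_cst y)) => n; by have [] := yw n.
Qed.

End LocalReachability.

(** * The Peierls barrier through loops, and the sign of their action *)

Section Closing.
Variables (R : realType) (d m : nat) (f : 'I_m -> 'rV[R]_d -> 'rV[R]_d).
Variables (L : 'rV[R]_d -> 'rV[R]_m -> R) (c : R) (D : bounds f L c).
Notation C0 := (bC0 D).

Lemma wk_path g l (p q : R) : p <= q -> wk D g l p q -> path_to D (q - p) (g p) (g q) (l q - l p).
Proof.
move=> pq H; exists (fun s => g (s + p)), (fun s => l (s + p)); rewrite !add0r subrK; split=> //.
move=> s t s0 st tq; have := H (s + p) (t + p).
by rewrite opprD addrACA subrr addr0 lerD2r lerDr -lerBrDr; apply.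
Qed.

Lemma path_iter (T : R) y k a n : intvec k -> 0 <= T -> path_to D T y (y + k) a ->
  path_to D (n%:R * T) y (y + k *+ n) (n%:R * a).
Proof.
move=> ik T0 H; elim: n => [|n IH].
  by rewrite !mul0r mulr0n addr0; have := path_wait D 0 y; rewrite mulr0.
have ikn : intvec (k *+ n).
  move=> i; have [z kz] := ik i; exists (z * n%:Z).
  by rewrite mulmxnE kz intrM -pmulrn mulr_natr.
have := path_cat _ T0 IH (path_shift ikn H).
rewrite mulr_ge0// => /(_ isT); rewrite -!natr1 !mulrDl !mul1r.
by rewrite mulrSr addrAC addrA.
Qed.

Lemma path_admissible (T : R) y z a : 0 <= T -> path_to D T y z a -> exists g u k,
  [/\ admissible f 0 T g u, g 0 = y, g T = z, cost L 0 T g u = k%:E & k - c * T <= a].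
Proof.
move=> T0 [g [l [H g0 gT lE]]].
have [g' [l' [H' gg ll]]] := wk_extend T0 H.
have [u [adm cst]] := wk_admissible H'.
have [k kE kl] := cst 0 T T0.
exists g', u, k; split=> //; rewrite ?gg ?lexx ?T0//; first exact: adm.
by move: kl; rewrite subr0 !ll ?lexx ?T0// lE.
Qed.

Lemma admissible_path (a b : R) g u k : a <= b -> admissible f a b g u -> cost L a b g u = k%:E ->
  exists2 T, b - a <= T & path_to D T (g a) (g b) (k - c * (b - a)).
Proof.
move=> ab adm kE; have [T [g' [Tab g0 gT _ H]]] := admissible_wk D ab adm.
have [l' wl lE] := H k kE.
by exists T => //; exists g', l'.
Qed.

Lemma admissible_path_C0 (a b : R) g u : a <= b -> admissible f a b g u ->
  exists2 T, b - a <= T & path_to D T (g a) (g b) (C0 * T).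
Proof.
move=> ab adm; have [T [g' [Tab g0 gT wg _]]] := admissible_wk D ab adm.
by exists T => //; exists g', (fun s => C0 * s); split=> //; rewrite mulr0 subr0.
Qed.

Lemma intvecN n (k : 'rV[R]_n) : intvec k -> intvec (- k).
Proof. by move=> ik i; have [z kz] := ik i; exists (- z); rewrite mxE kz mulrNz. Qed.

Lemma intvecD n (k l : 'rV[R]_n) : intvec k -> intvec l -> intvec (k + l).
Proof.
move=> ik il i; have [z kz] := ik i; have [w lw] := il i.
by exists (z + w); rewrite mxE kz lw mulrzDr.
Qed.

(** Together with [peierls_lt] this reduces the barrier to weak trajectories, lifted to R^d, whose
    end point is known up to an integer vector. *)
Lemma peierls_le y z (r : R) :
  (forall M e : R, 0 < e -> exists T a k,
    [/\ M <= T, 0 <= T, intvec k, path_to D T y (z + k) a & a <= r + e]) ->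
  (peierls f L c y z <= r%:E)%E.
Proof.
move=> H; apply: ge_ereal_sup => _ [M _ <-].
apply/lee_addgt0Pr => e e0.
have [T [a [k [MT T0 ik yz ar]]]] := H M e e0.
have [g [u [q [adm g0 gT qE qa]]]] := path_admissible T0 yz.
apply: (@le_trans _ _ (actionA f L T y z - (c * T)%:E)%E).
  by apply: ereal_inf_lbound; exists T.
have : (actionA f L T y z <= q%:E)%E.
  apply: ereal_inf_lbound; exists (g, u) => //=; split=> //; split=> //.
  by rewrite gT /torus_eq addrAC subrr add0r.
move=> /leeB /(_ (lexx (c * T)%:E)) => /le_trans; apply.
by rewrite -EFinB -EFinD lee_fin (le_trans qa).
Qed.

(** A nearly optimal admissible curve of duration at least [M] is slowed down; this only lengthens
    it, so the duration stays above [M]. *)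
Lemma peierls_lt y z (r M : R) : (peierls f L c y z < r%:E)%E ->
  exists T a k, [/\ M <= T, 0 <= T, intvec k, path_to D T y (z + k) a & a < r].
Proof.
move=> pr; pose M' := Num.max M 0.
have : (ereal_inf [set (actionA f L t y z - (c * t)%:E)%E | t in [set t | (M' <= t)%R]] < r%:E)%E.
  by apply: le_lt_trans pr; apply: ereal_sup_ubound; exists M'.
move=> /ereal_inf_lt[_ [t /= M't <-]].
have t0 : 0 <= t by rewrite (le_trans _ M't)// le_max lexx orbT.
have Mt : M <= t by rewrite (le_trans _ M't)// le_max lexx.
rewrite EFinN lteBlDr// -EFinD => /ereal_inf_lt[_ [[g u] /= [adm [g0 gt]] <-]].
have := cost_ltNy D t0 adm; case qE : (cost L 0 t g u) => [q| |] // _; rewrite lte_fin => qr.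
have [T tT H] := admissible_path t0 adm qE.
rewrite g0 subr0 in tT H; exists T, (q - c * t), (g t - z); split=> //.
- exact: le_trans tT.
- exact: le_trans tT.
- by rewrite (addrC z) subrK.
- by move: qr; lra.
Qed.

Hypothesis Hc : critical_value f L c.

(** Running [n] times around the loop bounds the value at time [n * T] by [n * a + c * (n * T)]. For
    negative [a] the time average would stay below [c + a / T / 2], contradicting its convergence to
    [c]. *)
Lemma loop_ge0 (T : R) y k a : 0 < T -> intvec k -> path_to D T y (y + k) a -> 0 <= a.
Proof.
move=> T0 ik H; rewrite leNgt; apply/negP => a0.
pose e := c + a / T / 2.
have aT : a / T < 0 by rewrite pmulr_llt0// invr_gt0.
have ec : (e%:E < c%:E)%E by rewrite lte_fin /e gtrDl pmulr_llt0.
have nb : nbhs c%:E [set x : \bar R | (e%:E < x)%E].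
  by apply: open_nbhs_nbhs; split => //; exact: open_ereal_gt_ereal.
have [M [_ HM]] := Hc y nb.
pose n := (Num.bound (`|M| / T)).+1.
have nT : M < n%:R * T.
  rewrite -ltr_pdivrMr// (le_lt_trans (_ : _ <= `|M| / T))//.
    by rewrite ler_wpM2r ?invr_ge0 ?(ltW T0)// ler_norm.
  by rewrite (lt_le_trans (archi_boundP _))// ?divr_ge0 ?(ltW T0)// ler_nat.
have n0 : 0 < n%:R :> R by [].
have nT0 : 0 < n%:R * T by rewrite mulr_gt0.
have [g [u [q [adm g0 _ qE qa]]]] := path_admissible (ltW nT0) (path_iter n ik (ltW T0) H).
have vq : (valueV f L (n%:R * T) y <= q%:E)%E.
  by apply: ereal_inf_lbound; exists (g, u).
have i0 : (0 <= ((n%:R * T)^-1)%:E)%E by rewrite lee_fin invr_ge0 ltW.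
have := lt_le_trans (HM _ nT) (lee_wpmul2r i0 vq).
rewrite /= -EFinM lte_fin ltr_pdivlMr// /e => h.
have : (c + a / T / 2) * (n%:R * T) < n%:R * a + c * (n%:R * T).
  by rewrite (lt_le_trans h)// -lerBlDr.
rewrite mulrDl addrC ltrD2r.
have -> : a / T / 2 * (n%:R * T) = n%:R * a / 2 by field; rewrite gt_eqF.
have : n%:R * a < 0 by rewrite pmulr_rlt0.
lra.
Qed.

Lemma peierls_diag_ge0 y : (0 <= peierls f L c y y)%E.
Proof.
rewrite leNgt; apply/negP => /(@peierls_lt y y 0 1)[T [a [k [T1 _ ik H a0]]]].
by have := loop_ge0 (lt_le_trans ltr01 T1) ik H; rewrite leNgt a0.
Qed.

(** The arc from [g a] to [g b], followed by a curve back to [g a], is a loop and has nonnegative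
    action. *)
Lemma peierls_ge (a b : R) g u k : a <= b -> admissible f a b g u -> cost L a b g u = k%:E ->
  ((c * (b - a) - k)%:E <= peierls f L c (g b) (g a))%E.
Proof.
move=> ab adm kE; rewrite leNgt; apply/negP => /(@peierls_lt _ _ _ 1)[T [q [v [T1 T0 iv H qk]]]].
have [T' T'0 H'] := admissible_path ab adm kE.
have T'p : 0 <= T' by rewrite (le_trans _ T'0)// subr_ge0.
have Tp : 0 < T' + T by rewrite ltr_wpDl// (lt_le_trans ltr01 T1).
have := loop_ge0 Tp iv (path_cat T'p T0 H' H).
by rewrite leNgt; move: qk; lra.
Qed.

(** Equality says that return curves of arbitrarily long duration close the arc with total action as
    small as desired. The resulting loops may be started at either end of the arc, so both barriers
    vanish. *)
Lemma calibrated_diag (a b : R) g u : a <= b -> admissible f a b g u ->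
  peierls f L c (g b) (g a) = (- cost L a b g u + (c * (b - a))%:E)%E ->
  aubry f L c (g a) /\ aubry f L c (g b).
Proof.
move=> ab adm E.
have [T' T'0 H'] := admissible_path_C0 ab adm.
have T'p : 0 <= T' by rewrite (le_trans _ T'0)// subr_ge0.
(* An infinite cost would make the barrier minus infinity; a return curve of very negative action
   would then close up to a forbidden loop with the arc charged at rate [C0]. *)
have [k kE] : exists k, cost L a b g u = k%:E.
  have := cost_ltNy D ab adm; case: (cost L a b g u) E => [k| |]; [by exists k| |by []].
  move=> /= E _; exfalso.
  have : (peierls f L c (g b) (g a) < (- (C0 * T'))%:E)%E by rewrite E ltNyr.
  move=> /(@peierls_lt _ _ _ 1)[T [q [v [T1 T0 iv H qk]]]].
  have Tp : 0 < T' + T by rewrite ltr_wpDl// (lt_le_trans ltr01 T1).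
  have := loop_ge0 Tp iv (path_cat T'p T0 H' H).
  by rewrite leNgt; move: qk; lra.
have {T' T'0 H' T'p} [T' T'0 H'] := admissible_path ab adm kE.
have T'p : 0 <= T' by rewrite (le_trans _ T'0)// subr_ge0.
have lt e : 0 < e -> (peierls f L c (g b) (g a) < (c * (b - a) - k + e)%:E)%E.
  by move=> e0; rewrite E kE -EFinN -EFinD lte_fin; move: e0; lra.
split; apply/eqP; rewrite eq_le peierls_diag_ge0 andbT; apply: peierls_le => M e e0.
  have [T [q [v [T1 T0 iv H qk]]]] := peierls_lt M (lt e e0).
  exists (T' + T), (k - c * (b - a) + q), v; split=> //.
  - by rewrite (le_trans T1)// lerDr.
  - exact: addr_ge0.
  - exact: path_cat H' H.
  - by move: qk; lra.
have [T [q [v [T1 T0 iv H qk]]]] := peierls_lt M (lt e e0).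
exists (T + T'), (q + (k - c * (b - a))), v; split=> //.
- by rewrite (le_trans T1)// lerDl.
- exact: addr_ge0.
- exact: path_cat H (path_shift iv H').
- by move: qk; lra.
Qed.

End Closing.

(** * The calibrated curve as a limit of loops *)

Section AubryCurve.
Variables (R : realType) (d m : nat) (f : 'I_m -> 'rV[R]_d -> 'rV[R]_d).
Variables (L : 'rV[R]_d -> 'rV[R]_m -> R) (c : R) (D : bounds f L c).
Notation C0 := (bC0 D).
Notation C1 := (bC1 D).

(** Two turns of a loop, centred at time 0 so that the limit is defined on the whole line; each turn
    shifts the lift by [k] and the running action by [a]. *)
Definition loop (T : R) x (k : 'rV[R]_d) (a : R) G l : Prop :=
  [/\ wk D G l (- T) T, G 0 = x, l 0 = 0 &
   forall s, - T <= s <= 0 -> G (s + T) = G s + k /\ l (s + T) = l s + a].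

Lemma loop_exists (T : R) x k a : 0 < T -> intvec k -> path_to D T x (x + k) a ->
  exists G l, loop T x k a G l.
Proof.
move=> T0 ik [g [l [H g0 gT lE]]].
pose G s := if 0 <= s then g s else g (s + T) - k.
pose h s := if 0 <= s then l s - l 0 else l (s + T) - l 0 - a.
have Gp s : 0 <= s -> G s = g s /\ h s = l s - l 0 by rewrite /G /h => ->.
have Gn s : s <= 0 -> G s = g (s + T) - k /\ h s = l (s + T) - l 0 - a.
  rewrite le_eqVlt => /predU1P[->|s0]; last by rewrite /G /h leNgt s0.
  by have [-> ->] := Gp 0 (lexx _); rewrite add0r gT addrK lE !subrr g0.
exists G, h; split.
- apply: (wk_cat (p := 0)) => s t as_ st tb.
    have [-> ->] := Gn s (le_trans st tb); have [-> ->] := Gn t tb.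
    have : step D (t + T - (s + T)) (g (s + T)) (g (t + T)) (l (t + T) - l (s + T)).
      by apply: H; rewrite ?lerD2r// -?lerBlDr ?sub0r// gerDr.
    move/(step_shift (intvecN ik)); congr step; by ring.
  have [-> ->] := Gp s as_; have [-> ->] := Gp t (le_trans as_ st).
  by have := H s t as_ st tb; congr step; ring.
- by have [-> _] := Gp 0 (lexx _).
- by have [_ ->] := Gp 0 (lexx _); rewrite subrr.
move=> s /andP[Ts s0]; have sT : 0 <= s + T by rewrite -lerBlDr sub0r.
by have [-> ->] := Gp _ sT; have [-> ->] := Gn s s0; rewrite !subrK.
Qed.

(** The remainder of a turn after the piece from [p] to [q]: it leads from [G q] to the translate of
    [G p] and carries the rest of the action. *)
Lemma loop_path (T : R) x k a G l (p q : R) : loop T x k a G l ->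
  - T <= p -> p <= 0 -> p <= q -> q <= p + T ->
  path_to D (p + T - q) (G q) (G p + k) (l p + a - l q).
Proof.
move=> [H _ _ sh] Tp p0 pq qT; have [<- <-] := sh p (introT andP (conj Tp p0)).
apply: wk_path => //; apply: (wk_sub _ _ H); first exact: le_trans pq.
by rewrite gerDr.
Qed.

Hypothesis Hc : critical_value f L c.

(** The remainder of the turn, closed by the piece itself charged at rate [C0], is a loop of
    nonnegative action. With the lower bound contained in [step], this bounds running actions
    uniformly over the loops. *)
Lemma loop_cost (T : R) x k a G l (p q : R) : 0 < T -> intvec k -> loop T x k a G l ->
  - T <= p -> p <= 0 -> p <= q -> q <= p + T -> l q - l p <= a + C0 * (q - p).
Proof.
move=> T0 ik H Tp p0 pq qT.
have P1 := loop_path H Tp p0 pq qT.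
have [W _ _ _] := H.
have P2 : path_to D (q - p) (G p) (G q) (C0 * (q - p)).
  apply: (path_C0 (a := l q - l p)); apply: wk_path => //; apply: (wk_sub Tp _ W).
  by rewrite (le_trans qT)// gerDr.
have := path_cat _ _ P1 (path_shift ik P2); rewrite !subr_ge0 => /(_ qT pq).
rewrite (_ : p + T - q + (q - p) = T); last by ring.
by move=> /(loop_ge0 Hc T0 ik); lra.
Qed.

Lemma aubry_loops x : aubry f L c x -> forall n : nat, exists T k a G l,
  [/\ n.+1%:R <= T, intvec k, 0 <= a <= n.+1%:R^-1 & loop T x k a G l].
Proof.
move=> Ax n.
have : (peierls f L c x x < (n.+1%:R^-1)%:E)%E by rewrite Ax lte_fin invr_gt0.
move=> /(peierls_lt D n.+1%:R)[T [a [k [nT _ ik H an]]]].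
have T0 : 0 < T by apply: lt_le_trans nT.
have a0 := loop_ge0 Hc T0 ik H.
have [G [l Gl]] := loop_exists T0 ik H.
by exists T, k, a, G, l; split=> //; rewrite a0 ltW.
Qed.

(** Loops at [x] of duration tending to infinity and action tending to 0 converge along an
    ultrafilter, with their running actions. For large [n] the remainder of the n-th loop after the
    piece [[p, q]] nearly joins [g q] to [g p] with action close to [l p - l q]. *)
Lemma aubry_curve x : aubry f L c x -> exists g l,
  [/\ forall p q, wk D g l p q, g 0 = x &
   forall p q : R, p <= 0 -> p <= q -> (peierls f L c (g q) (g p) <= (l p - l q)%:E)%E].
Proof.
move=> Ax.
have [T exT] := choice (aubry_loops Ax).
have [k exk] := choice exT; have [a exa] := choice exk.
have [G exG] := choice exa; have [l Hl] := choice exG.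
have [U [UU Uoo]] := @ultraFilterLemma nat \oo _.
have TM (M : R) : \forall n \near U, M <= T n.
  apply: Uoo; near=> n; have [h _ _ _] := Hl n; apply: le_trans h.
  by rewrite -natr1 ler_wpDr//; near: n; exact: nbhs_infty_ger.
have W n : wk D (G n) (l n) (- T n) (T n) by have [_ _ _ []] := Hl n.
have T0 n : 0 < T n by have [h _ _ _] := Hl n; apply: lt_le_trans h.
have G0 n : G n 0 = x by have [_ _ _ []] := Hl n.
have l0 n : l n 0 = 0 by have [_ _ _ []] := Hl n.
have a1 n : a n <= 1.
  by have [_ _ /andP[_ h] _] := Hl n; rewrite (le_trans h)// invf_le1// ler1n.
have gb (s : R) : \forall n \near U, `|G n s| <= `|x| + bB D * bK D * `|s|.
  apply: filterS (TM `|s|) => n sT.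
  rewrite -(subrK x (G n s)) addrC (le_trans (ler_normD _ _))// lerD2l -(G0 n).
  have [s0|/ltW s0] := leP 0 s.
    have [|||h _ _] := W n 0 s; rewrite ?oppr_le0 ?(ltW (T0 n))//.
      by rewrite (le_trans _ sT)// ler_norm.
    by rewrite (le_trans h)// subr0 ger0_norm.
  have [|||h _ _] := W n s 0; rewrite ?(ltW (T0 n))//.
    by rewrite lerNl (le_trans _ sT)// -normrN ler_norm.
  by rewrite distrC (le_trans h)// sub0r ler0_norm.
have lb (s : R) : \forall n \near U, `|l n s| <= 1 + (`|C0| + `|C1|) * `|s|.
  apply: filterS (TM `|s|) => n sT; have [_ ik _ lp] := Hl n.
  have N0 : 0 <= `|C0| * `|s| by rewrite mulr_ge0.
  have N1 : 0 <= `|C1| * `|s| by rewrite mulr_ge0.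
  have [s0|/ltW s0] := leP 0 s.
    have sTn : s <= T n by rewrite (le_trans _ sT)// ler_norm.
    have [|||_ h _] := W n 0 s; rewrite ?oppr_le0 ?(ltW (T0 n))//.
    have := loop_cost (p := 0) (q := s) (T0 n) ik lp.
    rewrite oppr_le0 add0r ltW// => /(_ isT (lexx _) s0 sTn).
    move: h; rewrite l0 !subr0 => h1 h2.
    have h3 : C0 * s <= `|C0| * `|s| by rewrite -normrM ler_norm.
    have h4 : C1 * s <= `|C1| * `|s| by rewrite -normrM ler_norm.
    by rewrite ler_norml; apply/andP; split; move: (a1 n) h1 h2 h3 h4 N0 N1; lra.
  have sTn : - T n <= s by rewrite lerNl (le_trans _ sT)// -normrN ler_norm.
  have [|||_ h _] := W n s 0; rewrite ?(ltW (T0 n))//.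
  have := loop_cost (p := s) (q := 0) (T0 n) ik lp sTn s0 s0.
  rewrite -lerBlDr sub0r => /(_ sTn).
  move: h; rewrite l0 !sub0r => h1 h2.
  have h3 : C0 * - s <= `|C0| * `|s| by rewrite -(normrN s) -normrM ler_norm.
  have h4 : C1 * - s <= `|C1| * `|s| by rewrite -(normrN s) -normrM ler_norm.
  by rewrite ler_norml; apply/andP; split; move: (a1 n) h1 h2 h3 h4 N0 N1; lra.
have [g Hg] := choice (fun s => ultra_bounded_cvg (gb s)).
have [h Hh] := choice (fun s => ultra_bounded_cvg_R (lb s)).
exists g, h; split.
- move=> p q; apply: (wk_limit (g := G) (l := l)) => [s _|s _|]; [exact: Hg|exact: Hh|].
  near=> n; apply: (wk_sub _ _ (W n)).
    by rewrite lerNl; near: n; exact: TM.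
  by near: n; exact: TM.
- apply: (cvg_unique _ (Hg 0)); first exact: norm_hausdorff.
  by rewrite (_ : (fun n => G n 0) = fun=> x); [exact: cvg_cst|exact/funext].
move=> p q p0 pq; apply: peierls_le => M e e0.
have C01 : 0 < `|C0| + 1 by rewrite ltr_wpDl.
(* A connection of duration [r] costs at most [e / 8]. Two connections, two values of the running
   action and the loop's own action spend five eighths of [e]. *)
have [r [r0 rE]] : exists r : R, 0 < r /\ (`|C0| + 1) * r = e / 8.
  exists (e / 8 / (`|C0| + 1)); split; first by rewrite !divr_gt0.
  by rewrite mulrC divfK// gt_eqF.
have Cr : C0 * r <= e / 8.
  by rewrite -rE ler_wpM2r ?(ltW r0)// (le_trans (ler_norm _))// lerDl.
have [d1 d10 reach1] := local_reach D (g q) r0.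
have [d2 d20 reach2] := local_reach D (g p) r0.
have e8 : 0 < e / 8 by rewrite divr_gt0.
have : \forall n \near U, [/\ `|G n q - g q| < d1, `|G n p - g p| < d2,
   `|h q - l n q| < e / 8 & `|h p - l n p| < e / 8] /\ [/\ a n <= e / 8, `|p| <= T n, q - p <= T n & M + (q - p) <= T n].
  near=> n; split; split.
  - by rewrite distrC; near: n; by move/cvgrPdist_lt : (Hg q); apply.
  - by rewrite distrC; near: n; by move/cvgrPdist_lt : (Hg p); apply.
  - by near: n; by move/cvgrPdist_lt : (Hh q); apply.
  - by near: n; by move/cvgrPdist_lt : (Hh p); apply.
  - have [_ _ /andP[_ an] _] := Hl n; apply: (le_trans an); apply/ltW.
    by near: n; apply: Uoo; exact: (near_infty_natSinv_lt (PosNum e8)).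
  - by near: n; exact: TM.
  - by near: n; exact: TM.
  - by near: n; exact: TM.
move=> /filter_ex[n [[n1 n2 n3 n4] [n5 n6 n8 n7]]].
have [_ ik _ lp] := Hl n.
have [P1 _] := reach1 _ n1; have [_ P2] := reach2 _ n2.
have Tp : - T n <= p by rewrite lerNl (le_trans _ n6)// -normrN ler_norm.
have qT : q <= p + T n by rewrite -lerBlDl.
have P3 := loop_path lp Tp p0 pq qT.
have Q0 : 0 <= p + T n - q by rewrite subr_ge0.
(* From [g q] to [G n q], along the loop to [G n p + k n], then to [g p + k n]. *)
have P4 := path_cat (addr_ge0 (ltW r0) Q0) (ltW r0) (path_cat (ltW r0) Q0 P1 P3) (path_shift ik P2).
eexists _, _, (k n); split; last 2 first.
- exact: P4.
- move: n3 n4 n5 Cr; rewrite !ltr_norml => /andP[m1 m2] /andP[m3 m4]; lra.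
- by move: n7 r0; lra.
- exact: (addr_ge0 (addr_ge0 (ltW r0) Q0) (ltW r0)).
- exact: ik.
Unshelve. all: by end_near. Qed.

End AubryCurve.

Theorem theorem3p8 (R : realType) (d m : nat) (hm1 : (1 <= m)%N) (hmd : (m <= d)%N)
  (f : 'I_m -> 'rV[R]_d -> 'rV[R]_d) (L : 'rV[R]_d -> 'rV[R]_m -> R) (cbar : R)
  (HF : hypF f) (HL : hypL L) (HS : hypS f L) (Hc : critical_value f L cbar)
  (x : 'rV[R]_d) :
  (aubry f L cbar x <->
     exists (gamma : R -> 'rV[R]_d) (u : R -> 'rV[R]_m), calibrated_at f L cbar x gamma u)
  /\ (forall (gamma : R -> 'rV[R]_d) (u : R -> 'rV[R]_m),
        calibrated_at f L cbar x gamma u -> forall t : R, aubry f L cbar (gamma t)).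
Proof.
have [D _] := bounds_exist cbar HF HL.
split; first split.
- move=> /(aubry_curve D Hc)[g [l [W g0 up]]].
  have [u [adm cst]] := wk_admissible W.
  exists g, u; split=> //; split=> // t t0.
  (* The barrier is pinched: [up] and the comparison of cost with running action bound it from
     above, [peierls_ge] from below. The cases (0, t) and (-t, 0) are the two calibration
     identities. *)
  have cal (p q : R) : p <= 0 -> p <= q ->
      peierls f L cbar (g q) (g p) = (- cost L p q g u + (cbar * (q - p))%:E)%E.
    move=> p0 pq; have [k kE kl] := cst p q pq.
    apply/eqP; rewrite eq_le kE -EFinN -EFinD addrC (peierls_ge D Hc pq (adm p q pq) kE) andbT.
    by rewrite (le_trans (up p q p0 pq))// lee_fin; move: kl; lra.
  have := cal 0 t (lexx _) t0; have := cal (- t) 0.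
  by rewrite oppr_le0 subr0 sub0r opprK g0 => /(_ t0 t0).
(* Calibration at time 0 involves a cost over a single point, which is 0. *)
- move=> [g [u [_ [g0 /(_ 0 (lexx _))[]]]]].
  rewrite /aubry g0 /cost => -> _.
  rewrite (_ : `[0, 0]%classic = [set 0]) ?set_itv1// integral_set1.
  by rewrite oppe0 mulr0 adde0.
(* A time [t >= 0] is the end of a calibrated arc that starts at [x], a time [t <= 0] the start of
   one that ends at [x]. *)
move=> g u [adm [g0 H]] t.
have [t0|/ltW t0] := leP 0 t.
  have [E _] := H t t0; rewrite -g0 in E.
  by have [] := calibrated_diag D Hc t0 (adm 0 t t0) _; rewrite ?subr0.
have nt0 : 0 <= - t by rewrite oppr_ge0.
have [_] := H (- t) nt0; rewrite opprK -g0 => E.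
by have [] := calibrated_diag D Hc t0 (adm t 0 t0) _; rewrite ?sub0r.
Qed.
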